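(* Let $\ell\in\mathbb{Z}_{\ge 0}$ and $a\in\mathbb{R}$, and let $f:\mathbb{C}_+\to\mathbb{C}$ and $g:\mathbb{C}_+\to\mathbb{C}_+$ be analytic functions. Then the operator $W_{f,g,\max}$ is $\mathcal{C}_a$-selfadjoint on $\mathbb{B}_\ell(\mathbb{C}_+)$ if and only if one of the following three cases holds (for all $w\in\mathbb{C}_+$): (1) $g(w)=\mu$ and $f(w)=\dfrac{\delta}{(w+\mu-ia)^{\ell+2}}$, where $\mu\in\mathbb{C}_+$ and $\delta\in\mathbb{C}$; (2) $g(w)=w+\gamma$ and $f(w)=\lambda$, where $\gamma\in\mathbb{C}$ with $\operatorname{Re}\gamma\ge 0$ and $\lambda\in\mathbb{C}$; (3) $g(w)=-\dfrac{\beta}{\alpha}-\dfrac{2}{\alpha(w-ia)-\beta}$ and $f(w)=\dfrac{\delta}{(\alpha(w-ia)-\beta)^{\ell+2}}$, where $\alpha\in\mathbb{C}\setminus\{0\}$, $\beta,\delta\in\mathbb{C}$, and either $\operatorname{Re}\frac{\beta}{\alpha}=\operatorname{Im}\frac1\alpha=0$ and $\operatorname{Re}\frac1\alpha<0$, or $\operatorname{Re}\frac{\beta}{\alpha}<0$ and $\left(\operatorname{Re}\frac{\beta}{\alpha}\right)^2\ge\operatorname{Re}\frac1\alpha+\frac1{|\alpha|}$. In this case, the operator $W_{f,g,\max}$ is bounded.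
   Context: $\mathbb{C}_+=\{z\in\mathbb{C}:\operatorname{Re}z>0\}$. For $\ell\in\mathbb{Z}_{\ge0}$, the weighted Bergman space $\mathbb{B}_\ell(\mathbb{C}_+)$ is the Hilbert space of analytic functions $h:\mathbb{C}_+\to\mathbb{C}$ with $\|h\|^2=\frac1\pi\int_{-\infty}^{\infty}\int_0^\infty x^\ell|h(x+iy)|^2\,dx\,dy<\infty$. For analytic $f:\mathbb{C}_+\to\mathbb{C}$ and $g:\mathbb{C}_+\to\mathbb{C}_+$, the maximal weighted composition operator $W_{f,g,\max}$ has domain $\{h\in\mathbb{B}_\ell(\mathbb{C}_+): f\cdot(h\circ g)\in\mathbb{B}_\ell(\mathbb{C}_+)\}$ and acts by $W_{f,g,\max}h=f\cdot(h\circ g)$. It is called bounded if its domain is all of $\mathbb{B}_\ell(\mathbb{C}_+)$ and there is $L>0$ with $\|W_{f,g,\max}h\|\le L\|h\|$ for every $h$. A conjugation is an anti-linear isometric involution. For a conjugation $\mathcal{C}$, a (densely defined, not necessarily bounded) linear operator $B$ is called $\mathcal{C}$-selfadjoint if $B=\mathcal{C}B^*\mathcal{C}$ (equality including domains). For $a\in\mathbb{R}$, $\mathcal{C}_a$ is the conjugation on $\mathbb{B}_\ell(\mathbb{C}_+)$ given by $\mathcal{C}_a h(z)=\overline{h(\overline{z}+ia)}$.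
   Formalization: The ''only if'' direction is stated for f not identically zero on C_+, since for f = 0 the operator is zero and selfadjoint for every g (e.g. g(w) = 2w, which fits none of (1)-(3)); the ''if'' direction and boundedness are stated for all f. *)

(* Defs.v *)
From HB Require Import structures.
From mathcomp Require Import all_boot all_order all_algebra.
From mathcomp Require Import complex.
From mathcomp Require Import all_classical all_reals all_analysis.

Set Implicit Arguments.
Unset Strict Implicit.
Unset Printing Implicit Defensive.

Import Order.TTheory GRing.Theory Num.Theory.
Import numFieldNormedType.Exports.

Local Open Scope classical_set_scope.
Local Open Scope ring_scope.
Local Open Scope complex_scope.

(* A function on the right half-plane is represented by a total function
   R[i] -> R[i] whose values off [Cplus] are irrelevant: every notion below
   depends only on the values on [Cplus], and two functions are identified
   when they are related by [eq_Cplus]. *)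

Section HalfPlane.
Context {R : realType}.
Implicit Types (f g h k u v : R[i] -> R[i]).

Definition Cplus : set R[i] := [set z | 0 < complex.Re z].

Definition eq_Cplus h k : Prop := forall z, Cplus z -> h z = k z.

(* [derivable] over the field R[i], hence differentiability in the complex
   sense. *)
Definition analytic h : Prop :=
  forall z, Cplus z -> derivable (h : R[i]^o -> R[i]^o) z 1.

Definition Cplus_integral (F : R[i] -> R) : \bar R :=
  (\int[lebesgue_measure]_y
     \int[lebesgue_measure]_(x in `]0%R, +oo[) (F (x +i* y))%:E)%E.

End HalfPlane.

Section Bergman.
Context {R : realType}.
Variable l : nat.
Implicit Types (f g h k u v : R[i] -> R[i]).

Definition bergman_normsq h : \bar R :=
  let F z := complex.Re z ^+ l * Normc.normc (h z) ^+ 2 in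
  ((pi^-1)%:E * Cplus_integral F)%E.

Definition bergman : set (R[i] -> R[i]) :=
  [set h | analytic h /\ (bergman_normsq h < +oo)%E].

Definition bergman_norm h : R := Num.sqrt (fine (bergman_normsq h)).

Definition bergman_inner h k : R[i] :=
  let F z := (complex.Re z ^+ l)%:C * (h z * conjc (k z)) in
  (pi^-1)%:C * (fine (Cplus_integral (fun z => complex.Re (F z)))
             +i* fine (Cplus_integral (fun z => complex.Im (F z)))).

(* Operators in the Bergman space, possibly not everywhere defined, are given
   by their graphs; [B h k] reads "h is in the domain of B and B h = k". *)
Definition operator := (R[i] -> R[i]) -> (R[i] -> R[i]) -> Prop.

Definition domain (B : operator) : set (R[i] -> R[i]) :=
  [set h | exists k, B h k].

Definition densely_defined (B : operator) : Prop :=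
  forall h (e : R), bergman h -> 0 < e ->
    exists2 k, domain B k & bergman_norm (fun z => h z - k z) < e.

Definition bounded_op (B : operator) : Prop :=
  (forall h, bergman h -> domain B h) /\
  (exists2 L : R, 0 < L &
     forall h k, B h k -> bergman_norm k <= L * bergman_norm h).

(* For [domain B] contained in [bergman l], single-valued modulo [eq_Cplus]
   exactly when [B] is densely defined. *)
Definition adjoint (B : operator) : operator := fun u v =>
  [/\ bergman u, bergman v &
      forall h k, B h k -> bergman_inner k u = bergman_inner h v].

(* The composition C B C, where [C] is an everywhere defined map. *)
Definition conj_op (C : (R[i] -> R[i]) -> (R[i] -> R[i])) (B : operator) :
    operator :=
  fun u v => exists2 w, B (C u) w & eq_Cplus v (C w).

Definition C_selfadjoint (C : (R[i] -> R[i]) -> (R[i] -> R[i]))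
    (B : operator) : Prop :=
  densely_defined B /\ forall u v, B u v <-> conj_op C (adjoint B) u v.

Definition Wmax f g : operator := fun h k =>
  [/\ bergman h, bergman (fun z => f z * h (g z)) &
      eq_Cplus k (fun z => f z * h (g z))].

Definition Cconj (a : R) h : R[i] -> R[i] :=
  fun z => conjc (h (conjc z + (0 +i* a))).

Definition case_constant (a : R) f g : Prop :=
  exists mu delta : R[i], Cplus mu /\
    forall w, Cplus w ->
      g w = mu /\ f w = delta / (w + mu - (0 +i* a)) ^+ (l + 2).

Definition case_translation f g : Prop :=
  exists gamma lambda : R[i], 0 <= complex.Re gamma /\
    forall w, Cplus w -> g w = w + gamma /\ f w = lambda.

Definition case_fractional (a : R) f g : Prop :=
  exists alpha beta delta : R[i],
    [/\ alpha != 0,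
        [/\ complex.Re (beta / alpha) = 0, complex.Im (1 / alpha) = 0
          & complex.Re (1 / alpha) < 0] \/
        (complex.Re (beta / alpha) < 0 /\
         complex.Re (1 / alpha) + 1 / Normc.normc alpha
           <= complex.Re (beta / alpha) ^+ 2)
      & forall w, Cplus w ->
          g w = - (beta / alpha) - 2 / (alpha * (w - (0 +i* a)) - beta) /\
          f w = delta / (alpha * (w - (0 +i* a)) - beta) ^+ (l + 2)].

End Bergman.

(* Main.v *)
(* Put n = l + 2 and E_z(w) = (w + z)^-n. Green's formula for the conj-derivative,
   applied with a cutoff to h(w) / (z - w) * (2 Re w / (conj w + z))^(l + 1) when
   h(z) = 0, shows that <h, E_(conj z)> is a constant multiple of h(z); hence the
   combinations of the E_z are dense.

   Sufficiency: in the three cases f = delta F^n with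
   F(w) (w + g(z) - ia) = F(z) (g(w) + z - ia), which says that W maps E_(z - ia)
   to f(z) E_(g(z) - ia), whence <W h, C u> = <h, C W u> on the E_z. On their span W is
   bounded as soon as the kernel A^n - B^n is positive, where
   A = L / (w + conj v) and B = F(w) conj(F(v)) / (g(w) + conj(g(v))) (with arguments
   shifted by ia); this follows from the positivity of
   L (g(w) + conj(g(v))) - F(w) conj(F(v)) (w + conj v), a sum of two rank-one
   kernels under the parameter conditions. Density and Fatou's lemma extend both
   facts to the whole space, so that W is bounded and C-selfadjoint.

   Necessity: C-selfadjointness gives f(w) (w + g(z) - ia)^n = f(z) (g(w) + z - ia)^n.
   An n-th root can be extracted because a continuous root of unity is constant, which
   makes f^(-1/n) affine and g a Moebius map; the condition Re g > 0 then yields the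
   parameter conditions. *)
From HB Require Import structures.
Require Import Defs.
From mathcomp Require Import all_boot all_order all_algebra.
From mathcomp Require Import complex.
From mathcomp Require Import all_classical all_reals all_analysis.
From mathcomp Require Import measurable_realfun.
From mathcomp Require Import ring lra.

Set Implicit Arguments.
Unset Strict Implicit.
Unset Printing Implicit Defensive.

Import Order.TTheory GRing.Theory Num.Theory.
Import numFieldNormedType.Exports.

Local Open Scope classical_set_scope.
Local Open Scope ring_scope.
Local Open Scope complex_scope.

(** The factor 2 Re w / (conj w + z) is chosen because its conj-derivative is (z - w) / (conj w +
    z)^2. This z - w cancels the denominator of h(w) / (z - w), so the (l + 1)-st power
    differentiates exactly to a multiple of (Re w)^l h(w) / (conj w + z)^(l + 2), the integrand of
    <h, E_(conj z)>. The function itself keeps a spare factor Re w, which pays for the growth of the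
    derivative of the cutoff near the imaginary axis. The condition h(z) = 0 makes the singularity
    at z removable, but only continuity is established there; hence a divergence theorem with one
    exceptional point, proved by bisection in the manner of Goursat from pointwise differentiability
    alone. The reproducing constant is never computed: its positivity and its independence of z are
    enough. The obstacle on the operator side is that the adjoint of an unbounded W and its domain
    are out of reach. For sufficiency, boundedness comes first and makes the domain of W the whole
    space; for necessity, the adjoint is evaluated on kernels only, where the reproducing property
    gives it without any boundedness. *)

Local Notation normc := Normc.normc.

(** * Complex numbers and Wirtinger derivatives *)

Section ComplexBasics.
Context {R : realType}.
Implicit Types (z w : R[i]) (r : R).

Lemma normc_ge0 z : 0 <= normc z.
Proof. by case: z => x y; exact: sqrtr_ge0. Qed.

Lemma normc_sqr z : normc z ^+ 2 = complex.Re z ^+ 2 + complex.Im z ^+ 2.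
Proof. by case: z => x y /=; rewrite sqr_sqrtr// addr_ge0// sqr_ge0. Qed.

Lemma normcX z n : normc (z ^+ n) = normc z ^+ n.
Proof.
elim: n => [|n IH]; first by rewrite !expr0 Normc.normc1.
by rewrite !exprS Normc.normcM IH.
Qed.

Lemma normc_conj z : normc (conjc z) = normc z.
Proof. by case: z => x y /=; rewrite sqrrN. Qed.

Lemma conjcD z w : conjc (z + w) = conjc z + conjc w.
Proof. exact: rmorphD. Qed.

Lemma conjcM z w : conjc (z * w) = conjc z * conjc w.
Proof. exact: rmorphM. Qed.

Lemma conjcB z w : conjc (z - w) = conjc z - conjc w.
Proof. exact: rmorphB. Qed.

Lemma conjcX z n : conjc (z ^+ n) = conjc z ^+ n.
Proof. exact: rmorphXn. Qed.

Lemma rcD (x y : R) : (x + y)%:C = x%:C + y%:C. Proof. exact: rmorphD. Qed.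
Lemma rcN (x : R) : (- x)%:C = - x%:C. Proof. exact: rmorphN. Qed.
Lemma rcM (x y : R) : (x * y)%:C = x%:C * y%:C. Proof. exact: rmorphM. Qed.
Lemma rcX (x : R) n : (x ^+ n)%:C = x%:C ^+ n. Proof. exact: rmorphXn. Qed.
Lemma rcV (x : R) : (x^-1)%:C = x%:C^-1. Proof. exact: fmorphV. Qed.
Lemma rc1 : 1%:C = 1 :> R[i]. Proof. by []. Qed.
Lemma rc_nat n : (n%:R)%:C = n%:R :> R[i]. Proof. exact: rmorph_nat. Qed.
Definition rcE := (rcD, rcN, rcM, rcX, rcV, rc1, rc_nat).
Lemma rc_neq0 (x : R) : x != 0 -> x%:C != 0.
Proof. by move=> x0; apply/eqP => -[]; exact/eqP. Qed.

Lemma normcC r : normc (r%:C) = `|r|.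
Proof. by rewrite /= expr0n /= addr0 sqrtr_sqr. Qed.

Lemma normcD z w : normc (z + w) <= normc z + normc w.
Proof. exact: le_normcD. Qed.

Lemma normcBC z w : normc (z - w) = normc (w - z).
Proof. by rewrite -normcN opprB. Qed.

Lemma normcB z w : normc (z - w) <= normc z + normc w.
Proof. by rewrite (le_trans (normcD _ _))// normcN. Qed.

Lemma lerB_normc z w : normc z - normc w <= normc (z - w).
Proof. by rewrite lerBlDr (le_trans _ (normcD _ _))// subrK. Qed.

Lemma normc_eq0 z : (normc z == 0) = (z == 0).
Proof.
apply/eqP/eqP => [/Normc.eq0_normc//|->]; exact: Normc.normc0.
Qed.

Lemma normc_gt0 z : (0 < normc z) = (z != 0).
Proof. by rewrite lt_def normc_ge0 andbT normc_eq0. Qed.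

Lemma normr_Re_le z : `|complex.Re z| <= normc z.
Proof.
rewrite -ler_sqr ?nnegrE ?normc_ge0// normc_sqr real_normK ?num_real//.
by rewrite lerDl sqr_ge0.
Qed.

Lemma normr_Im_le z : `|complex.Im z| <= normc z.
Proof.
rewrite -ler_sqr ?nnegrE ?normc_ge0// normc_sqr real_normK ?num_real//.
by rewrite lerDr sqr_ge0.
Qed.

Lemma normc_le_ReIm z : normc z <= `|complex.Re z| + `|complex.Im z|.
Proof.
have -> : z = (complex.Re z)%:C + 'i * (complex.Im z)%:C by rewrite -complexE.
apply: le_trans (normcD _ _) _; rewrite Normc.normcM !normcC.
by case: z => x y /=; rewrite !(expr0n,expr1n,mul0r,mul1r,subr0,addr0,add0r) /= sqrtr1 mul1r.
Qed.

Lemma mulcJ z : z * conjc z = (normc z ^+ 2)%:C.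
Proof.
rewrite normc_sqr; case: z => x y /=; apply/eqP; rewrite eq_complex /= -!expr2.
by apply/andP; split; apply/eqP; ring.
Qed.

Lemma ReCD z w : complex.Re (z + w) = complex.Re z + complex.Re w.
Proof. by case: z; case: w. Qed.
Lemma ImCD z w : complex.Im (z + w) = complex.Im z + complex.Im w.
Proof. by case: z; case: w. Qed.
Lemma ReCN z : complex.Re (- z) = - complex.Re z. Proof. by case: z. Qed.
Lemma ImCN z : complex.Im (- z) = - complex.Im z. Proof. by case: z. Qed.
Lemma ReCM z w : complex.Re (z * w) =
  complex.Re z * complex.Re w - complex.Im z * complex.Im w.
Proof. by case: z; case: w. Qed.
Lemma ImCM z w : complex.Im (z * w) =
  complex.Re z * complex.Im w + complex.Im z * complex.Re w.
Proof. by case: z => a b; case: w => c d /=; ring. Qed.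
Lemma Re_conjc z : complex.Re (conjc z) = complex.Re z. Proof. by case: z. Qed.
Lemma Im_conjc z : complex.Im (conjc z) = - complex.Im z. Proof. by case: z. Qed.
Definition ReImE := (ReCD, ImCD, ReCN, ImCN, ReCM, ImCM, Re_conjc, Im_conjc).

Lemma complex_ext z w : complex.Re z = complex.Re w -> complex.Im z = complex.Im w ->
  z = w.
Proof. by case: z => a b; case: w => c d /= -> ->. Qed.

End ComplexBasics.

Section Wirtinger.
Context {R : realType}.
Implicit Types (G H : R[i] -> R[i]) (w z A B : R[i]) (e d : R).

Definition Ccontinuous_at G w := forall e, 0 < e -> exists2 d, 0 < d &
  forall v, normc (v - w) < d -> normc (G v - G w) < e.

(* Real differentiability at [w], with A = dG/dw and B = dG/d(conj w). *)
Definition is_wirtinger G w A B := forall e, 0 < e -> exists2 d, 0 < d &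
  forall v, normc (v - w) < d ->
  normc (G v - G w - (A * (v - w) + B * conjc (v - w))) <= e * normc (v - w).

(** The vanishing conj-derivative is the Cauchy-Riemann equation. *)
Definition Cdifferentiable G w := exists A, is_wirtinger G w A 0.

Lemma is_wirtinger_lipschitz G w A B : is_wirtinger G w A B ->
  exists2 d, 0 < d & forall v, normc (v - w) < d ->
    normc (G v - G w) <= (normc A + normc B + 1) * normc (v - w).
Proof.
move=> /(_ 1 ltr01)[d d0 H]; exists d => // v /H; rewrite mul1r => {}H.
have {1}-> : G v - G w = (G v - G w - (A * (v - w) + B * conjc (v - w)))
  + A * (v - w) + B * conjc (v - w) by ring.
apply: le_trans (normcD _ _) _; apply: le_trans (lerD (normcD _ _) (lexx _)) _.
rewrite !Normc.normcM normc_conj !mulrDl mul1r (addrC _ (normc (v - w))).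
by rewrite -addrA lerD2r.
Qed.

Lemma is_wirtinger_continuous G w A B : is_wirtinger G w A B ->
  Ccontinuous_at G w.
Proof.
move=> /is_wirtinger_lipschitz[d d0 H] e e0.
set M := normc A + normc B + 1 in H.
have M0 : 0 < M by rewrite ltr_wpDl// addr_ge0 ?normc_ge0.
exists (Num.min d (e / M)); first by rewrite lt_min d0 divr_gt0.
move=> v; rewrite lt_min => /andP[/H vd]; rewrite ltr_pdivlMr// mulrC.
exact: le_lt_trans.
Qed.

Lemma is_wirtinger_near G H w A B d : 0 < d ->
  (forall v, normc (v - w) < d -> G v = H v) ->
  is_wirtinger G w A B -> is_wirtinger H w A B.
Proof.
move=> d0 GH WG e /WG[d' d'0 {}WG]; exists (Num.min d d').
  by rewrite lt_min d0.
move=> v; rewrite lt_min => /andP[vd /WG]; rewrite !GH// subrr Normc.normc0//.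
Qed.

Lemma is_wirtinger_cst c w : is_wirtinger (fun=> c) w 0 0.
Proof.
move=> e e0; exists 1 => // v _.
by rewrite !mul0r addr0 !subrr Normc.normc0 mulr_ge0 ?normc_ge0// ltW.
Qed.

Lemma is_wirtinger_id w : is_wirtinger id w 1 0.
Proof.
move=> e e0; exists 1 => // v _.
by rewrite mul0r addr0 mul1r subrr Normc.normc0 mulr_ge0 ?normc_ge0// ltW.
Qed.

Lemma is_wirtinger_conj w : is_wirtinger conjc w 0 1.
Proof.
move=> e e0; exists 1 => // v _.
by rewrite mul0r add0r mul1r -rmorphB subrr Normc.normc0 mulr_ge0 ?normc_ge0// ltW.
Qed.

Lemma is_wirtingerD G H w A B A' B' : is_wirtinger G w A B ->
  is_wirtinger H w A' B' ->
  is_wirtinger (fun v => G v + H v) w (A + A') (B + B').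
Proof.
move=> WG WH e e0; have e20 : 0 < e / 2 by rewrite divr_gt0.
have [d d0 {}WG] := WG _ e20; have [d' d'0 {}WH] := WH _ e20.
exists (Num.min d d'); first by rewrite lt_min d0.
move=> v; rewrite lt_min => /andP[/WG h1 /WH h2].
rewrite (_ : G v + H v - (G w + H w) - _ = (G v - G w - (A * (v - w) + B * conjc (v - w))) +
  (H v - H w - (A' * (v - w) + B' * conjc (v - w)))); last first.
  by set X := conjc _; ring.
rewrite (splitr e) mulrDl; exact: le_trans (normcD _ _) (lerD h1 h2).
Qed.

Let divD1M_le a b : 0 <= a -> 0 < b + 1 -> a / (b + 1) * b <= a :> R.
Proof.
by move=> a0 b0; rewrite mulrAC ler_pdivrMr// ler_wpM2l// lerDl.
Qed.

Lemma is_wirtingerM G H w A B A' B' : is_wirtinger G w A B ->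
  is_wirtinger H w A' B' ->
  is_wirtinger (fun v => G v * H v) w (A * H w + G w * A')
    (B * H w + G w * B').
Proof.
move=> WG WH e e0.
have [d1 d10 LG] := is_wirtinger_lipschitz WG.
set M := normc A + normc B + 1 in LG.
have M0 : 0 < M by rewrite ltr_wpDl// addr_ge0 ?normc_ge0.
have eM0 : 0 < e / 3 / M by rewrite !divr_gt0.
have [d2 d20 CH] := is_wirtinger_continuous WH eM0.
have nH0 : 0 < normc (H w) + 1 by rewrite ltr_wpDl ?normc_ge0.
have nG0 : 0 < normc (G w) + 1 by rewrite ltr_wpDl ?normc_ge0.
have eH0 : 0 < e / 3 / (normc (H w) + 1) by rewrite !divr_gt0.
have eG0 : 0 < e / 3 / (normc (G w) + 1) by rewrite !divr_gt0.
have [d3 d30 {}WG] := WG _ eH0; have [d4 d40 {}WH] := WH _ eG0.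
exists (Num.min (Num.min d1 d2) (Num.min d3 d4)).
  by rewrite !lt_min d10 d20 d30.
move=> v; rewrite !lt_min => /andP[/andP[/LG h1 /CH h2] /andP[/WG h3 /WH h4]].
set x := normc (v - w) in h1 h3 h4 *.
(* The remainder of a product: the remainder of each factor times the value of the other, and the
   product of the two increments, where one is Lipschitz and the other small. Each part gets e / 3;
   the [+ 1] in the radii covers vanishing values. *)
rewrite (_ : G v * H v - G w * H w - _ =
  (G v - G w - (A * (v - w) + B * conjc (v - w))) * H w +
  (H v - H w - (A' * (v - w) + B' * conjc (v - w))) * G w +
  (G v - G w) * (H v - H w)); last by set X := conjc _; ring.
apply: le_trans (normcD _ _) _; rewrite (_ : e * x = e / 3 * x + e / 3 * x + e / 3 * x); last by field.
have x0 : 0 <= x by exact: normc_ge0.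
apply: lerD; [apply: le_trans (normcD _ _) _; apply: lerD|]; rewrite Normc.normcM.
- apply: le_trans (ler_wpM2r (normc_ge0 _) h3) _.
  by rewrite mulrAC; apply: ler_wpM2r => //; apply: divD1M_le; rewrite // divr_ge0// ltW.
- apply: le_trans (ler_wpM2r (normc_ge0 _) h4) _.
  by rewrite mulrAC; apply: ler_wpM2r => //; apply: divD1M_le; rewrite // divr_ge0// ltW.
- apply: le_trans (ler_pM (normc_ge0 _) (normc_ge0 _) h1 (ltW h2)) _.
  by rewrite mulrC mulrA divfK ?gt_eqF.
Qed.

(** The outer function is complex differentiable, so the chain rule has no cross terms. *)
Lemma is_wirtinger_comp G H w A B C : is_wirtinger G w A B ->
  is_wirtinger H (G w) C 0 ->
  is_wirtinger (fun v => H (G v)) w (C * A) (C * B).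
Proof.
move=> WG WH e e0.
have [d1 d10 LG] := is_wirtinger_lipschitz WG.
set M := normc A + normc B + 1 in LG.
have M0 : 0 < M by rewrite ltr_wpDl// addr_ge0 ?normc_ge0.
have nC0 : 0 < normc C + 1 by rewrite ltr_wpDl ?normc_ge0.
have eM0 : 0 < e / 2 / M by rewrite !divr_gt0.
have eC0 : 0 < e / 2 / (normc C + 1) by rewrite !divr_gt0.
have CG := is_wirtinger_continuous WG.
have [d2 d20 {}WG] := WG _ eC0; have [d3 d30 {}WH] := WH _ eM0.
have [d4 d40 {}CG] := CG _ d30.
exists (Num.min (Num.min d1 d2) d4); first by rewrite !lt_min d10 d20 d40.
move=> v; rewrite !lt_min => /andP[/andP[/LG h1 /WG h2] /CG/WH h3].
set x := normc (v - w) in h1 h2 *.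
rewrite (_ : H (G v) - H (G w) - _ =
  C * (G v - G w - (A * (v - w) + B * conjc (v - w))) +
  (H (G v) - H (G w) - (C * (G v - G w) + 0 * conjc (G v - G w)))); last first.
    by set X := conjc _; set Y := conjc _; ring.
rewrite (splitr e) mulrDl; apply: le_trans (normcD _ _) _; apply: lerD.
- rewrite Normc.normcM; apply: le_trans (ler_wpM2l (normc_ge0 _) h2) _.
  rewrite mulrA; apply: ler_wpM2r; first exact: normc_ge0.
  by rewrite mulrC; apply: divD1M_le; rewrite // divr_ge0// ltW.
- apply: le_trans h3 _; apply: le_trans (ler_wpM2l (ltW eM0) h1) _.
  by rewrite mulrA divfK ?gt_eqF.
Qed.

Lemma is_wirtinger_inv w : w != 0 -> is_wirtinger (fun v => v^-1) w (- (w ^- 2)) 0.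
Proof.
move=> w0 e e0; have nw0 : 0 < normc w by rewrite normc_gt0.
(* The first radius forces |v| >= |w| / 2. The remainder (v - w)^2 / (v w^2) is then at most 2 |v -
   w|^2 / |w|^3, which the second radius makes at most e |v - w|. *)
exists (Num.min (normc w / 2) (e * normc w ^+ 3 / 2)).
  by rewrite lt_min !divr_gt0// mulr_gt0// exprn_gt0.
move=> v; rewrite lt_min => /andP[h1 h2].
have nv : normc w / 2 <= normc v.
  have := le_trans (lerB_normc _ _) (ltW (eq_ind _ (fun x => x < _) h1 _ (normcBC _ _))).
  lra.
have v0 : v != 0 by rewrite -normc_gt0 (lt_le_trans _ nv)// divr_gt0.
rewrite mul0r addr0 (_ : _ - _ = (v - w) * ((v - w) * (v^-1 * w ^- 2))); last first.
  by field; rewrite v0 w0.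
rewrite Normc.normcM mulrC ler_wpM2r ?normc_ge0// Normc.normcM Normc.normcM !Normc.normcV.
have nv0 : 0 < normc v by rewrite normc_gt0.
rewrite normcX mulrA ler_pdivrMr ?exprn_gt0// ler_pdivrMr//.
apply: le_trans (ltW h2) _.
rewrite (_ : e * _ / 2 = e * normc w ^+ 2 * (normc w / 2)); last by ring.
by rewrite ler_wpM2l// mulr_ge0 ?exprn_ge0 ?ltW.
Qed.

Lemma is_wirtingerV G w A B : G w != 0 -> is_wirtinger G w A B ->
  is_wirtinger (fun v => (G v)^-1) w (- (G w ^- 2) * A) (- (G w ^- 2) * B).
Proof. by move=> Gw0 WG; exact: is_wirtinger_comp WG (is_wirtinger_inv Gw0). Qed.

Lemma is_wirtingerZ c G w A B : is_wirtinger G w A B ->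
  is_wirtinger (fun v => c * G v) w (c * A) (c * B).
Proof.
move=> /(is_wirtingerM (is_wirtinger_cst c w)).
by rewrite !mul0r !add0r.
Qed.

Lemma is_wirtingerX n G w A B : is_wirtinger G w A B ->
  is_wirtinger (fun v => G v ^+ n.+1) w (n.+1%:R * G w ^+ n * A)
    (n.+1%:R * G w ^+ n * B).
Proof.
move=> WG; elim: n => [|n IH]; first by rewrite expr0 !mul1r.
have := is_wirtingerM WG IH.
rewrite (_ : A * _ + _ = n.+2%:R * G w ^+ n.+1 * A); last first.
  by rewrite -(@natr1 _ n.+1) !exprS; ring.
rewrite (_ : B * _ + _ = n.+2%:R * G w ^+ n.+1 * B)//.
by rewrite -(@natr1 _ n.+1) !exprS; ring.
Qed.

Lemma Cdifferentiable_near G H w d : 0 < d ->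
  (forall v, normc (v - w) < d -> G v = H v) ->
  Cdifferentiable G w -> Cdifferentiable H w.
Proof. by move=> d0 GH [A WG]; exists A; exact: is_wirtinger_near d0 GH WG. Qed.

Lemma Cdifferentiable_cst c w : Cdifferentiable (fun=> c) w.
Proof. by exists 0; exact: is_wirtinger_cst. Qed.

Lemma Cdifferentiable_id w : Cdifferentiable id w.
Proof. by exists 1; exact: is_wirtinger_id. Qed.

Lemma CdifferentiableD G H w : Cdifferentiable G w -> Cdifferentiable H w ->
  Cdifferentiable (fun v => G v + H v) w.
Proof.
by move=> [A WG] [A' WH]; exists (A + A'); have := is_wirtingerD WG WH; rewrite addr0.
Qed.

Lemma CdifferentiableM G H w : Cdifferentiable G w -> Cdifferentiable H w ->
  Cdifferentiable (fun v => G v * H v) w.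
Proof.
move=> [A WG] [A' WH]; exists (A * H w + G w * A').
by have := is_wirtingerM WG WH; rewrite mul0r mulr0 addr0.
Qed.

Lemma Cdifferentiable_comp G H w : Cdifferentiable G w ->
  Cdifferentiable H (G w) -> Cdifferentiable (fun v => H (G v)) w.
Proof.
by move=> [A WG] [C WH]; exists (C * A); have := is_wirtinger_comp WG WH; rewrite mulr0.
Qed.

Lemma CdifferentiableV G w : G w != 0 -> Cdifferentiable G w ->
  Cdifferentiable (fun v => (G v)^-1) w.
Proof.
move=> G0 dG; apply: (@Cdifferentiable_comp G (fun v => v^-1)) => //.
by exists (- (G w ^- 2)); exact: is_wirtinger_inv.
Qed.

Lemma CdifferentiableX n G w : Cdifferentiable G w ->
  Cdifferentiable (fun v => G v ^+ n) w.
Proof.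
move=> dG; elim: n => [|n IH]; first exact: Cdifferentiable_cst.
apply: Cdifferentiable_near ltr01 _ (CdifferentiableM dG IH) => v _.
by rewrite exprS.
Qed.

Lemma Cdifferentiable_continuous G w : Cdifferentiable G w -> Ccontinuous_at G w.
Proof. by move=> [A]; exact: is_wirtinger_continuous. Qed.

Lemma CdifferentiableP G w :
  derivable (G : R[i]^o -> R[i]^o) w 1 <-> Cdifferentiable G w.
Proof.
split.
- move=> dG; exists ('D_1 (G : R[i]^o -> R[i]^o) w) => e e0.
  have : (fun h : R[i]^o => h^-1 *: (((G : R[i]^o -> R[i]^o) \o shift w) (h *: 1) - G w))
      @ 0^' --> 'D_1 (G : R[i]^o -> R[i]^o) w by exact: dG.
  have ec0 : 0 < e%:C by rewrite ltcR.
  move=> /cvgrPdist_lt/(_ _ ec0).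
  move=> [d /= d0 H].
  (* Radii in the library topology of [R[i]] are elements of [R[i]]; being positive they are real,
     which gives back a radius in [R]. *)
  have [dr dr0] : exists2 r : R, 0 < r & r%:C = d.
    exists (complex.Re d).
    by move: d0; rewrite ltcE /= => /andP[].
    by rewrite RRe_real// gtr0_real.
  move=> dE; exists dr => // v vd.
  have [->|vw] := eqVneq v w.
    by rewrite !subrr rmorph0 !mulr0 addr0 subrr Normc.normc0 mulr0.
  have vw0 : v - w != 0 by rewrite subr_eq0.
  have /= := H (v - w).
  rewrite sub0r normrN -dE => /(_ _ vw0).
  rewrite -[`|v - w|]/((normc (v - w))%:C) ltcR => /(_ vd).
  rewrite /shift /= -[_ *: _]/((v - w)^-1 * _) -[(v - w) *: _]/((v - w) * 1).
  rewrite mulr1 subrK -[`|_|]/((normc _)%:C) ltcR => h.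
  rewrite mul0r addr0.
  rewrite (_ : _ - _ = - (('D_1 (G : R[i]^o -> R[i]^o) w - (v - w)^-1 * (G v - G w)) * (v - w))); last first.
    by field.
  by rewrite normcN Normc.normcM ler_wpM2r ?normc_ge0// ltW.
- move=> [A WG]; apply/cvg_ex; exists A; apply/cvgrPdist_lt => e e0.
  have [er er0 erE] : exists2 r : R, 0 < r & r%:C = e.
    exists (complex.Re e).
    by move: e0; rewrite ltcE /= => /andP[].
    by rewrite RRe_real// gtr0_real.
  have e20 : 0 < er / 2 by rewrite divr_gt0.
  have [d d0 {}WG] := WG _ e20.
  exists d%:C => /=; first by rewrite ltcR.
  move=> h /=; rewrite sub0r normrN => hd h0.
  have := WG (h + w); rewrite addrK -[normc h < d]ltcR => /(_ hd).
  rewrite mul0r addr0 -[h *: 1]/(h * 1) mulr1 -[_ *: _]/(h^-1 * _).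
  rewrite -[`|_|]/((normc _)%:C) -erE ltcR => WGh.
  have nh : 0 < normc h by rewrite normc_gt0.
  rewrite -(ltr_pM2r nh) -Normc.normcM.
  rewrite (_ : _ * h = - (G (h + w) - G w - A * h)); last by field.
  by rewrite normcN (le_lt_trans WGh)// ltr_pM2r// ltr_pdivrMr// ltr_pMr// ltr1n.
Qed.

Lemma analyticP G : analytic G <-> forall w, Cplus w -> Cdifferentiable G w.
Proof. by split=> aG w /aG /CdifferentiableP. Qed.

End Wirtinger.

(** * The divergence theorem on rectangles *)

Section Plane.
Context {R : realType}.
Implicit Types (f g k : R[i] -> R) (D : set R[i]) (w z v : R[i]) (a b c d : R).

Definition pt (p : R * R) : R[i] := p.1 +i* p.2.

Definition Copen D := forall w, D w -> exists2 r, 0 < r &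
  forall v, normc (v - w) < r -> D v.

Definition Rcontinuous_at f w := forall e : R, 0 < e -> exists2 r, 0 < r &
  forall v, normc (v - w) < r -> `|f v - f w| < e.

Definition box (q : (rat * rat) * (rat * rat)) : set (R * R) :=
  `]ratr q.1.1, ratr q.1.2[ `*` `]ratr q.2.1, ratr q.2.2[.

(** An open set is the union of the rational boxes that it contains; the other boxes contribute the
    empty set, so that the union runs over a fixed countable type. *)
Lemma measurable_Copen D : Copen D ->
  measurable (pt @^-1` D : set (measurableTypeR R * measurableTypeR R)).
Proof.
move=> oD.
rewrite (_ : _ @^-1` _ = \bigcup_q
   (if `[< box q `<=` pt @^-1` D >] then box q else set0)); last first.
  apply/seteqP; split => [[x y] /= Dxy|p [q _]]; last first.
    by case: asboolP => // + qp; apply.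
  have [r r0 rD] := oD _ Dxy.
  have r20 : 0 < r / 2 by rewrite divr_gt0.
  have H t : t - r / 2 < t /\ t < t + r / 2 by split; lra.
  have [/rat_in_itvoo[x1 hx1] /rat_in_itvoo[x2 hx2]] := H x.
  have [/rat_in_itvoo[y1 hy1] /rat_in_itvoo[y2 hy2]] := H y.
  move: hx1 hx2 hy1 hy2; rewrite !in_itv /=.
  move=> /andP[hx1 hx1'] /andP[hx2 hx2'] /andP[hy1 hy1'] /andP[hy2 hy2'].
  exists ((x1, x2), (y1, y2)) => //; case: asboolP => [_|].
    by split; rewrite /= in_itv /=; apply/andP.
  case=> -[x' y'] [/=]; rewrite !in_itv /= => /andP[h1 h2] /andP[h3 h4].
  apply: rD; apply: le_lt_trans (normc_le_ReIm _) _ => /=.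
  rewrite (splitr r) ltrD// ltr_norml; apply/andP; split; lra.
apply: countable_bigcupT_measurable => [|q]; first exact: countableP.
by case: asboolP => // _; apply: measurableX; exact: measurable_itv.
Qed.

Lemma measurable_fun_Copen D f : Copen D ->
  (forall w, D w -> Rcontinuous_at f w) ->
  measurable_fun (pt @^-1` D : set (measurableTypeR R * measurableTypeR R))
    (f \o pt).
Proof.
move=> oD cf mD; apply: (measurability _ (measurable_realfun.RGenOInfty.measurableE R)) => //.
move=> /= _ [_ [t ->] <-]; rewrite preimage_itvoy.
rewrite (_ : _ `&` _ = pt @^-1` (D `&` [set w | t < f w]))//.
apply: measurable_Copen => w [/= Dw tw].
have [r r0 rD] := oD _ Dw.
have [e e0 eD] := cf _ Dw (f w - t) (ltac:(by rewrite subr_gt0)).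
exists (Num.min r e); first by rewrite lt_min r0.
move=> v; rewrite lt_min => /andP[/rD Dv /eD]; rewrite ltr_norml => /andP[h _].
by split => //=; lra.
Qed.

Definition rect a b c d : set R[i] :=
  [set w | [/\ a <= complex.Re w, complex.Re w <= b, c <= complex.Im w
             & complex.Im w <= d]].

(** * Bisection of rectangles *)

Section Bisection.
Variables (P : R -> R -> R -> R -> Prop) (a b c d : R).
Hypotheses (ab : a < b) (cd : c < d).
Hypothesis P_x : forall a' m b' c' d', a' < m -> m < b' -> c' < d' ->
  a <= a' -> b' <= b -> c <= c' -> d' <= d ->
  P a' m c' d' -> P m b' c' d' -> P a' b' c' d'.
Hypothesis P_y : forall a' b' c' m d', a' < b' -> c' < m -> m < d' ->
  a <= a' -> b' <= b -> c <= c' -> d' <= d ->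
  P a' b' c' m -> P a' b' m d' -> P a' b' c' d'.
Hypothesis P_local : forall w, rect a b c d w -> exists2 r, 0 < r &
  forall a' b' c' d', a <= a' -> a' < b' -> b' <= b ->
    c <= c' -> c' < d' -> d' <= d -> rect a' b' c' d' w ->
    b' - a' < r -> d' - c' < r ->
    (b' - a') * (d - c) = (d' - c') * (b - a) -> P a' b' c' d'.

Let W n := (b - a) / 2 ^+ n.
Let H n := (d - c) / 2 ^+ n.
Let W0 n : 0 < W n. Proof. by rewrite divr_gt0 ?subr_gt0// exprn_gt0. Qed.
Let H0 n : 0 < H n. Proof. by rewrite divr_gt0 ?subr_gt0// exprn_gt0. Qed.
Let WS n : W n = W n.+1 + W n.+1.
Proof. by rewrite /W exprS; field; rewrite expf_neq0. Qed.
Let HS n : H n = H n.+1 + H n.+1.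
Proof. by rewrite /H exprS; field; rewrite expf_neq0. Qed.

Let Q n (s : R * R) := P s.1 (s.1 + W n) s.2 (s.2 + H n).
Let inQ n (s : R * R) :=
  [/\ a <= s.1, s.1 + W n <= b, c <= s.2 & s.2 + H n <= d].

(** Were P true on all four quarters, [P_y] would glue them into two halves and [P_x] would glue the
    halves. *)
Let step n s : inQ n s -> ~ Q n s -> exists s', [/\ inQ n.+1 s', ~ Q n.+1 s',
  s.1 <= s'.1 /\ s'.1 + W n.+1 <= s.1 + W n
  & s.2 <= s'.2 /\ s'.2 + H n.+1 <= s.2 + H n].
Proof.
case: s => x y [/= h1 h2 h3 h4]; rewrite /Q /= => nQ; apply: contrapT => nex.
have W1 := W0 n.+1; have H1 := H0 n.+1; have W2 := WS n; have H2 := HS n.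
have K s : x <= s.1 -> s.1 + W n.+1 <= x + W n -> y <= s.2 ->
    s.2 + H n.+1 <= y + H n -> Q n.+1 s.
  move=> k1 k2 k3 k4; apply: contrapT => nQs; apply: nex; exists s.
  by split => //=; split => /=; lra.
apply: nQ; apply: (@P_x x (x + W n.+1)); try lra.
- apply: (@P_y _ _ y (y + H n.+1)); try lra.
    by apply: (K (x, y)) => /=; lra.
  have := K (x, y + H n.+1); rewrite /Q /= -addrA -HS; apply; lra.
- have E : x + W n = (x + W n.+1) + W n.+1 by rewrite -addrA -WS.
  apply: (@P_y _ _ y (y + H n.+1)); try lra.
    by have := K (x + W n.+1, y); rewrite /Q /= E; apply; lra.
  have := K (x + W n.+1, y + H n.+1); rewrite /Q /= E -(addrA y) -HS; apply; lra.
Qed.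

(** The nested-rectangle argument of Goursat: if P failed, a quarter would fail at every stage, and
    the failing rectangles would shrink to a point at which [P_local] is contradicted. Halving both
    sides preserves the shape, so [P_local] only has to treat rectangles similar to the given
    one. *)
Lemma rect_bisection : P a b c d.
Proof.
apply: contrapT => nP.
have [F HF] : exists F : nat -> R * R -> R * R, forall n s, inQ n s -> ~ Q n s ->
   [/\ inQ n.+1 (F n s), ~ Q n.+1 (F n s),
  s.1 <= (F n s).1 /\ (F n s).1 + W n.+1 <= s.1 + W n
  & s.2 <= (F n s).2 /\ (F n s).2 + H n.+1 <= s.2 + H n].
  (* [choice] asks for a total relation: away from the failing rectangles, [s] itself is
     returned. *)
  have [F HF] := @choice (nat * (R * R)) (R * R) (fun ns s' => inQ ns.1 ns.2 -> ~ Q ns.1 ns.2 ->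
   [/\ inQ ns.1.+1 s', ~ Q ns.1.+1 s',
    ns.2.1 <= s'.1 /\ s'.1 + W ns.1.+1 <= ns.2.1 + W ns.1
    & ns.2.2 <= s'.2 /\ s'.2 + H ns.1.+1 <= ns.2.2 + H ns.1]) (ltac:(
     move=> [n s]; have [/= [q q']|nq] := pselect (inQ n s /\ ~ Q n s);
     [by have [s' hs'] := step q q'; exists s'
     |by exists s => q q'; exfalso; apply: nq])).
  by exists (fun n s => F (n, s)) => n s; exact: (HF (n, s)).
pose S := fix S n := if n is m.+1 then F m (S m) else (a, c).
have SP n : inQ n (S n) /\ ~ Q n (S n).
  elim: n => [|n [i1 i2]]; last by have [? ?] := HF _ _ i1 i2.
  rewrite /inQ /Q /= /W /H expr0 !divr1; split; first by split; lra.
  by rewrite !subrKC.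
have mono n m : (S n).1 <= (S (n + m)%N).1 /\ (S (n + m)%N).1 + W (n + m)%N <= (S n).1 + W n
  /\ (S n).2 <= (S (n + m)%N).2 /\ (S (n + m)%N).2 + H (n + m)%N <= (S n).2 + H n.
  elim: m => [|m IH]; first by rewrite addn0; do !split.
  have [i1 i2] := SP (n + m)%N; have [_ _ [? ?] [? ?]] := HF _ _ i1 i2.
  rewrite addnS /=; repeat split; lra.
pose X := [set (S n).1 | n in setT]; pose Y := [set (S n).2 | n in setT].
have ubX n : ubound X ((S n).1 + W n).
  move=> _ [m _ <-]; have [/ltnW nm|mn] := ltnP n m.
    have [_ [+ _]] := mono n (m - n)%N; rewrite subnKC// => h.
    by have := W0 m; lra.
  have [+ _] := mono m (n - m)%N; rewrite subnKC// => h.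
  by have := W0 n; lra.
have ubY n : ubound Y ((S n).2 + H n).
  move=> _ [m _ <-]; have [/ltnW nm|mn] := ltnP n m.
    have [_ [_ [_ +]]] := mono n (m - n)%N; rewrite subnKC// => h.
    by have := H0 m; lra.
  have [_ [_ [+ _]]] := mono m (n - m)%N; rewrite subnKC// => h.
  by have := H0 n; lra.
have hsX : has_sup X.
  by split; [exists (S 0%N).1; exists 0%N|exists ((S 0%N).1 + W 0); exact: ubX].
have hsY : has_sup Y.
  by split; [exists (S 0%N).2; exists 0%N|exists ((S 0%N).2 + H 0); exact: ubY].
(* The lower left corners increase in both coordinates and are bounded by every upper right corner,
   so the point formed by their suprema lies in all the rectangles. *)
pose w := sup X +i* sup Y.
have wS n : rect (S n).1 ((S n).1 + W n) (S n).2 ((S n).2 + H n) w.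
  split => /=.
  - by apply: ub_le_sup => //; [exact: hsX.2|exists n].
  - by apply: ge_sup => //; exact: hsX.1.
  - by apply: ub_le_sup => //; [exact: hsY.2|exists n].
  - by apply: ge_sup => //; exact: hsY.1.
have wR : rect a b c d w.
  by have [] := wS 0%N; rewrite /= /W /H expr0 !divr1 !subrKC.
have [r r0 hr] := P_local wR.
have [n [Wn Hn]] : exists n, W n < r /\ H n < r.
  have M0 : 0 < Num.max (b - a) (d - c) / r by rewrite divr_gt0// lt_max subr_gt0 ab.
  exists (Num.truncn (Num.max (b - a) (d - c) / r)).+1.
  set n := _.+1.
  have n2 : Num.max (b - a) (d - c) / r < 2 ^+ n.
    apply: lt_le_trans (truncnS_gt _) _.
    by rewrite -natrX ler_nat ltnW// ltn_expl.
  have := n2; rewrite ltr_pdivrMr// => h.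
  rewrite /W /H !ltr_pdivrMr ?exprn_gt0// mulrC.
  by move: h; rewrite gt_max => /andP[].
have [i1 i2] := SP n; case: i1 => j1 j2 j3 j4.
apply: i2; apply: hr => //.
- by rewrite ltrDl.
- by rewrite ltrDl.
- by rewrite addrC addKr.
- by rewrite addrC addKr.
- by rewrite !(addrC _ (W n)) !(addrC _ (H n)) !addrK /W /H; field; rewrite expf_neq0.
Qed.

End Bisection.

End Plane.

Section Divergence.
Context {R : realType}.
Local Notation mu := (@lebesgue_measure R).
Local Notation mu2 := (@lebesgue_measure R \x @lebesgue_measure R)%E.
Implicit Types (f g k : R[i] -> R) (D : set R[i]) (w z v : R[i]) (a b c d : R).

Lemma integrable_cst_lty (dsp : measure_display) (T : measurableType dsp)
    (nu : {measure set T -> \bar R}) (A : set T) (C : R) :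
  measurable A -> (nu A < +oo)%E -> nu.-integrable A (EFin \o (fun=> C)).
Proof.
move=> mA Aoo; apply: measurable_bounded_integrable => //.
by exists `|C|; split; [exact: num_real|move=> M CM x _ /=; exact: ltW].
Qed.

Lemma Rintegral_split (F : R -> R) a m b : a <= m -> m <= b ->
  mu.-integrable `[a, b] (EFin \o F) ->
  \int[mu]_(x in `[a, b]) F x =
  \int[mu]_(x in `[a, m]) F x + \int[mu]_(x in `[m, b]) F x.
Proof.
move=> am mb iF.
rewrite -(@Rintegral_itv_obnd_cbnd _ m (BRight b)); last first.
  by apply: integrableS iF => //; apply: subset_itvr; rewrite bnd_simp.
by rewrite -(@Rintegral_itvB _ F (BLeft a) (BRight b) m) ?bnd_simp// addrC subrK.
Qed.

Lemma Rintegral_near_cst (F : R -> R) K M a b : a <= b ->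
  mu.-integrable `[a, b] (EFin \o F) ->
  (forall x, a <= x <= b -> `|F x - K| <= M) ->
  `|\int[mu]_(x in `[a, b]) F x - K * (b - a)| <= M * (b - a).
Proof.
move=> ab iF FK.
have muab : fine (mu `[a, b]) = b - a.
  by rewrite lebesgue_measure_itv /= lte_fin; case: ltP => //= h; lra.
have icst C : mu.-integrable `[a, b] (EFin \o (fun=> C)).
  apply: integrable_cst_lty => //.
  by rewrite /= lebesgue_measure_itv /=; case: ifP => // _; rewrite ltry.
rewrite -muab -!Rintegral_cst//= -RintegralB//.
apply: le_trans (le_normr_Rintegral _ _) _ => //.
  by apply: (integrableB _ iF (icst K)).
apply: le_Rintegral => //.
  by apply: integrable_norm; apply: (integrableB _ iF (icst K)).
Qed.

(** Half-open, unlike [rect], so that cutting a rectangle in two gives a disjoint union. *)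
Definition rect_pairs a b c d : set (R * R) := `]a, b] `*` `]c, d].

Lemma measurable_rect_pairs a b c d :
  measurable (rect_pairs a b c d : set (measurableTypeR R * measurableTypeR R)).
Proof. by apply: measurableX; exact: measurable_itv. Qed.

Lemma mu2_rect_pairs a b c d : a <= b -> c <= d ->
  mu2 (rect_pairs a b c d) = ((b - a) * (d - c))%:E.
Proof.
move=> ab cd; rewrite product_measure1E; [|exact: measurable_itv..].
rewrite /= !lebesgue_measure_itv /= !lte_fin EFinM.
case: ltP => h1; case: ltP => h2; rewrite ?EFinB//.
- have -> : d = c by apply/le_anti; rewrite h2 cd.
  by rewrite -!EFinB subrr !mule0.
- have -> : b = a by apply/le_anti; rewrite h1 ab.
  by rewrite -!EFinB subrr !mul0e.
- have -> : b = a by apply/le_anti; rewrite h1 ab.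
  by rewrite -!EFinB subrr !mul0e.
Qed.

Lemma mu2_rect_pairs_lty a b c d : a <= b -> c <= d ->
  (mu2 (rect_pairs a b c d) < +oo)%E.
Proof. by move=> ab cd; rewrite mu2_rect_pairs// ltry. Qed.

Lemma rect_pairsP a b c d p : rect_pairs a b c d p -> rect a b c d (pt p).
Proof.
case: p => x y [/=]; rewrite !in_itv /= => /andP[h1 h2] /andP[h3 h4].
by split => //=; exact: ltW.
Qed.

Lemma rect_normc_le a b c d w v : rect a b c d w -> rect a b c d v ->
  normc (v - w) <= (b - a) + (d - c).
Proof.
move=> [h1 h2 h3 h4] [h5 h6 h7 h8]; apply: le_trans (normc_le_ReIm _) _.
by rewrite !ReImE; apply: lerD; rewrite ler_norml; lra.
Qed.

Lemma rect_sub a b c d a' b' c' d' : a <= a' -> b' <= b -> c <= c' -> d' <= d ->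
  rect a' b' c' d' `<=` rect a b c d.
Proof. by move=> h1 h2 h3 h4 w [h5 h6 h7 h8]; split; lra. Qed.

Section Domain.
Variables (D : set R[i]) (oD : Copen D).

(** Bisection in the role of compactness: a bound on two pieces gives one on their union, and
    continuity gives one near each point. *)
Lemma rect_bounded f a b c d : a < b -> c < d -> rect a b c d `<=` D ->
  (forall w, D w -> Rcontinuous_at f w) ->
  exists M, forall w, rect a b c d w -> `|f w| <= M.
Proof.
move=> ab cd sD cf.
apply: (@rect_bisection _ (fun a b c d =>
  exists M, forall w, rect a b c d w -> `|f w| <= M)) => //.
- move=> a' m b' c' d' h1 h2 h3 _ _ _ _ [M1 H1] [M2 H2].
  exists (Num.max M1 M2) => w [k1 k2 k3 k4]; rewrite le_max.
  have [wm|mw] := leP (complex.Re w) m.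
    by rewrite H1.
  by rewrite H2 ?orbT//; split => //; exact: ltW.
- move=> a' b' c' m d' h1 h2 h3 _ _ _ _ [M1 H1] [M2 H2].
  exists (Num.max M1 M2) => w [k1 k2 k3 k4]; rewrite le_max.
  have [wm|mw] := leP (complex.Im w) m.
    by rewrite H1.
  by rewrite H2 ?orbT//; split => //; exact: ltW.
- move=> w /sD/cf/(_ _ ltr01)[r r0 hr]; exists (r / 2); first by rewrite divr_gt0.
  move=> a' b' c' d' _ _ _ _ _ _ w' h1 h2 _; exists (`|f w| + 1) => v v'.
  have /hr : normc (v - w) < r.
    by apply: le_lt_trans (rect_normc_le w' v') _; lra.
  have := ler_normD (f v - f w) (f w); rewrite subrK; lra.
Qed.

Lemma Rcontinuous_at_measurable f a b c d : rect a b c d `<=` D ->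
  (forall w, D w -> Rcontinuous_at f w) ->
  measurable_fun (rect_pairs a b c d : set (measurableTypeR R * measurableTypeR R)) (f \o pt).
Proof.
move=> sD cf; apply: measurable_funS (measurable_fun_Copen oD cf).
  exact: measurable_Copen.
by move=> p /rect_pairsP/sD.
Qed.

Lemma rect_integrable f a b c d : a <= b -> c <= d -> rect a b c d `<=` D ->
  (forall w, D w -> Rcontinuous_at f w) ->
  mu2.-integrable (rect_pairs a b c d) (EFin \o (f \o pt)).
Proof.
move=> ab cd sD cf; apply: measurable_bounded_integrable.
- exact: measurable_rect_pairs.
- exact: mu2_rect_pairs_lty.
- exact: Rcontinuous_at_measurable.
- have [ab'|ba] := ltP a b; last first.
    exists 0; split => // M _ [x y] [/=]; rewrite in_itv /= => /andP[h1 h2]; lra.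
  have [cd'|dc] := ltP c d; last first.
    exists 0; split => // M _ [x y] [_ /=]; rewrite in_itv /= => /andP[h1 h2]; lra.
  have [M HM] := rect_bounded ab' cd' sD cf.
  exists M; split; first exact: num_real.
  by move=> M' MM' p /rect_pairsP/HM /= h; apply: le_trans h (ltW MM').
Qed.

Lemma vslice_integrable f x c d : (forall y, c <= y <= d -> D (x +i* y)) ->
  (forall w, D w -> Rcontinuous_at f w) ->
  mu.-integrable `[c, d] (EFin \o (fun y => f (x +i* y))).
Proof.
move=> sD cf; apply: continuous_compact_integrable; first exact: segment_compact.
apply: continuous_in_subspaceT => y; rewrite inE /= in_itv /= => /sD/cf cy.
apply/cvgrPdist_lt => e /cy[r r0 hr]; exists r => //= t /= ht.
rewrite distrC; apply: hr; apply: le_lt_trans (normc_le_ReIm _) _ => /=.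
by rewrite subrr normr0 add0r distrC.
Qed.

Lemma hslice_integrable f y a b : (forall x, a <= x <= b -> D (x +i* y)) ->
  (forall w, D w -> Rcontinuous_at f w) ->
  mu.-integrable `[a, b] (EFin \o (fun x => f (x +i* y))).
Proof.
move=> sD cf; apply: continuous_compact_integrable; first exact: segment_compact.
apply: continuous_in_subspaceT => x; rewrite inE /= in_itv /= => /sD/cf cy.
apply/cvgrPdist_lt => e /cy[r r0 hr]; exists r => //= t /= ht.
rewrite distrC; apply: hr; apply: le_lt_trans (normc_le_ReIm _) _ => /=.
by rewrite subrr normr0 addr0 distrC.
Qed.

Lemma rect_pairs_near_cst f K M a b c d : a <= b -> c <= d -> rect a b c d `<=` D ->
  (forall w, D w -> Rcontinuous_at f w) ->
  (forall w, rect a b c d w -> `|f w - K| <= M) ->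
  `|\int[mu2]_(p in rect_pairs a b c d) f (pt p) - K * ((b - a) * (d - c))| <=
    M * ((b - a) * (d - c)).
Proof.
move=> ab cd sD cf fK.
have mS := measurable_rect_pairs a b c d.
have iF := rect_integrable ab cd sD cf.
have <- : fine (mu2 (rect_pairs a b c d)) = (b - a) * (d - c).
  by rewrite mu2_rect_pairs.
have icst C : mu2.-integrable (rect_pairs a b c d) (EFin \o (fun=> C)).
  by apply: integrable_cst_lty => //; exact: mu2_rect_pairs_lty.
rewrite -!Rintegral_cst//= -RintegralB//.
apply: le_trans (le_normr_Rintegral _ _) _ => //.
  by apply: (integrableB _ iF (icst K)).
apply: le_Rintegral => //.
  by apply: integrable_norm; apply: (integrableB _ iF (icst K)).
by move=> p /rect_pairsP; exact: fK.
Qed.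

End Domain.

End Divergence.

Section DivergenceTheorem.
Context {R : realType}.
Local Notation mu := (@lebesgue_measure R).
Local Notation mu2 := (@lebesgue_measure R \x @lebesgue_measure R)%E.
Implicit Types (f g k : R[i] -> R) (D : set R[i]) (w z v : R[i]) (a b c d : R).

Definition Rdifferentiable_at f w A B := forall e : R, 0 < e ->
  exists2 r, 0 < r & forall v, normc (v - w) < r ->
  `|f v - f w - (A * complex.Re (v - w) + B * complex.Im (v - w))|
    <= e * normc (v - w).

(** The outward flux of the field (f, g) through the boundary, minus the integral of k over the
    inside; it should vanish when k is the divergence of the field. *)
Definition divergence_defect f g k a b c d : R :=
  \int[mu]_(y in `[c, d]) f (b +i* y) - \int[mu]_(y in `[c, d]) f (a +i* y) +
  (\int[mu]_(x in `[a, b]) g (x +i* d) - \int[mu]_(x in `[a, b]) g (x +i* c)) -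
  \int[mu2]_(p in rect_pairs a b c d) k (pt p).

Section Domain.
Variables (D : set R[i]) (oD : Copen D) (f g k : R[i] -> R).
Hypotheses (cf : forall w, D w -> Rcontinuous_at f w)
           (cg : forall w, D w -> Rcontinuous_at g w)
           (ck : forall w, D w -> Rcontinuous_at k w).
Local Notation J := (divergence_defect f g k).

(** The fluxes through the common edge cancel; all other terms are additive. *)
Lemma divergence_defectDx a m b c d : a <= m -> m <= b -> c <= d ->
  rect a b c d `<=` D -> J a b c d = J a m c d + J m b c d.
Proof.
move=> am mb cd sD; rewrite /divergence_defect.
have ab := le_trans am mb.
have hD y : c <= y <= d -> forall x, a <= x <= b -> D (x +i* y).
  by move=> /andP[? ?] x /andP[? ?]; exact: sD.
rewrite (Rintegral_split am mb (hslice_integrable (hD d _) cg)) ?cd ?lexx//.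
rewrite (Rintegral_split am mb (hslice_integrable (hD c _) cg)) ?cd ?lexx//.
have E : rect_pairs a b c d = rect_pairs a m c d `|` rect_pairs m b c d.
  rewrite /rect_pairs [in LHS](@itv_bndbnd_setU _ _ (BRight a) (BRight m)) ?bnd_simp//.
  by apply/seteqP; split => [p [[h|h] h']|p [[h h']|[h h']]];
    [left|right|split; [left|]|split; [right|]].
rewrite E (@Rintegral_setU _ _ _ mu2 (rect_pairs a m c d) (rect_pairs m b c d) (k \o pt)).
- by ring.
- exact: measurable_rect_pairs.
- exact: measurable_rect_pairs.
- by rewrite -E; apply: rect_integrable ck.
- apply/disj_setPS => -[x y] [[/= + _] [/= + _]]; rewrite !in_itv /=.
  by move=> /andP[_ h1] /andP[h2 _]; move: (le_lt_trans h1 h2); rewrite ltxx.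
Qed.

Lemma divergence_defectDy a b c m d : a <= b -> c <= m -> m <= d ->
  rect a b c d `<=` D -> J a b c d = J a b c m + J a b m d.
Proof.
move=> ab cm md sD; rewrite /divergence_defect.
have cd := le_trans cm md.
have hD x : a <= x <= b -> forall y, c <= y <= d -> D (x +i* y).
  by move=> /andP[? ?] y /andP[? ?]; exact: sD.
rewrite (Rintegral_split cm md (vslice_integrable (hD b _) cf)) ?ab ?lexx//.
rewrite (Rintegral_split cm md (vslice_integrable (hD a _) cf)) ?ab ?lexx//.
have E : rect_pairs a b c d = rect_pairs a b c m `|` rect_pairs a b m d.
  rewrite /rect_pairs [in LHS](@itv_bndbnd_setU _ _ (BRight c) (BRight m)) ?bnd_simp//.
  by apply/seteqP; split => [p [h' [h|h]]|p [[h h']|[h h']]];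
    [left|right|split; [|left]|split; [|right]].
rewrite E (@Rintegral_setU _ _ _ mu2 (rect_pairs a b c m) (rect_pairs a b m d) (k \o pt)).
- by ring.
- exact: measurable_rect_pairs.
- exact: measurable_rect_pairs.
- by rewrite -E; apply: rect_integrable ck.
- apply/disj_setPS => -[x y] [[_ /= +] [_ /= +]]; rewrite !in_itv /=.
  by move=> /andP[_ h1] /andP[h2 _]; move: (le_lt_trans h1 h2); rewrite ltxx.
Qed.

(** Comparison with a field of constant partial derivatives A and B: its flux (A + B) times the area
    cancels against the integral of N = A + B, and only the errors M1 and M2 remain. *)
Lemma divergence_defect_le A B N M1 M2 a b c d : a <= b -> c <= d ->
  rect a b c d `<=` D ->
  (forall y, c <= y <= d -> `|f (b +i* y) - f (a +i* y) - A * (b - a)| <= M1) ->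
  (forall x, a <= x <= b -> `|g (x +i* d) - g (x +i* c) - B * (d - c)| <= M1) ->
  (forall w, rect a b c d w -> `|k w - N| <= M2) ->
  A + B = N ->
  `|J a b c d| <= M1 * ((b - a) + (d - c)) + M2 * ((b - a) * (d - c)).
Proof.
move=> ab cd sD hf hg hk AB; rewrite /divergence_defect.
have hDv x : a <= x <= b -> forall y, c <= y <= d -> D (x +i* y).
  by move=> /andP[? ?] y /andP[? ?]; exact: sD.
have hDh y : c <= y <= d -> forall x, a <= x <= b -> D (x +i* y).
  by move=> /andP[? ?] x /andP[? ?]; exact: sD.
have ib := vslice_integrable (hDv b (ltac:(by rewrite ab lexx))) cf.
have ia := vslice_integrable (hDv a (ltac:(by rewrite ab lexx))) cf.
have id := hslice_integrable (hDh d (ltac:(by rewrite cd lexx))) cg.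
have ic := hslice_integrable (hDh c (ltac:(by rewrite cd lexx))) cg.
rewrite -!RintegralB//.
have iba : mu.-integrable `[c, d] (EFin \o (fun y => f (b +i* y) - f (a +i* y))).
  by apply: (integrableB _ ib ia).
have idc : mu.-integrable `[a, b] (EFin \o (fun x => g (x +i* d) - g (x +i* c))).
  by apply: (integrableB _ id ic).
have h1 := Rintegral_near_cst cd iba hf.
have h2 := Rintegral_near_cst ab idc hg.
have h3 := rect_pairs_near_cst oD ab cd sD ck hk.
rewrite /= in h1 h2 h3.
set I1 := Rintegral _ _ _ in h1 *; set I2 := Rintegral _ _ _ in h2 *.
set I3 := Rintegral _ _ _ in h3 *.
rewrite (_ : _ - I3 = (I1 - A * (b - a) * (d - c)) + (I2 - B * (d - c) * (b - a))
  - (I3 - N * ((b - a) * (d - c)))); last by rewrite -AB; ring.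
apply: le_trans (ler_normB _ _) _; apply: lerD => //.
apply: le_trans (ler_normD _ _) _.
by rewrite (mulrDr M1) (addrC (M1 * _)); exact: lerD h1 h2.
Qed.

(** The bound |defect| <= e' times area passes from pieces to unions, so by bisection it suffices to
    prove it on small rectangles around a point, where first-order expansions of f and g apply. *)
Lemma divergence_theorem a b c d : a < b -> c < d -> rect a b c d `<=` D ->
  (forall w, rect a b c d w -> exists A B A' B',
    [/\ Rdifferentiable_at f w A A', Rdifferentiable_at g w B' B & A + B = k w]) ->
  J a b c d = 0.
Proof.
move=> ab cd sD fgk; apply/eqP; rewrite -normr_le0; apply/ler_addgt0Pl => e e0.
rewrite addr0.
have ar0 : 0 < (b - a) * (d - c) by rewrite mulr_gt0// subr_gt0.
pose e' := e / ((b - a) * (d - c)).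
have e'0 : 0 < e' by exact: divr_gt0.
suff : `|J a b c d| <= e' * ((b - a) * (d - c)) by rewrite /e' divfK// gt_eqF.
have dDx : forall a' m b' c' d', a' < m -> m < b' -> c' < d' ->
  a <= a' -> b' <= b -> c <= c' -> d' <= d ->
  `|J a' m c' d'| <= e' * ((m - a') * (d' - c')) ->
  `|J m b' c' d'| <= e' * ((b' - m) * (d' - c')) ->
  `|J a' b' c' d'| <= e' * ((b' - a') * (d' - c')).
  move=> a' m b' c' d' h1 h2 h3 h4 h5 h6 h7 H1 H2.
  rewrite (@divergence_defectDx a' m) ?(ltW h1) ?(ltW h2) ?(ltW h3)//; last first.
    by apply: subset_trans sD; exact: rect_sub.
  by apply: le_trans (ler_normD _ _) _; lra.
have dDy : forall a' b' c' m d', a' < b' -> c' < m -> m < d' ->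
  a <= a' -> b' <= b -> c <= c' -> d' <= d ->
  `|J a' b' c' m| <= e' * ((b' - a') * (m - c')) ->
  `|J a' b' m d'| <= e' * ((b' - a') * (d' - m)) ->
  `|J a' b' c' d'| <= e' * ((b' - a') * (d' - c')).
  move=> a' b' c' m d' h1 h2 h3 h4 h5 h6 h7 H1 H2.
  rewrite (@divergence_defectDy a' b' c' m) ?(ltW h1) ?(ltW h2) ?(ltW h3)//; last first.
    by apply: subset_trans sD; exact: rect_sub.
  by apply: le_trans (ler_normD _ _) _; lra.
apply: (@rect_bisection _ (fun a b c d => `|J a b c d| <= e' * ((b - a) * (d - c)))) => //.
move=> w Rw; have [A [B [A' [B' [df dg AB]]]]] := fgk _ Rw.
(* C is the ratio of the squared half-perimeter s^2 to the area, common to all similar rectangles.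
   The edge errors 2 h s contribute 2 h s^2 and the error of k contributes h times the area, in
   total h (2 C + 1) times the area; h makes this e' times the area. *)
pose C := ((b - a) + (d - c)) ^+ 2 / ((b - a) * (d - c)).
have C0 : 0 <= C by rewrite divr_ge0 ?sqr_ge0// ltW.
pose h := e' / (2 * C + 1).
have C10 : 0 < 2 * C + 1 by lra.
have h0 : 0 < h by rewrite divr_gt0.
have [r1 r10 {}df] := df _ h0; have [r2 r20 {}dg] := dg _ h0.
have [r3 r30 dk] := ck (sD _ Rw) h0.
exists (Num.min r1 (Num.min r2 r3) / 2); first by rewrite divr_gt0// !lt_min r10 r20.
move=> a' b' c' d' aa' ab' bb' cc' cd' dd' Rw'.
set r := Num.min _ _ => br dr ratio.
have nr v : rect a' b' c' d' v -> [/\ normc (v - w) < r1, normc (v - w) < r2 & normc (v - w) < r3].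
  move=> Rv; suff : normc (v - w) < r by rewrite !lt_min => /and3P[].
  by apply: le_lt_trans (rect_normc_le Rw' Rv) _; lra.
have sD' : rect a' b' c' d' `<=` D by apply: subset_trans sD; exact: rect_sub.
pose s := (b' - a') + (d' - c').
have ns v : rect a' b' c' d' v -> h * normc (v - w) <= h * s.
  by move=> Rv; rewrite ler_wpM2l ?(ltW h0)// rect_normc_le.
have K1 y : c' <= y <= d' -> `|f (b' +i* y) - f (a' +i* y) - A * (b' - a')| <= 2 * h * s.
  move=> /andP[y1 y2].
  have R1 : rect a' b' c' d' (b' +i* y) by split => //=; exact: ltW.
  have R2 : rect a' b' c' d' (a' +i* y) by split => //=; exact: ltW.
  have [+ _ _] := nr _ R1 => /df/le_trans/(_ (ns _ R1)); rewrite !ReImE /= => H1.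
  have [+ _ _] := nr _ R2 => /df/le_trans/(_ (ns _ R2)); rewrite !ReImE /= => H2.
  move: H1 H2; rewrite !ler_norml; lra.
have K2 x : a' <= x <= b' -> `|g (x +i* d') - g (x +i* c') - B * (d' - c')| <= 2 * h * s.
  move=> /andP[x1 x2].
  have R1 : rect a' b' c' d' (x +i* d') by split => //=; exact: ltW.
  have R2 : rect a' b' c' d' (x +i* c') by split => //=; exact: ltW.
  have [_ + _] := nr _ R1 => /dg/le_trans/(_ (ns _ R1)); rewrite !ReImE /= => H1.
  have [_ + _] := nr _ R2 => /dg/le_trans/(_ (ns _ R2)); rewrite !ReImE /= => H2.
  move: H1 H2; rewrite !ler_norml; lra.
have K3 v : rect a' b' c' d' v -> `|k v - k w| <= h.
  by move=> /nr[_ _ /dk/ltW].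
apply: le_trans (divergence_defect_le (ltW ab') (ltW cd') sD' K1 K2 K3 AB) _.
have sC : s * s = C * ((b' - a') * (d' - c')).
  rewrite /s /C; have E : b' - a' = (d' - c') * ((b - a) / (d - c)).
    by rewrite mulrA -ratio mulfK// gt_eqF// subr_gt0.
  by rewrite E; field; rewrite !subr_eq0 !gt_eqF.
rewrite -/s (_ : _ * s + _ = h * (2 * C + 1) * ((b' - a') * (d' - c'))).
  by rewrite /h divfK// gt_eqF.
by rewrite (_ : 2 * h * s * s = 2 * h * (s * s)); [rewrite sC|]; ring.
Qed.

(** The frame between the two rectangles splits into four rectangles that avoid z, each of defect
    zero. *)
Lemma divergence_defect_shrink z a b c d a' b' c' d' :
  a < a' -> a' < complex.Re z -> complex.Re z < b' -> b' < b ->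
  c < c' -> c' < complex.Im z -> complex.Im z < d' -> d' < d ->
  rect a b c d `<=` D ->
  (forall w, rect a b c d w -> w != z -> exists A B A' B',
    [/\ Rdifferentiable_at f w A A', Rdifferentiable_at g w B' B & A + B = k w]) ->
  J a b c d = J a' b' c' d'.
Proof.
case: z => x y /= a1 a2 b1 b2 c1 c2 d1 d2 sD fgk.
have ab' := lt_trans a2 b1; have cd' := lt_trans c2 d1.
have ab1 := lt_trans ab' b2; have cd1 := lt_trans cd' d2.
have cd := lt_trans c1 cd1.
have nz p q s t : a <= p -> q <= b -> c <= s -> t <= d -> p < q -> s < t ->
    (forall w, rect p q s t w -> w != x +i* y) -> J p q s t = 0.
  move=> h1 h2 h3 h4 h5 h6 hw; apply: divergence_theorem => //.
    by apply: subset_trans sD; exact: rect_sub.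
  by move=> w Rw; apply: fgk; [exact: rect_sub Rw|exact: hw].
have sub p q s t : a <= p -> q <= b -> c <= s -> t <= d -> rect p q s t `<=` D.
  by move=> h1 h2 h3 h4; apply: subset_trans sD; exact: rect_sub.
have l1 := ltW a1; have l2 := ltW b2; have l3 := ltW c1; have l4 := ltW d2.
rewrite (divergence_defectDx l1 (ltW ab1) (ltW cd) sD) (nz a a' c d) ?lexx//; last 2 first.
- exact: le_trans (ltW ab') l2.
- move=> w [_ h _ _]; apply/eqP => E; move: h; rewrite E /=.
  by rewrite leNgt a2.
rewrite (divergence_defectDx (ltW ab') l2 (ltW cd) (sub a' b c d l1 (lexx b) (lexx c) (lexx d))).
rewrite (nz b' b c d) ?lexx//; last 2 first.
- exact: le_trans l1 (ltW ab').
- move=> w [h _ _ _]; apply/eqP => E; move: h; rewrite E /=.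
  by rewrite leNgt b1.
rewrite (divergence_defectDy (ltW ab') l3 (ltW cd1) (sub a' b' c d l1 l2 (lexx c) (lexx d))).
rewrite (nz a' b' c c') ?lexx//; last 2 first.
- exact: le_trans (ltW cd') l4.
- move=> w [_ _ _ h]; apply/eqP => E; move: h; rewrite E /=.
  by rewrite leNgt c2.
rewrite (divergence_defectDy (ltW ab') (ltW cd') l4 (sub a' b' c' d l1 l2 l3 (lexx d))).
rewrite (nz a' b' d' d) ?lexx//; last 2 first.
- exact: le_trans l3 (ltW cd').
- move=> w [_ _ h _]; apply/eqP => E; move: h; rewrite E /=.
  by rewrite leNgt d1.
by rewrite !add0r !addr0.
Qed.

Lemma divergence_defect_bound M a b c d : a <= b -> c <= d -> rect a b c d `<=` D ->
  (forall w, rect a b c d w -> [/\ `|f w| <= M, `|g w| <= M & `|k w| <= M]) ->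
  `|J a b c d| <= 2 * M * ((b - a) + (d - c)) + M * ((b - a) * (d - c)).
Proof.
move=> ab cd sD H.
have M2 (u v : R) : `|u| <= M -> `|v| <= M -> `|u - v| <= 2 * M.
  by move=> h1 h2; apply: le_trans (ler_normB _ _) _; rewrite mulr2n mulrDl !mul1r lerD.
apply: (@divergence_defect_le 0 0 0) => //; last by rewrite addr0.
- move=> y y01; rewrite mul0r subr0; have /andP[y0 y1] := y01.
  by apply: M2; [have [] := H (b +i* y)|have [] := H (a +i* y)].
- move=> x x01; rewrite mul0r subr0; have /andP[x0 x1] := x01.
  by apply: M2; [have [] := H (x +i* d)|have [] := H (x +i* c)].
- by move=> w /H[_ _]; rewrite subr0.
Qed.

(* The integrands are bounded near [z], so that the defect of a small square
   around [z] is as small as its perimeter. *)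
Lemma divergence_theorem_except z a b c d : a < complex.Re z -> complex.Re z < b ->
  c < complex.Im z -> complex.Im z < d -> rect a b c d `<=` D ->
  (forall w, rect a b c d w -> w != z -> exists A B A' B',
    [/\ Rdifferentiable_at f w A A', Rdifferentiable_at g w B' B & A + B = k w]) ->
  J a b c d = 0.
Proof.
case: z => x y /= ax xb cy yd sD fgk.
have ab := lt_trans ax xb; have cd := lt_trans cy yd.
have [M1 H1] := rect_bounded ab cd sD cf.
have [M2 H2] := rect_bounded ab cd sD cg.
have [M3 H3] := rect_bounded ab cd sD ck.
pose M := Num.max (Num.max M1 M2) (Num.max M3 0).
have M0 : 0 <= M by rewrite !le_max lexx !orbT.
pose r0 := Num.min (Num.min (x - a) (b - x)) (Num.min (y - c) (d - y)) / 2.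
have r00 : 0 < r0 by rewrite divr_gt0// !lt_min !subr_gt0 ax xb cy yd.
have : 2 * r0 = Num.min (Num.min (x - a) (b - x)) (Num.min (y - c) (d - y)).
  by rewrite /r0; field.
set m := Num.min _ _ => r0m.
have [m1 m2 m3 m4] : [/\ m <= x - a, m <= b - x, m <= y - c & m <= d - y].
  by rewrite /m; split; rewrite !ge_min lexx ?orbT.
(* The square of side 2 r around z has half-perimeter 4 r and area 4 r^2 <= 4 r0 r;
   [divergence_defect_bound] with these values gives the constant. *)
have small r : 0 < r -> r <= r0 -> `|J a b c d| <= (8 * M + 4 * M * r0) * r.
  move=> rp rr.
  have [a1 b1 c1 d1] : [/\ a < x - r, x + r < b, c < y - r & y + r < d].
    by clear -r0m m1 m2 m3 m4 rp rr r00; split; lra.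
  have [a2 b2 c2 d2] : [/\ x - r < x, x < x + r, y - r < y & y < y + r].
    by rewrite !ltrDl !ltrBlDr !ltrDl.
  have ab' := ltW (lt_trans a2 b2); have cd' := ltW (lt_trans c2 d2).
  rewrite (@divergence_defect_shrink (x +i* y) _ _ _ _ (x - r) (x + r) (y - r) (y + r))//.
  have sR : rect (x - r) (x + r) (y - r) (y + r) `<=` rect a b c d.
    by apply: rect_sub; exact: ltW.
  apply: le_trans (@divergence_defect_bound M _ _ _ _ ab' cd' (subset_trans sR sD) _) _.
    move=> w /sR Rw; have := H1 _ Rw; have := H2 _ Rw; have := H3 _ Rw => h1 h2 h3.
    by rewrite !le_max h1 h2 h3 !orbT.
  have : 4 * M * r * r <= 4 * M * r0 * r.
    by rewrite ler_wpM2r ?(ltW rp)// ler_wpM2l// mulr_ge0.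
  rewrite (_ : 2 * M * _ + _ = 8 * M * r + 4 * M * r * r); last by ring.
  by move=> h; rewrite (mulrDl (8 * M)) lerD2l.
apply/eqP; rewrite -normr_le0; apply/ler_addgt0Pl => e e0; rewrite addr0.
pose N := 8 * M + 4 * M * r0 + 1.
have Mr : 0 <= M * r0 by rewrite mulr_ge0// ltW.
have N0 : 0 < N by rewrite /N; lra.
have [h1 h2] : Num.min r0 (e / N) <= r0 /\ Num.min r0 (e / N) <= e / N.
  by rewrite !ge_min !lexx orbT.
have h3 : 0 < Num.min r0 (e / N) by rewrite lt_min r00 divr_gt0.
apply: le_trans (small _ h3 h1) _.
apply: (@le_trans _ _ (N * (e / N))); last by rewrite mulrC divfK// gt_eqF.
apply: ler_pM => //; [|exact: ltW|by rewrite lerDl].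
by lra.
Qed.

End Domain.

End DivergenceTheorem.

Section Green.
Context {R : realType}.
Local Notation mu2 := (@lebesgue_measure R \x @lebesgue_measure R)%E.
Implicit Types (G B : R[i] -> R[i]) (D : set R[i]) (w z v : R[i]) (a b c d : R).

Lemma Rcontinuous_at_Re G w : Ccontinuous_at G w ->
  Rcontinuous_at (fun v => complex.Re (G v)) w.
Proof.
move=> cG e /cG[r r0 hr]; exists r => // v /hr; apply: le_lt_trans.
by rewrite -ReCN -ReCD normr_Re_le.
Qed.

Lemma Rcontinuous_at_Im G w : Ccontinuous_at G w ->
  Rcontinuous_at (fun v => complex.Im (G v)) w.
Proof.
move=> cG e /cG[r r0 hr]; exists r => // v /hr; apply: le_lt_trans.
by rewrite -ImCN -ImCD normr_Im_le.
Qed.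

Lemma Rdifferentiable_at_Re G w (A B : R[i]) : is_wirtinger G w A B ->
  Rdifferentiable_at (fun v => complex.Re (G v)) w
    (complex.Re (A + B)) (complex.Im (B - A)).
Proof.
move=> WG e /WG[r r0 hr]; exists r => // v /hr; apply: le_trans.
apply: le_trans (normr_Re_le _).
rewrite !ReImE le_eqVlt; apply/orP; left; apply/eqP; congr `|_|; ring.
Qed.

Lemma Rdifferentiable_at_Im G w (A B : R[i]) : is_wirtinger G w A B ->
  Rdifferentiable_at (fun v => complex.Im (G v)) w
    (complex.Im (A + B)) (complex.Re (A - B)).
Proof.
move=> WG e /WG[r r0 hr]; exists r => // v /hr; apply: le_trans.
apply: le_trans (normr_Im_le _).
rewrite !ReImE le_eqVlt; apply/orP; left; apply/eqP; congr `|_|; ring.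
Qed.

Lemma Rdifferentiable_atN (f : R[i] -> R) w (A B : R) : Rdifferentiable_at f w A B ->
  Rdifferentiable_at (fun v => - f v) w (- A) (- B).
Proof.
move=> df e /df[r r0 hr]; exists r => // v /hr; apply: le_trans.
rewrite -normrN le_eqVlt; apply/orP; left; apply/eqP; congr `|_|; ring.
Qed.

Lemma Rcontinuous_atN (f : R[i] -> R) w : Rcontinuous_at f w ->
  Rcontinuous_at (fun v => - f v) w.
Proof.
move=> cf e /cf[r r0 hr]; exists r => // v /hr; apply: le_lt_trans.
by rewrite -normrN opprD !opprK.
Qed.

Lemma Rcontinuous_atZ C (f : R[i] -> R) w : 0 < C -> Rcontinuous_at f w ->
  Rcontinuous_at (fun v => C * f v) w.
Proof.
move=> C0 cf e e0; have [r r0 hr] := cf _ (divr_gt0 e0 C0); exists r => // v /hr.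
by rewrite -mulrBr normrM (gtr0_norm C0) ltr_pdivlMr// mulrC.
Qed.

(** The divergence of the field (Re G, - Im G) is 2 Re (dG/d(conj w)), and its flux vanishes because
    G is zero on the boundary. The imaginary part is recovered later by multiplying the function by
    -i. *)
Lemma green_Re D G B z a b c d : Copen D ->
  (forall w, D w -> Ccontinuous_at G w) -> (forall w, D w -> Ccontinuous_at B w) ->
  a < complex.Re z -> complex.Re z < b -> c < complex.Im z -> complex.Im z < d ->
  rect a b c d `<=` D ->
  (forall w, rect a b c d w -> w != z -> exists A, is_wirtinger G w A (B w)) ->
  (forall x, G (x +i* c) = 0) -> (forall x, G (x +i* d) = 0) ->
  (forall y, G (a +i* y) = 0) -> (forall y, G (b +i* y) = 0) ->
  \int[mu2]_(p in rect_pairs a b c d) complex.Re (B (pt p)) = 0.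
Proof.
move=> oD cG cB az zb cz zd sD WG G1 G2 G3 G4.
have cB2 w : D w -> Rcontinuous_at (fun v => 2 * complex.Re (B v)) w.
  by move=> /cB/Rcontinuous_at_Re; exact: Rcontinuous_atZ.
have := divergence_theorem_except oD
  (fun w Dw => Rcontinuous_at_Re (cG w Dw))
  (fun w Dw => Rcontinuous_atN (Rcontinuous_at_Im (cG w Dw)))
  cB2 az zb cz zd sD.
rewrite /divergence_defect.
under eq_Rintegral do rewrite G4 /=.
under [X in _ - X + _]eq_Rintegral do rewrite G3 /=.
under [X in _ + (X - _)]eq_Rintegral do rewrite G2 /=.
under [X in _ + (_ - X)]eq_Rintegral do rewrite G1 /=.
rewrite !subrr !add0r RintegralZl; last 2 first.
- exact: measurable_rect_pairs.
- apply: (rect_integrable oD _ _ sD (fun w Dw => Rcontinuous_at_Re (cB w Dw))).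
    exact/ltW/(lt_trans az).
  exact/ltW/(lt_trans cz).
move=> H.
have {}H : - (2 * \int[mu2]_(p in rect_pairs a b c d) complex.Re (B (pt p))) = 0.
  apply: H => w Rw wz; have [A WGw] := WG w Rw wz.
  exists (complex.Re (A + B w)), (- complex.Re (A - B w)), (complex.Im (B w - A)), (- complex.Im (A + B w)).
  split; [exact: Rdifferentiable_at_Re|exact/Rdifferentiable_atN/Rdifferentiable_at_Im|].
  by rewrite !ReImE; ring.
lra.
Qed.

End Green.

(** * The Bergman space *)

Section RestrictedFubini.
Local Open Scope ereal_scope.
Context (d1 d2 : measure_display) (T1 : measurableType d1)
  (T2 : measurableType d2) (R : realType).
Variables (m1 : {sigma_finite_measure set T1 -> \bar R})
  (m2 : {sigma_finite_measure set T2 -> \bar R}).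
Variables (D : set (T1 * T2)) (f : T1 * T2 -> \bar R).
Hypothesis mD : measurable D.

Lemma integral21_restrict_ge0 : measurable_fun D f ->
  (forall p, D p -> 0 <= f p) ->
  \int[m1 \x m2]_(p in D) f p = \int[m2]_y \int[m1]_x (f \_ D) (x, y).
Proof.
move=> mf f0; rewrite integral_mkcond fubini_tonelli2//.
  exact: (measurable_restrictT _ _).1.
by move=> p; rewrite /patch; case: ifPn => //; rewrite inE => /f0.
Qed.

Lemma integral21_restrict : (m1 \x m2).-integrable D f ->
  \int[m1 \x m2]_(p in D) f p = \int[m2]_y \int[m1]_x (f \_ D) (x, y).
Proof.
move=> intf; rewrite integral_mkcond -integral21_prod_meas1//.
exact: (integrable_mkcond _ _).1.
Qed.

Lemma measurable_restrict_slice : measurable_fun D f ->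
  (forall p, D p -> 0 <= f p) ->
  measurable_fun setT (fun y => \int[m1]_x (f \_ D) (x, y)).
Proof.
move=> mf f0; apply: (@measurable_fun_fubini_tonelli_G _ _ _ _ _ m1 (f \_ D)).
  exact: (measurable_restrictT _ _).1.
by move=> p; rewrite /patch; case: ifPn => //; rewrite inE => /f0.
Qed.

End RestrictedFubini.

Section CplusIntegral.
Context {R : realType}.
Local Notation mu := (@lebesgue_measure R).
Local Notation mu2 := (@lebesgue_measure R \x @lebesgue_measure R)%E.
Implicit Types (F : R[i] -> R) (h k : R[i] -> R[i]) (w z v : R[i]).

Definition Cplus_pairs : set (R * R) := pt @^-1` (@Cplus R).
Local Notation CP := Cplus_pairs.

Lemma Copen_Cplus : Copen (@Cplus R).
Proof.
move=> w /= w0; exists (complex.Re w) => // v h /=.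
have := le_lt_trans (normr_Re_le (v - w)) h.
rewrite !ReImE ltr_norml => /andP[h1 _]; rewrite /Cplus /=; lra.
Qed.

Lemma measurable_Cplus_pairs :
  measurable (CP : set (measurableTypeR R * measurableTypeR R)).
Proof. exact: measurable_Copen Copen_Cplus. Qed.

Definition Cplus_integrable F := mu2.-integrable CP (EFin \o (F \o pt)).
Definition Cplus_measurable F :=
  measurable_fun (CP : set (measurableTypeR R * measurableTypeR R)) (F \o pt).
Definition Cplus_Rintegral F : R := \int[mu2]_(p in CP) F (pt p).

Let slice (F : R[i] -> \bar R) y :
  (\int[mu]_(x in `]0%R, +oo[) F (x +i* y) =
   \int[mu]_x ((F \o pt) \_ CP) (x, y))%E.
Proof.
rewrite integral_mkcond; apply: eq_integral => x _.
rewrite /patch (_ : (x \in _) = ((x, y) \in CP))//.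
by apply/idP/idP; rewrite !inE /= in_itv /= andbT.
Qed.

(** The integral in the definition of the space is iterated; convergence theorems and linearity are
    used for the product measure, and Tonelli's theorem makes the passage. *)
Lemma Cplus_integral_ge0E F : Cplus_measurable F ->
  (forall w, Cplus w -> 0 <= F w) ->
  Cplus_integral F = (\int[mu2]_(p in CP) (F (pt p))%:E)%E.
Proof.
move=> mF F0; rewrite (integral21_restrict_ge0 mu mu measurable_Cplus_pairs).
- by apply: eq_integral => y _; rewrite (slice (EFin \o F)).
- exact/measurable_EFinP.
- by move=> p /F0; rewrite lee_fin.
Qed.

Lemma Cplus_integral_integrableE F : Cplus_integrable F ->
  Cplus_integral F = (\int[mu2]_(p in CP) (F (pt p))%:E)%E.
Proof.
move=> iF; rewrite (integral21_restrict measurable_Cplus_pairs iF).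
by apply: eq_integral => y _; rewrite (slice (EFin \o F)).
Qed.

Lemma Cplus_slice_measurable F : Cplus_measurable F ->
  (forall w, Cplus w -> 0 <= F w) ->
  measurable_fun setT (fun y => \int[mu]_(x in `]0%R, +oo[) (F (x +i* y))%:E)%E.
Proof.
move=> mF F0.
rewrite (_ : (fun y => _) = fun y => (\int[mu]_x (((EFin \o F) \o pt) \_ CP) (x, y))%E).
  apply: (measurable_restrict_slice mu measurable_Cplus_pairs).
    exact/measurable_EFinP.
  by move=> p /F0 /=; rewrite lee_fin.
by apply/funext => y; exact: (slice (EFin \o F)).
Qed.

Lemma fine_Cplus_integral F : Cplus_integrable F ->
  fine (Cplus_integral F) = Cplus_Rintegral F.
Proof. by move=> iF; rewrite Cplus_integral_integrableE. Qed.

Lemma Cplus_integrable_measurable F : Cplus_integrable F -> Cplus_measurable F.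
Proof. by move=> /measurable_int/measurable_EFinP. Qed.

Lemma Cplus_integrableD F F' : Cplus_integrable F -> Cplus_integrable F' ->
  Cplus_integrable (fun w => F w + F' w).
Proof. by move=> i i'; apply: (integrableD measurable_Cplus_pairs i i'). Qed.

Lemma Cplus_integrableZ c F : Cplus_integrable F ->
  Cplus_integrable (fun w => c * F w).
Proof. by move=> i; apply: (integrableZl measurable_Cplus_pairs c i). Qed.

Lemma Cplus_RintegralD F F' : Cplus_integrable F -> Cplus_integrable F' ->
  Cplus_Rintegral (fun w => F w + F' w) = Cplus_Rintegral F + Cplus_Rintegral F'.
Proof. by move=> i i'; apply: (RintegralD measurable_Cplus_pairs i i'). Qed.

Lemma Cplus_RintegralZ c F : Cplus_integrable F ->
  Cplus_Rintegral (fun w => c * F w) = c * Cplus_Rintegral F.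
Proof. by move=> i; apply: (RintegralZl _ measurable_Cplus_pairs i). Qed.

Lemma eq_Cplus_Rintegral F F' : (forall w, Cplus w -> F w = F' w) ->
  Cplus_Rintegral F = Cplus_Rintegral F'.
Proof. by move=> FF'; apply: eq_Rintegral => p; rewrite inE => /FF'. Qed.

Lemma eq_Cplus_integrable F F' : (forall w, Cplus w -> F w = F' w) ->
  Cplus_integrable F -> Cplus_integrable F'.
Proof.
move=> FF'; apply: eq_integrable; first exact: measurable_Cplus_pairs.
by move=> p; rewrite inE => /FF' /= ->.
Qed.

Lemma Cplus_integrable_le F F' : Cplus_measurable F -> Cplus_integrable F' ->
  (forall w, Cplus w -> `|F w| <= F' w) -> Cplus_integrable F.
Proof.
move=> mF iF' FF'; apply: le_integrable iF'.
- exact: measurable_Cplus_pairs.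
- exact/measurable_EFinP.
- by move=> p /FF' /= h; rewrite lee_fin (le_trans h)// ler_norm.
Qed.

Lemma Cplus_Rintegral_ge0 F : (forall w, Cplus w -> 0 <= F w) ->
  0 <= Cplus_Rintegral F.
Proof. by move=> F0; apply: Rintegral_ge0 => p /F0. Qed.

Lemma Cplus_measurable_continuous F :
  (forall w, Cplus w -> Rcontinuous_at F w) -> Cplus_measurable F.
Proof. by move=> cF; apply: measurable_fun_Copen => //; exact: Copen_Cplus. Qed.

Lemma analytic_continuous h w : analytic h -> Cplus w -> Ccontinuous_at h w.
Proof. by move=> /analyticP + Cw => /(_ _ Cw); exact: Cdifferentiable_continuous. Qed.

Lemma Cplus_measurable_Re : Cplus_measurable (@complex.Re R).
Proof.
apply: Cplus_measurable_continuous => w _ e e0; exists e => // v.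
by apply: le_lt_trans; rewrite -ReCN -ReCD normr_Re_le.
Qed.

Lemma Cplus_measurableM F F' : Cplus_measurable F -> Cplus_measurable F' ->
  Cplus_measurable (fun w => F w * F' w).
Proof. by move=> m m'; apply: (measurable_funM m m'). Qed.

Lemma Cplus_measurableX n F : Cplus_measurable F ->
  Cplus_measurable (fun w => F w ^+ n).
Proof. by move=> m; apply: (measurable_funX n m). Qed.

Lemma Rcontinuous_normc h w : Ccontinuous_at h w ->
  Rcontinuous_at (fun v => normc (h v)) w.
Proof.
move=> ch e /ch[r r0 hr]; exists r => // v /hr; apply: le_lt_trans.
rewrite ler_norml; apply/andP; split; last exact: lerB_normc.
by rewrite lerNl opprB normcBC lerB_normc.
Qed.

Lemma Ccontinuous_atM h k w : Ccontinuous_at h w -> Ccontinuous_at k w ->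
  Ccontinuous_at (fun v => h v * k v) w.
Proof.
move=> ch ck e e0.
have nh0 : 0 < normc (h w) + 1 by rewrite ltr_wpDl ?normc_ge0.
have nk0 : 0 < normc (k w) + 1 by rewrite ltr_wpDl ?normc_ge0.
have [r1 r10 h1] := ch _ ltr01.
have [r2 r20 h2] := ch _ (divr_gt0 (divr_gt0 e0 (ltr0n R 2)) nk0).
have [r3 r30 h3] := ck _ (divr_gt0 (divr_gt0 e0 (ltr0n R 2)) nh0).
exists (Num.min r1 (Num.min r2 r3)); first by rewrite !lt_min r10 r20.
move=> v; rewrite !lt_min => /and3P[/h1 {}h1 /h2 {}h2 /h3 {}h3].
rewrite (_ : _ - _ = h v * (k v - k w) + (h v - h w) * k w); last by ring.
apply: le_lt_trans (normcD _ _) _; rewrite !Normc.normcM (splitr e).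
apply: ltr_leD.
  apply: (@le_lt_trans _ _ ((normc (h w) + 1) * normc (k v - k w))).
    rewrite ler_wpM2r ?normc_ge0//; have := lerB_normc (h v) (h w); lra.
  by rewrite mulrC -ltr_pdivlMr.
apply: (@le_trans _ _ (normc (h v - h w) * (normc (k w) + 1))).
  by rewrite ler_wpM2l ?normc_ge0// lerDl.
by rewrite -ler_pdivlMr// ltW.
Qed.

Lemma Ccontinuous_atD h k w : Ccontinuous_at h w -> Ccontinuous_at k w ->
  Ccontinuous_at (fun v => h v + k v) w.
Proof.
move=> ch ck e e0.
have [r2 r20 h2] := ch _ (divr_gt0 e0 (ltr0n R 2)).
have [r3 r30 h3] := ck _ (divr_gt0 e0 (ltr0n R 2)).
exists (Num.min r2 r3); first by rewrite !lt_min r20.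
move=> v; rewrite !lt_min => /andP[/h2 {}h2 /h3 {}h3].
rewrite (_ : _ - _ = (h v - h w) + (k v - k w)); last by ring.
by apply: le_lt_trans (normcD _ _) _; rewrite (splitr e) ltrD.
Qed.

Lemma Ccontinuous_at_conj h w : Ccontinuous_at h w ->
  Ccontinuous_at (fun v => conjc (h v)) w.
Proof.
by move=> ch e /ch[r r0 hr]; exists r => // v /hr; rewrite -rmorphB normc_conj.
Qed.

Lemma Ccontinuous_atX n h w : Ccontinuous_at h w ->
  Ccontinuous_at (fun v => h v ^+ n) w.
Proof.
move=> ch; elim: n => [|n IH].
  by move=> e e0; exists 1 => // v _; rewrite subrr Normc.normc0.
by move=> e /(Ccontinuous_atM ch IH)[r r0 hr]; exists r => // v; rewrite !exprS; exact: hr.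
Qed.

Lemma Ccontinuous_atV h w : h w != 0 -> Ccontinuous_at h w ->
  Ccontinuous_at (fun v => (h v)^-1) w.
Proof.
move=> hw ch e e0.
have [r r0 hr] := is_wirtinger_continuous (is_wirtinger_inv hw) e0.
by have [r' r'0 hr'] := ch _ r0; exists r' => // v /hr'; exact: hr.
Qed.

End CplusIntegral.

Section BergmanBasics.
Context {R : realType}.
Variable l : nat.
Implicit Types (F : R[i] -> R) (h k u : R[i] -> R[i]) (w z v c : R[i]).

Definition sq_weight h w : R := complex.Re w ^+ l * normc (h w) ^+ 2.

Lemma sq_weight_ge0 h w : Cplus w -> 0 <= sq_weight h w.
Proof. by move=> /ltW w0; rewrite mulr_ge0 ?exprn_ge0 ?normc_ge0. Qed.

Lemma sq_weight_measurable h : analytic h -> Cplus_measurable (sq_weight h).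
Proof.
move=> ah; apply: (@Cplus_measurableM _ (fun w => complex.Re w ^+ l)).
  by apply: Cplus_measurableX; exact: Cplus_measurable_Re.
apply: Cplus_measurableX; apply: Cplus_measurable_continuous => w Cw.
exact/Rcontinuous_normc/analytic_continuous.
Qed.

Let mul_lty_lty (r x : \bar R) : (0 < r)%E -> (r * x < +oo)%E -> (x < +oo)%E.
Proof.
by move=> r0 H; rewrite ltey; apply/eqP => xE; move: H; rewrite xE gt0_muley// ltxx.
Qed.

Lemma bergmanP h : bergman l h <-> analytic h /\ Cplus_integrable (sq_weight h).
Proof.
split=> -[ah hh]; split=> //.
- apply/integrableP; split; first by apply/measurable_EFinP; exact: sq_weight_measurable.
  have p0 : (0 < (@pi R)^-1%:E)%E by rewrite lte_fin invr_gt0 pi_gt0.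
  move: hh; rewrite /bergman_normsq Cplus_integral_ge0E; last 2 first.
  - exact: sq_weight_measurable.
  - by move=> w; exact: sq_weight_ge0.
  have -> : (\int[lebesgue_measure \x lebesgue_measure]_(p in Cplus_pairs) `|(EFin \o (sq_weight h \o pt)) p| =
     \int[lebesgue_measure \x lebesgue_measure]_(p in Cplus_pairs) (sq_weight h (pt p))%:E)%E.
    apply: eq_integral => p; rewrite inE => Cp /=.
    by rewrite ger0_norm//; exact: sq_weight_ge0.
  exact: mul_lty_lty.
- rewrite /bergman_normsq Cplus_integral_integrableE//.
  by rewrite lte_mul_pinfty// ?lee_fin ?invr_ge0 ?pi_ge0//; exact: (integrable_lty measurable_Cplus_pairs hh).
Qed.

Lemma bergman_analytic h : bergman l h -> analytic h. Proof. by case. Qed.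

Lemma bergman_integrable h : bergman l h -> Cplus_integrable (sq_weight h).
Proof. by move=> /bergmanP[]. Qed.

(* The squared norm and the inner product are used without the factor 1/pi. *)
Definition normsq h : R := Cplus_Rintegral (sq_weight h).

Definition ip h k : R[i] :=
  Cplus_Rintegral (fun w => complex.Re w ^+ l * complex.Re (h w * conjc (k w))) +i*
  Cplus_Rintegral (fun w => complex.Re w ^+ l * complex.Im (h w * conjc (k w))).

Lemma normsq_ge0 h : 0 <= normsq h.
Proof. by apply: Cplus_Rintegral_ge0 => w; exact: sq_weight_ge0. Qed.

Lemma bergman_normE h : bergman l h ->
  bergman_norm l h = Num.sqrt (pi^-1 * normsq h).
Proof.
move=> bh; rewrite /bergman_norm /bergman_normsq.
rewrite Cplus_integral_integrableE; last exact: bergman_integrable.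
rewrite fineM//; apply: integrable_fin_num; [exact: measurable_Cplus_pairs|exact: bergman_integrable].
Qed.

(** Domination by the sum of the two squared weights, since |h| |k| <= |h|^2 + |k|^2. *)
Lemma weight_integrable h k F : bergman l h -> bergman l k ->
  Cplus_measurable F -> (forall w, Cplus w -> `|F w| <= normc (h w) * normc (k w)) ->
  Cplus_integrable (fun w => complex.Re w ^+ l * F w).
Proof.
move=> bh bk mF Fhk.
apply: (Cplus_integrable_le _ (Cplus_integrableD (bergman_integrable bh) (bergman_integrable bk))).
  apply: (@Cplus_measurableM _ (fun w => complex.Re w ^+ l)) => //.
  by apply: Cplus_measurableX; exact: Cplus_measurable_Re.
move=> w Cw; have w0 : 0 <= complex.Re w ^+ l by rewrite exprn_ge0// ltW.
rewrite normrM (ger0_norm w0) /sq_weight -mulrDr ler_wpM2l//.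
apply: le_trans (Fhk _ Cw) _.
have := sqr_ge0 (normc (h w) - normc (k w)); have := sqr_ge0 (normc (h w) + normc (k w)).
rewrite sqrrB sqrrD; lra.
Qed.

Lemma analytic_mulJ_measurable h k : analytic h -> analytic k ->
  Cplus_measurable (fun w => complex.Re (h w * conjc (k w))) /\
  Cplus_measurable (fun w => complex.Im (h w * conjc (k w))).
Proof.
move=> ah ak; split; apply: Cplus_measurable_continuous => w Cw;
  [apply: Rcontinuous_at_Re|apply: Rcontinuous_at_Im];
  apply: Ccontinuous_atM; [exact: analytic_continuous| |exact: analytic_continuous|];
  exact/Ccontinuous_at_conj/analytic_continuous.
Qed.

Lemma ip_integrable h k : bergman l h -> bergman l k ->
  Cplus_integrable (fun w => complex.Re w ^+ l * complex.Re (h w * conjc (k w))) /\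
  Cplus_integrable (fun w => complex.Re w ^+ l * complex.Im (h w * conjc (k w))).
Proof.
move=> bh bk.
have [m1 m2] := analytic_mulJ_measurable (bergman_analytic bh) (bergman_analytic bk).
split; apply: (weight_integrable bh bk) => // w _; rewrite -[normc (k w)]normc_conj -Normc.normcM.
  exact: normr_Re_le.
exact: normr_Im_le.
Qed.

Lemma bergman_innerE h k : bergman l h -> bergman l k ->
  bergman_inner l h k = (pi^-1)%:C * ip h k.
Proof.
move=> bh bk; have [i1 i2] := ip_integrable bh bk; rewrite /bergman_inner /ip.
have E1 w : complex.Re ((complex.Re w ^+ l)%:C * (h w * conjc (k w))) =
   complex.Re w ^+ l * complex.Re (h w * conjc (k w)).
  by rewrite ReCM /= mul0r subr0.
have E2 w : complex.Im ((complex.Re w ^+ l)%:C * (h w * conjc (k w))) =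
   complex.Re w ^+ l * complex.Im (h w * conjc (k w)).
  by rewrite ImCM /= mul0r addr0.
congr (_ * _); congr (_ +i* _).
- by rewrite -(fine_Cplus_integral i1); congr (fine (Cplus_integral _)); apply/funext.
- by rewrite -(fine_Cplus_integral i2); congr (fine (Cplus_integral _)); apply/funext.
Qed.

Lemma eq_ip h h' k k' : eq_Cplus h h' -> eq_Cplus k k' -> ip h k = ip h' k'.
Proof.
move=> hh kk; rewrite /ip; congr (_ +i* _); apply: eq_Cplus_Rintegral => w Cw;
by rewrite hh// kk.
Qed.

Lemma eq_normsq h h' : eq_Cplus h h' -> normsq h = normsq h'.
Proof. by move=> hh; apply: eq_Cplus_Rintegral => w Cw; rewrite /sq_weight hh. Qed.

Lemma ip_conj h k : bergman l h -> bergman l k -> ip k h = conjc (ip h k).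
Proof.
move=> bh bk; have [_ i2] := ip_integrable bh bk; rewrite /ip /=; congr (_ +i* _).
  by apply: eq_Cplus_Rintegral => w _; rewrite !ReImE; ring.
rewrite -mulN1r -Cplus_RintegralZ//; apply: eq_Cplus_Rintegral => w _.
by rewrite !ReImE; ring.
Qed.

Lemma ipDl h h' k : bergman l h -> bergman l h' -> bergman l k ->
  ip (fun w => h w + h' w) k = ip h k + ip h' k.
Proof.
move=> bh bh' bk; have [i1 i2] := ip_integrable bh bk.
have [i3 i4] := ip_integrable bh' bk.
apply: complex_ext; rewrite ?ReCD ?ImCD /= -Cplus_RintegralD//;
  by apply: eq_Cplus_Rintegral => w _; rewrite !ReImE; ring.
Qed.

Lemma ipZl c h k : bergman l h -> bergman l k ->
  ip (fun w => c * h w) k = c * ip h k.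
Proof.
move=> bh bk; have [i1 i2] := ip_integrable bh bk.
apply: complex_ext; rewrite ?ReCM ?ImCM /=.
- rewrite -mulNr -!Cplus_RintegralZ// -Cplus_RintegralD; last 2 first.
  + exact: Cplus_integrableZ.
  + exact: Cplus_integrableZ.
  by apply: eq_Cplus_Rintegral => w _; rewrite !ReImE; ring.
- rewrite -!Cplus_RintegralZ// -Cplus_RintegralD; last 2 first.
  + exact: Cplus_integrableZ.
  + exact: Cplus_integrableZ.
  by apply: eq_Cplus_Rintegral => w _; rewrite !ReImE; ring.
Qed.

Lemma ip_normsq h : ip h h = (normsq h)%:C.
Proof.
apply: complex_ext => /=.
  by apply: eq_Cplus_Rintegral => w _; rewrite /sq_weight mulcJ.
rewrite -[RHS](mul0r (Cplus_Rintegral (fun=> 0))) /=.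
transitivity (@Cplus_Rintegral R (fun=> 0)).
  by apply: eq_Cplus_Rintegral => w _; rewrite mulcJ /= mulr0.
rewrite mul0r /Cplus_Rintegral /Rintegral integral0//.
Qed.

Lemma bergmanD h k : bergman l h -> bergman l k -> bergman l (fun w => h w + k w).
Proof.
move=> bh bk; apply/bergmanP.
have ahk : analytic (fun w => h w + k w).
  apply/analyticP => w Cw; apply: CdifferentiableD.
    by move/analyticP: (bergman_analytic bh); apply.
  by move/analyticP: (bergman_analytic bk); apply.
split => //; apply: (Cplus_integrable_le (sq_weight_measurable ahk)
  (Cplus_integrableD (Cplus_integrableZ 2 (bergman_integrable bh))
  (Cplus_integrableZ 2 (bergman_integrable bk)))) => w Cw.
rewrite (ger0_norm (sq_weight_ge0 _ Cw)) /sq_weight.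
have w0 : 0 <= complex.Re w ^+ l by rewrite exprn_ge0// ltW.
rewrite (_ : _ + _ = complex.Re w ^+ l * (2 * normc (h w) ^+ 2 + 2 * normc (k w) ^+ 2)); last by ring.
rewrite ler_wpM2l//.
apply: (@le_trans _ _ ((normc (h w) + normc (k w)) ^+ 2)).
  by rewrite ler_sqr ?nnegrE ?addr_ge0 ?normc_ge0// normcD.
have := sqr_ge0 (normc (h w) - normc (k w)); rewrite sqrrB sqrrD; lra.
Qed.

Lemma bergmanZ c h : bergman l h -> bergman l (fun w => c * h w).
Proof.
move=> bh; apply/bergmanP; split.
  apply/analyticP => w Cw; apply: CdifferentiableM; first exact: Cdifferentiable_cst.
  by move/analyticP: (bergman_analytic bh); apply.
apply: eq_Cplus_integrable (Cplus_integrableZ (normc c ^+ 2) (bergman_integrable bh)).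
by move=> w _; rewrite /sq_weight Normc.normcM; ring.
Qed.

Lemma eq_Cplus_analytic h k : eq_Cplus h k -> analytic h -> analytic k.
Proof.
move=> hk /analyticP ah; apply/analyticP => w Cw.
have [r r0 hr] := Copen_Cplus Cw.
by apply: Cdifferentiable_near r0 _ (ah _ Cw) => v /hr; exact: hk.
Qed.

Lemma eq_Cplus_bergman h k : eq_Cplus h k -> bergman l h -> bergman l k.
Proof.
move=> hk /bergmanP[ah ih]; apply/bergmanP; split; first exact: eq_Cplus_analytic ah.
by apply: eq_Cplus_integrable ih => w Cw; rewrite /sq_weight hk.
Qed.

Lemma bergmanB h k : bergman l h -> bergman l k -> bergman l (fun w => h w - k w).
Proof.
move=> bh bk; apply: eq_Cplus_bergman (bergmanD bh (bergmanZ (-1) bk)) => w _.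
by rewrite mulN1r.
Qed.

Lemma bergman0 : bergman l (fun _ : R[i] => 0 : R[i]).
Proof.
apply/bergmanP; split; first by apply/analyticP => w _; exact: Cdifferentiable_cst.
rewrite /Cplus_integrable (_ : EFin \o _ = cst 0%E).
  by apply: integrable0; exact: measurable_Cplus_pairs.
by apply/funext => p /=; rewrite /sq_weight Normc.normc0 expr0n mulr0.
Qed.

Lemma ipDr h k k' : bergman l h -> bergman l k -> bergman l k' ->
  ip h (fun w => k w + k' w) = ip h k + ip h k'.
Proof.
move=> bh bk bk'; rewrite (ip_conj (bergmanD bk bk') bh) ipDl// conjcD.
by rewrite -!ip_conj.
Qed.

Lemma ipZr c h k : bergman l h -> bergman l k ->
  ip h (fun w => c * k w) = conjc c * ip h k.
Proof.
move=> bh bk; rewrite (ip_conj (bergmanZ c bk) bh) ipZl// conjcM.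
by rewrite -ip_conj.
Qed.

Lemma normsqD h k : bergman l h -> bergman l k ->
  normsq (fun w => h w + k w) = normsq h + 2 * complex.Re (ip h k) + normsq k.
Proof.
move=> bh bk; have := ip_normsq (fun w => h w + k w).
have bhk := bergmanD bh bk.
rewrite ipDl// !ipDr// !ip_normsq (ip_conj bh bk) => /(congr1 (@complex.Re R)).
by rewrite !ReImE /= => <-; ring.
Qed.

Lemma normsqZ c h : bergman l h -> normsq (fun w => c * h w) = normc c ^+ 2 * normsq h.
Proof.
move=> /bergman_integrable bh; rewrite /normsq -Cplus_RintegralZ//.
by apply: eq_Cplus_Rintegral => w _; rewrite /sq_weight Normc.normcM; ring.
Qed.

Lemma cauchy_schwarz h k : bergman l h -> bergman l k ->
  normc (ip h k) ^+ 2 <= normsq h * normsq k.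
Proof.
move=> bh bk; set c := ip h k.
(* The squared norm of h + t c k for real t. *)
have H (t : R) : 0 <= normsq h + 2 * t * normc c ^+ 2 + t ^+ 2 * normc c ^+ 2 * normsq k.
  have bck := bergmanZ (t%:C * c) bk.
  have := normsq_ge0 (fun w => h w + t%:C * c * k w).
  rewrite normsqD// normsqZ// ipZr// -/c conjcM Normc.normcM normcC exprMn.
  rewrite conjc_real -(mulrA t%:C) (mulrC (conjc c)) mulcJ -rmorphM.
  by rewrite real_normK ?num_real//= mulrA.
have [c0|c0] := eqVneq (normc c) 0.
  by rewrite c0 expr0n mulr_ge0 ?normsq_ge0.
have c20 : 0 < normc c ^+ 2 by rewrite exprn_gt0// lt_def c0 normc_ge0.
(* When k has norm zero the expression is affine in t and takes the value -1 at the chosen t.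
   Otherwise the quadratic is evaluated at its minimum t = - 1 / [normsq k]. *)
have [k0|k0] := eqVneq (normsq k) 0.
  have := H (- (normsq h + 1) / (2 * normc c ^+ 2)).
  rewrite k0 mulr0 addr0 (_ : 2 * _ * _ = - (normsq h + 1)); last by field.
  lra.
have kp : 0 < normsq k by rewrite lt_def k0 normsq_ge0.
have := H (- (normsq k)^-1).
rewrite (_ : _ + _ = normsq h - normc c ^+ 2 / normsq k); last by field.
by rewrite subr_ge0 ler_pdivrMr.
Qed.

Lemma parallelogram h k : bergman l h -> bergman l k ->
  normsq (fun w => h w + k w) + normsq (fun w => h w - k w) =
  2 * normsq h + 2 * normsq k.
Proof.
move=> bh bk; have bNk := bergmanZ (-1) bk.
rewrite (@eq_normsq (fun w => h w - k w) (fun w => h w + (-1) * k w)); last first.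
  by move=> w _; rewrite mulN1r.
rewrite !normsqD// normsqZ// ipZr// normcN Normc.normc1 expr1n mul1r.
by rewrite rmorphN1 mulN1r ReCN; ring.
Qed.

End BergmanBasics.

Section ProductIntegrable.
Local Open Scope ereal_scope.
Context (d1 d2 : measure_display) (T1 : measurableType d1)
  (T2 : measurableType d2) (R : realType).
Variables (m1 : {sigma_finite_measure set T1 -> \bar R})
  (m2 : {sigma_finite_measure set T2 -> \bar R}).

Lemma integrable_prod_fun (f : T1 -> R) (g : T2 -> R) :
  measurable_fun setT f -> measurable_fun setT g ->
  (forall x, 0 <= f x)%R -> (forall y, 0 <= g y)%R ->
  \int[m1]_x (f x)%:E < +oo -> \int[m2]_y (g y)%:E < +oo ->
  (m1 \x m2).-integrable setT (fun p => (f p.1 * g p.2)%:E).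
Proof.
move=> mf mg f0 g0 If Ig.
have mfg : measurable_fun setT (fun p : T1 * T2 => (f p.1 * g p.2)%R).
  by apply: measurable_funM; apply: measurableT_comp.
apply/integrableP; split; first exact/measurable_EFinP.
rewrite (fubini_tonelli1 (fun p => `|(f p.1 * g p.2)%:E|)); last 2 first.
- by apply: measurableT_comp => //; exact/measurable_EFinP.
- by [].
rewrite /fubini_F (eq_integral (fun x => (f x)%:E * \int[m2]_y (g y)%:E)).
  rewrite ge0_integralZr//; last 3 first.
  - exact/measurable_EFinP.
  - by move=> x _; rewrite lee_fin.
  - by apply: integral_ge0 => y _; rewrite lee_fin.
  apply: lte_mul_pinfty => //.
    by apply: integral_ge0 => y _; rewrite lee_fin.
  by rewrite ge0_fin_numE//; apply: integral_ge0 => y _; rewrite lee_fin.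
move=> x _; rewrite -ge0_integralZl//; last 3 first.
- exact/measurable_EFinP.
- by move=> y _; rewrite lee_fin.
- by rewrite lee_fin.
by apply: eq_integral => y _ /=; rewrite ger0_norm ?mulr_ge0// EFinM.
Qed.

End ProductIntegrable.

(** * Fatou's lemma in the Bergman space; membership of the kernels *)

Section KernelFunction.
Context {R : realType}.
Local Notation mu := (@lebesgue_measure R).
Variable l : nat.
Implicit Types (h k u : R[i] -> R[i]) (w z v c : R[i]).

(** Plays the part of completeness: in each application the pointwise limit is known beforehand and
    analytic, and only its norm has to be controlled. *)
Lemma fatou_bergman (phi : nat -> R[i] -> R[i]) h (C : R) :
  (forall n, bergman l (phi n)) -> analytic h ->
  (forall w, Cplus w -> (fun n => normc (phi n w - h w)) @ \oo --> (0 : R)) ->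
  (forall n, normsq l (phi n) <= C) -> bergman l h /\ normsq l h <= C.
Proof.
move=> bphi ah phih phiC.
have C0 : 0 <= C by apply: le_trans (phiC 0%N); exact: normsq_ge0.
have H : (\int[lebesgue_measure \x lebesgue_measure]_(p in Cplus_pairs) (sq_weight l h (pt p))%:E <= C%:E)%E.
  have limE p : Cplus_pairs p -> limn_einf (fun n => (sq_weight l (phi n) (pt p))%:E) =
      (sq_weight l h (pt p))%:E.
    move=> Cp.
    have cv : (fun n => (sq_weight l (phi n) (pt p))%:E) @ \oo --> (sq_weight l h (pt p))%:E.
      apply: cvg_EFin; first by apply: nearW.
      apply: cvgM; first exact: cvg_cst.
      rewrite /comp /= !expr2.
      have cn : (fun n => normc (phi n (pt p))) @ \oo --> normc (h (pt p)).
        apply/cvgrPdist_lt => e e0.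
        have /cvgrPdist_lt/(_ _ e0) := phih _ Cp.
        apply: filterS => n; rewrite sub0r normrN (ger0_norm (normc_ge0 _)).
        apply: le_lt_trans; rewrite ler_norml; apply/andP; split.
          by rewrite lerNl opprB lerB_normc.
        by rewrite normcBC lerB_normc.
      exact: cvgM.
    by rewrite is_cvg_limn_einfE; [exact: cvg_lim|apply/cvg_ex; eexists; exact: cv].
  apply: (@le_trans _ _ (\int[lebesgue_measure \x lebesgue_measure]_(p in Cplus_pairs)
      limn_einf (fun n => (sq_weight l (phi n) (pt p))%:E))%E).
    rewrite le_eqVlt; apply/orP; left; apply/eqP; apply: eq_integral => p.
    by rewrite inE => /limE.
  apply: le_trans (fatou _ _ _ _) _.
  - exact: measurable_Cplus_pairs.
  - move=> n; apply/measurable_EFinP.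
    exact: sq_weight_measurable (bergman_analytic (bphi n)).
  - by move=> n p Cp; rewrite lee_fin; exact: sq_weight_ge0.
  rewrite limn_einf_lim; apply: lime_le; first exact: is_cvg_einfs.
  apply: nearW => n; apply: ereal_inf_le.
  exists (\int[lebesgue_measure \x lebesgue_measure]_(p in Cplus_pairs)
    (sq_weight l (phi n) (pt p))%:E)%E.
    by exists n => //=; exact: leqnn.
  have ib := bergman_integrable (bphi n).
  rewrite -[X in (X <= _)%E]fineK ?lee_fin; first exact: phiC.
  by apply: integrable_fin_num; [exact: measurable_Cplus_pairs|exact: ib].
have ih : Cplus_integrable (sq_weight l h).
  apply/integrableP; split; first by apply/measurable_EFinP; exact: sq_weight_measurable.
  apply: le_lt_trans (ltry C); apply: le_trans H.
  rewrite le_eqVlt; apply/orP; left; apply/eqP; apply: eq_integral => p; rewrite inE => Cp /=.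
  by rewrite ger0_norm//; exact: sq_weight_ge0.
split; first by apply/bergmanP.
rewrite -lee_fin fineK//; apply: integrable_fin_num => //.
exact: measurable_Cplus_pairs.
Qed.

(* Up to a constant factor, [power_kernel z] is the reproducing kernel of the
   Bergman space at the conjugate of [z]. *)
Definition power_kernel z w : R[i] := (w + z) ^- l.+2.

Lemma CplusD w z : Cplus w -> Cplus z -> Cplus (w + z).
Proof. by move=> Cw Cz; rewrite /Cplus /= ReCD addr_gt0. Qed.

Lemma Cplus_neq0 w : Cplus w -> w != 0.
Proof. by move=> Cw; apply/eqP => w0; move: Cw; rewrite w0 /Cplus /= ltxx. Qed.

Lemma Cplus_conj w : Cplus w -> Cplus (conjc w).
Proof. by rewrite /Cplus /= Re_conjc. Qed.

Lemma analytic_power_kernel z : Cplus z -> analytic (power_kernel z).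
Proof.
move=> Cz; apply/analyticP => w Cw; apply: CdifferentiableV.
  by rewrite expf_neq0// Cplus_neq0//; exact: CplusD.
apply: CdifferentiableX; apply: CdifferentiableD; first exact: Cdifferentiable_id.
exact: Cdifferentiable_cst.
Qed.

Lemma integral_oneDsqrV_lty : (\int[mu]_x ((oneDsqr x)^-1)%:E < +oo)%E.
Proof.
rewrite ge0_symfun_integralT.
- by rewrite -set_itvcy integral0y_oneDsqr -EFinM ltry.
- by move=> x; rewrite invr_ge0 addr_ge0// sqr_ge0.
- exact: continuous_oneDsqrV.
- by move=> x /=; rewrite /oneDsqr sqrrN.
Qed.

(** With A = |w + z|^2 the left side is x^l / A^(l + 2). As x x0 <= A, this is at most x0^(-l) /
    A^2, and one factor A dominates 1 + x^2 while the other dominates 1 + y^2; the result is a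
    product of integrable functions of one variable. *)
Lemma power_kernel_weight_le z : Cplus z -> exists2 C : R, 0 <= C &
  forall w, Cplus w -> sq_weight l (power_kernel z) w <=
    C * ((oneDsqr (complex.Re w))^-1 * (oneDsqr (complex.Im w))^-1).
Proof.
case: z => x0 y0; rewrite /Cplus /= => x00.
(* C1 comes from x^2 + x0^2 <= A; C2 from x0^2 + (y + y0)^2 <= A together with y^2 <= 2 (y + y0)^2 +
   2 y0^2. *)
pose C1 := 1 + (x0 ^+ 2)^-1; pose C2 := 2 + (2 * y0 ^+ 2 + 1) / x0 ^+ 2.
have x20 : 0 < x0 ^+ 2 by rewrite exprn_gt0.
have C10 : 0 < C1 by rewrite ltr_wpDr// invr_ge0 ltW.
have C20 : 0 < C2.
  by rewrite ltr_wpDr// divr_ge0 ?(ltW x20)// addr_ge0// mulr_ge0// sqr_ge0.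
exists (C1 * C2 / x0 ^+ l).
  by rewrite divr_ge0 ?mulr_ge0 ?exprn_ge0 ?ltW.
case=> x y /= xp; rewrite /sq_weight /power_kernel Normc.normcV normcX.
rewrite exprVn -exprM mulnC exprM.
set A := normc ((x +i* y) + (x0 +i* y0)) ^+ 2; rewrite /=.
have AE : A = (x + x0) ^+ 2 + (y + y0) ^+ 2 by rewrite /A normc_sqr.
have A1 : 1 + x ^+ 2 <= C1 * A.
  have : x ^+ 2 + x0 ^+ 2 <= A.
    by rewrite AE; have := sqr_ge0 (y + y0); have := mulr_gt0 xp x00; rewrite sqrrD; lra.
  move=> h; apply: le_trans (ler_wpM2l (ltW C10) h); rewrite /C1.
  rewrite (_ : _ * _ = 1 + x ^+ 2 + x0 ^+ 2 + x ^+ 2 / x0 ^+ 2); last by field; rewrite gt_eqF.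
  have : 0 <= x ^+ 2 / x0 ^+ 2 by rewrite divr_ge0// ltW// exprn_gt0.
  lra.
have A2 : 1 + y ^+ 2 <= C2 * A.
  have : x0 ^+ 2 + (y + y0) ^+ 2 <= A.
    by rewrite AE; have := mulr_gt0 xp x00; have := sqr_ge0 x; rewrite sqrrD; lra.
  move=> h; apply: le_trans (ler_wpM2l (ltW C20) h).
  rewrite (_ : C2 * _ = 2 * x0 ^+ 2 + 2 * y0 ^+ 2 + 1 + 2 * (y + y0) ^+ 2 +
    (2 * y0 ^+ 2 + 1) / x0 ^+ 2 * (y + y0) ^+ 2); last first.
    by rewrite /C2; field; rewrite gt_eqF.
  have : 0 <= (2 * y0 ^+ 2 + 1) / x0 ^+ 2 * (y + y0) ^+ 2.
    by rewrite mulr_ge0 ?sqr_ge0// divr_ge0 ?(ltW x20)// addr_ge0// mulr_ge0// sqr_ge0.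
  have := sqr_ge0 (y + y0 *+ 2); have := sqr_ge0 x0; rewrite !sqrrD; nra.
have Ap : 0 < A.
  by rewrite -(pmulr_rgt0 _ C10); apply: lt_le_trans A1; rewrite ltr_wpDr// sqr_ge0.
have xA : x ^+ l <= A ^+ l / x0 ^+ l.
  rewrite ler_pdivlMr ?exprn_gt0// -exprMn lerXn2r ?nnegrE ?(ltW Ap)//.
    by rewrite mulr_ge0 ?ltW.
  by rewrite AE; have := sqr_ge0 (y + y0); have := sqr_ge0 x; have := mulr_gt0 xp x00;
     rewrite sqrrD; nra.
have A0 : A != 0 by rewrite gt_eqF.
have xn0 : x0 != 0 by rewrite gt_eqF.
have D1 : 0 < oneDsqr x by rewrite ltr_wpDr ?sqr_ge0.
have D2 : 0 < oneDsqr y by rewrite ltr_wpDr ?sqr_ge0.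
apply: (@le_trans _ _ (A ^+ l / x0 ^+ l / A ^+ l.+2)).
  by rewrite ler_wpM2r// invr_ge0 exprn_ge0// ltW.
rewrite (_ : A ^+ l / x0 ^+ l / A ^+ l.+2 = (x0 ^+ l)^-1 / A ^+ 2); last first.
  by rewrite -addn2 exprD; field; apply/and3P; split => //; exact: expf_neq0.
rewrite (_ : C1 * C2 / x0 ^+ l * _ = (x0 ^+ l)^-1 * ((C1 / oneDsqr x) * (C2 / oneDsqr y))); last first.
  by field; rewrite ?expf_neq0 ?gt_eqF.
rewrite ler_wpM2l ?invr_ge0 ?exprn_ge0 ?(ltW x00)// expr2 invfM.
apply: ler_pM; rewrite ?invr_ge0 ?(ltW Ap)//.
  by rewrite ler_pdivlMr// mulrC ler_pdivrMr.
by rewrite ler_pdivlMr// mulrC ler_pdivrMr.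
Qed.

Lemma bergman_power_kernel z : Cplus z -> bergman l (power_kernel z).
Proof.
move=> Cz; have aE := analytic_power_kernel Cz.
apply/bergmanP; split => //.
have [C C0 HC] := power_kernel_weight_le Cz.
apply: (@Cplus_integrable_le _ _ (fun w => C *
   ((oneDsqr (complex.Re w))^-1 * (oneDsqr (complex.Im w))^-1))).
- exact: sq_weight_measurable.
- apply: Cplus_integrableZ.
  have mo : measurable_fun [set: R] (fun x : R => (oneDsqr x)^-1).
    by apply: continuous_measurable_fun; exact: continuous_oneDsqrV.
  have o0 (x : R) : 0 <= (oneDsqr x)^-1 by rewrite invr_ge0 addr_ge0// sqr_ge0.
  have := @integrable_prod_fun _ _ _ _ _ mu mu _ _ mo mo o0 o0 integral_oneDsqrV_lty integral_oneDsqrV_lty.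
  apply: integrableS => //; exact: measurable_Cplus_pairs.
- by move=> w Cw; rewrite ger0_norm ?sq_weight_ge0// HC.
Qed.

End KernelFunction.

(** * The reproducing property *)

Section CutoffCalculus.
Context {R : realType}.
Implicit Types (w z v : R[i]) (N : R).

Definition ReC w : R[i] := (complex.Re w)%:C.
Definition ImC w : R[i] := (complex.Im w)%:C.

Lemma is_wirtinger_ReC w : is_wirtinger ReC w (2^-1) (2^-1).
Proof.
have := is_wirtingerZ 2^-1 (is_wirtingerD (is_wirtinger_id w) (is_wirtinger_conj w)).
rewrite addr0 add0r mulr1; apply: (is_wirtinger_near ltr01) => v _.
by rewrite addcJ mulrA mulVf ?pnatr_eq0// mul1r.
Qed.

Lemma is_wirtinger_ImC w : is_wirtinger ImC w (- 'i%C / 2) ('i%C / 2).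
Proof.
have := is_wirtingerZ (- 'i%C / 2) (is_wirtingerD (is_wirtinger_id w)
  (is_wirtingerZ (-1) (is_wirtinger_conj w))).
rewrite mulr0 addr0 add0r !mulr1 mulrN1 mulNr opprK -mulNr.
apply: (is_wirtinger_near ltr01) => v _; rewrite mulN1r subcJ -/(ImC v).
transitivity (- ('i%C ^+ 2) * ImC v); last by rewrite sqr_i opprK mul1r.
by set t := ImC v; set j : R[i] := 'i%C; field.
Qed.

(** A rational cutoff with an explicit derivative: the factors vanish on the sides Im w = N and Im w
    = -N, Re w = N, and Re w = 1/N of the rectangle, and each tends to 1 as N grows. *)
Definition cutoff N w : R[i] :=
  (1 - ImC w ^+ 2 / (N ^+ 2)%:C) * (1 - ReC w / N%:C) * (1 - (N%:C * ReC w)^-1).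

(* The product of [Re w] with the conj-derivative of [cutoff N]. *)
Definition cutoff_deriv N w : R[i] :=
  ReC w * ((- 'i%C * ImC w / (N ^+ 2)%:C * (1 - ReC w / N%:C) +
      (1 - ImC w ^+ 2 / (N ^+ 2)%:C) * (- (2 * N%:C)^-1)) * (1 - (N%:C * ReC w)^-1) +
  (1 - ImC w ^+ 2 / (N ^+ 2)%:C) * (1 - ReC w / N%:C) * (2 * N%:C * ReC w ^+ 2)^-1).

Lemma is_wirtinger_cutoff N w : 0 < N -> Cplus w ->
  exists A, is_wirtinger (cutoff N) w A (cutoff_deriv N w / ReC w).
Proof.
move=> N0 Cw.
have x0 : ReC w != 0 by rewrite /ReC; rewrite rc_neq0// gt_eqF.
have NC0 : N%:C != 0 by rewrite rc_neq0// gt_eqF.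
have NC2 : (N ^+ 2)%:C = N%:C ^+ 2 by rewrite rcX.
have w1 := is_wirtingerD (is_wirtinger_cst 1 w)
  (is_wirtingerZ (- (N ^+ 2)%:C^-1) (is_wirtingerX 1 (is_wirtinger_ImC w))).
have w2 := is_wirtingerD (is_wirtinger_cst 1 w)
  (is_wirtingerZ (- N%:C^-1) (is_wirtinger_ReC w)).
have NX0 : N%:C * ReC w != 0 by rewrite mulf_neq0.
have w3 := is_wirtingerD (is_wirtinger_cst 1 w)
  (is_wirtingerZ (-1) (@is_wirtingerV _ (fun v => N%:C * ReC v) _ _ _ NX0
     (is_wirtingerZ N%:C (is_wirtinger_ReC w)))).
have := is_wirtingerM (is_wirtingerM w1 w2) w3.
set A := (X in is_wirtinger _ _ X _); set B := (X in is_wirtinger _ _ _ X) => W.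
exists A; rewrite (_ : cutoff_deriv N w / ReC w = B).
  apply: (is_wirtinger_near ltr01 _ W) => v _.
  rewrite /cutoff; set r := (N%:C * ReC v)^-1; ring.
rewrite /B /cutoff_deriv NC2 -[ReC]/ReC; move: x0 NC0 NX0.
set X := ReC w; set Y := ImC w; set M := N%:C => x0 NC0 NX0; field.
by rewrite x0 NC0.
Qed.

Lemma Ccontinuous_cst (c w : R[i]) : Ccontinuous_at (fun=> c) w.
Proof. by move=> e e0; exists 1 => // v _; rewrite subrr Normc.normc0. Qed.

Lemma Ccontinuous_ReC w : Ccontinuous_at ReC w.
Proof. exact: is_wirtinger_continuous (is_wirtinger_ReC w). Qed.

Lemma Ccontinuous_ImC w : Ccontinuous_at ImC w.
Proof. exact: is_wirtinger_continuous (is_wirtinger_ImC w). Qed.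

Lemma Ccontinuous_atN (h : R[i] -> R[i]) w : Ccontinuous_at h w ->
  Ccontinuous_at (fun v => - h v) w.
Proof. by move=> ch e /ch[r r0 hr]; exists r => // v /hr; rewrite -opprD normcN. Qed.

Lemma Ccontinuous_cutoff N w : 0 < N -> Cplus w ->
  Ccontinuous_at (cutoff N) w /\ Ccontinuous_at (cutoff_deriv N) w.
Proof.
move=> N0 Cw.
have x0 : ReC w != 0 by rewrite /ReC; rewrite rc_neq0// gt_eqF.
have NC0 : N%:C != 0 by rewrite rc_neq0// gt_eqF.
have c1 : Ccontinuous_at (fun v => 1 - ImC v ^+ 2 / (N ^+ 2)%:C) w.
  apply: Ccontinuous_atD; first exact: Ccontinuous_cst.
  apply: Ccontinuous_atN; apply: Ccontinuous_atM; last exact: Ccontinuous_cst.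
  exact/Ccontinuous_atX/Ccontinuous_ImC.
have c2 : Ccontinuous_at (fun v => 1 - ReC v / N%:C) w.
  apply: Ccontinuous_atD; first exact: Ccontinuous_cst.
  apply: Ccontinuous_atN; apply: Ccontinuous_atM; last exact: Ccontinuous_cst.
  exact: Ccontinuous_ReC.
have c3 : Ccontinuous_at (fun v => 1 - (N%:C * ReC v)^-1) w.
  apply: Ccontinuous_atD; first exact: Ccontinuous_cst.
  apply: Ccontinuous_atN; apply: Ccontinuous_atV; first by rewrite mulf_neq0.
  by apply: Ccontinuous_atM; [exact: Ccontinuous_cst|exact: Ccontinuous_ReC].
split; first by apply: Ccontinuous_atM => //; exact: Ccontinuous_atM.
apply: Ccontinuous_atM; first exact: Ccontinuous_ReC.
apply: Ccontinuous_atD; apply: Ccontinuous_atM => //.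
- apply: Ccontinuous_atD; apply: Ccontinuous_atM => //; last exact: Ccontinuous_cst.
  apply: Ccontinuous_atM; last exact: Ccontinuous_cst.
  by apply: Ccontinuous_atM; [exact: Ccontinuous_cst|exact: Ccontinuous_ImC].
- exact: Ccontinuous_atM.
- apply: Ccontinuous_atV.
    by rewrite !mulf_neq0 ?pnatr_eq0// expf_neq0.
  apply: Ccontinuous_atM; first exact: Ccontinuous_cst.
  exact/Ccontinuous_atX/Ccontinuous_ReC.
Qed.

(** The constant bounds serve domination, the bounds in 1 / N serve pointwise convergence. The
    derivative of the last factor of the cutoff is of order N near Re w = 1/N, and it is the factor
    Re w in [cutoff_deriv] that keeps the latter bounded. *)
Lemma cutoff_bounds N w : 1 <= N -> rect (N^-1) N (- N) N w ->
  [/\ normc (cutoff N w) <= 1,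
  normc (cutoff N w - 1) <= (complex.Im w ^+ 2 + complex.Re w + (complex.Re w)^-1) / N,
  normc (cutoff_deriv N w) <= 2 &
  normc (cutoff_deriv N w) <=
    (complex.Re w * `|complex.Im w| + complex.Re w + (complex.Re w)^-1) / N].
Proof.
case: w => x y N1 [h1 h2 h3 h4]; rewrite /= in h1 h2 h3 h4.
rewrite -[complex.Re (x +i* y)]/x -[complex.Im (x +i* y)]/y.
have N0 : 0 < N by apply: lt_le_trans N1.
have x0 : 0 < x by apply: lt_le_trans h1; rewrite invr_gt0.
have yN : `|y| <= N by rewrite ler_norml h3.
pose al := 1 - y ^+ 2 / N ^+ 2; pose be := 1 - x / N; pose ga := 1 - (N * x)^-1.
have alE : 1 - ImC (x +i* y) ^+ 2 / (N ^+ 2)%:C = al%:C.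
  by rewrite /al /ImC !rcE.
have beE : 1 - ReC (x +i* y) / N%:C = be%:C.
  by rewrite /be /ReC !rcE.
have gaE : 1 - (N%:C * ReC (x +i* y))^-1 = ga%:C.
  by rewrite /ga /ReC !rcE.
have chiE : cutoff N (x +i* y) = (al * be * ga)%:C.
  by rewrite /cutoff alE beE gaE !rcM.
have N20 : 0 < N ^+ 2 by rewrite exprn_gt0.
have y2 : y ^+ 2 <= N ^+ 2 by rewrite -(real_normK (num_real y)) lerXn2r ?nnegrE ?(ltW N0).
have al01 : 0 <= al <= 1.
  rewrite /al subr_ge0 ler_pdivrMr// mul1r y2 /= gerBl divr_ge0 ?sqr_ge0//.
have be01 : 0 <= be <= 1.
  by rewrite /be subr_ge0 ler_pdivrMr// mul1r h2 /= gerBl divr_ge0 ?ltW.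
have Nx1 : 1 <= N * x by rewrite mulrC -ler_pdivrMr// div1r.
have ga01 : 0 <= ga <= 1.
  rewrite /ga subr_ge0 invf_le1 ?mulr_gt0// Nx1 /= gerBl invr_ge0 mulr_ge0 ?ltW//.
have a1 : 1 - al <= y ^+ 2 / N.
  rewrite /al opprB addrC subrK ler_wpM2l ?sqr_ge0// lef_pV2 ?posrE//.
  by rewrite expr2 ler_peMr// ltW.
have b1 : 1 - be <= x / N by rewrite /be; lra.
have g1 : 1 - ga <= x^-1 / N by rewrite /ga invfM mulrC; lra.
move/andP: al01 => [al0 al1]; move/andP: be01 => [be0 be1]; move/andP: ga01 => [ga0 ga1].
have ab1 : al * be <= 1 by rewrite mulr_ile1.
have ab0 : 0 <= al * be by rewrite mulr_ge0.
have abg1 : al * be * ga <= 1 by rewrite mulr_ile1.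
have abg0 : 0 <= al * be * ga by rewrite mulr_ge0.
have dE : cutoff_deriv N (x +i* y) =
   (- (x * y / N ^+ 2 * be * ga))%:C * 'i%C +
   (x / (2 * N) * (- al * ga) + al * be * (2 * N * x)^-1)%:C.
  rewrite /cutoff_deriv alE beE gaE /ReC /ImC /=.
  have xC : x%:C != 0 by rewrite rc_neq0// gt_eqF.
  have NC : N%:C != 0 by rewrite rc_neq0// gt_eqF.
  rewrite !rcE.
  set X := x%:C; set Y := y%:C; set M := N%:C; set A := al%:C; set B := be%:C; set C := ga%:C.
  by field; rewrite xC NC.
have d1 : normc (cutoff_deriv N (x +i* y)) <= x * `|y| / N ^+ 2 + x / (2 * N) + (2 * N * x)^-1.
  rewrite dE; apply: le_trans (normcD _ _) _; rewrite Normc.normcM !normcC.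
  rewrite (_ : normc 'i%C = 1) ?mulr1; last by rewrite /= expr0n expr1n /= add0r sqrtr1.
  rewrite normrN -addrA; apply: lerD.
    rewrite !normrM normfV (gtr0_norm x0) (gtr0_norm N20) (ger0_norm be0) (ger0_norm ga0).
    have bg : be * ga <= 1 by exact: mulr_ile1.
    rewrite -(mulrA _ be) ler_piMr//; apply: divr_ge0; last exact: ltW.
    by apply: mulr_ge0; [exact: ltW|exact: normr_ge0].
  apply: le_trans (ler_normD _ _) _; apply: lerD.
    have t0 : 0 <= x / (2 * N) by rewrite divr_ge0 ?mulr_ge0 ?ltW.
    have ag : al * ga <= 1 by exact: mulr_ile1.
    by rewrite normrM (ger0_norm t0) ler_piMr// mulNr normrN ger0_norm// mulr_ge0.
  have t0 : 0 <= (2 * N * x)^-1 by rewrite invr_ge0 !mulr_ge0 ?ltW.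
  by rewrite normrM (ger0_norm t0) ler_piMl// ger0_norm.
split.
- by rewrite chiE normcC ger0_norm.
- rewrite chiE -rc1 -rcN -rcD normcC distrC ger0_norm ?subr_ge0//.
  rewrite (_ : (_ + _ + _) / N = y ^+ 2 / N + x / N + x^-1 / N); last by rewrite !mulrDl.
  have e1 : al * be * ga = al - al * (1 - be) - al * be * (1 - ga) by ring.
  have e2 : al * (1 - be) <= 1 - be by rewrite ler_piMl// subr_ge0.
  have e3 : al * be * (1 - ga) <= 1 - ga by rewrite ler_piMl// subr_ge0.
  lra.
- apply: le_trans d1 _.
  have t1 : x * `|y| / N ^+ 2 <= 1.
    by rewrite ler_pdivrMr// mul1r expr2 ler_pM// ltW.
  have t2 : x / (2 * N) <= 2^-1.
    rewrite ler_pdivrMr ?mulr_gt0// mulrA mulVf ?pnatr_eq0// mul1r//.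
  have t3 : (2 * N * x)^-1 <= 2^-1.
    by rewrite lef_pV2 ?posrE ?mulr_gt0// -mulrA ler_peMr.
  lra.
- apply: le_trans d1 _.
  rewrite (_ : (_ + _ + _) / N = x * `|y| / N + x / N + x^-1 / N); last by rewrite !mulrDl.
  have t1 : x * `|y| / N ^+ 2 <= x * `|y| / N.
    rewrite ler_wpM2l ?mulr_ge0 ?(ltW x0)// lef_pV2 ?posrE//.
    by rewrite expr2 ler_peMr// ltW.
  have q1 : 0 < x / N by rewrite divr_gt0.
  have q2 : 0 < x^-1 / N by rewrite divr_gt0// invr_gt0.
  have t2 : x / (2 * N) = x / N / 2 by field; rewrite gt_eqF.
  have t3 : (2 * N * x)^-1 = x^-1 / N / 2 by field; rewrite !gt_eqF.
  lra.
Qed.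

Lemma cutoff_boundary N t : N != 0 ->
  [/\ cutoff N (t +i* (- N)) = 0, cutoff N (t +i* N) = 0,
      cutoff N (N^-1 +i* t) = 0 & cutoff N (N +i* t) = 0].
Proof.
move=> N0.
have NC : N%:C != 0 by exact: rc_neq0.
have NC2 : (N ^+ 2)%:C = N%:C ^+ 2 by rewrite rcX.
rewrite /cutoff /ImC /ReC NC2 /=; split.
- by rewrite rcN sqrrN divff ?expf_neq0// subrr !mul0r.
- by rewrite divff ?expf_neq0// subrr !mul0r.
- by rewrite rcV mulfV// invr1 subrr mulr0.
- by rewrite divff// subrr mulr0 mul0r.
Qed.

End CutoffCalculus.

Section GreenFunction.
Context {R : realType}.
Local Notation mu2 := (@lebesgue_measure R \x @lebesgue_measure R)%E.
Variable l : nat.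
Implicit Types (h : R[i] -> R[i]) (w v : R[i]).

Section Vanishing.
Variables (z : R[i]) (h : R[i] -> R[i]) (A0 : R[i]).
Hypotheses (Cz : Cplus z) (bh : bergman l h) (hz : h z = 0)
  (dh : is_wirtinger h z A0 0).

(** Since h(z) = 0, the singularity is removable; - A0 = - h'(z) is the limit at z. *)
Definition quot w : R[i] := if w == z then - A0 else h w / (z - w).
Definition conj_shift w : R[i] := conjc w + z.
Local Notation q := conj_shift.
Local Notation t w := (2 * ReC w / q w).
(* [kern] is the conj-derivative of [quot w * t w ^+ l.+1], and
   [kern_quot w * ReC w] is that function itself. *)
Definition kern w : R[i] := l.+1%:R * t w ^+ l * h w / q w ^+ 2.
Definition kern_quot w : R[i] := quot w * (2 / q w * t w ^+ l).
Definition green_fun N w : R[i] := quot w * t w ^+ l.+1 * cutoff N w.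
Definition green_deriv N w : R[i] :=
  kern w * cutoff N w + kern_quot w * cutoff_deriv N w.

Let q_neq0 w : Cplus w -> q w != 0.
Proof. by move=> Cw; apply: Cplus_neq0; apply: CplusD => //; exact: Cplus_conj. Qed.

Let ReC_neq0 w : Cplus w -> ReC w != 0.
Proof. by move=> Cw; apply: rc_neq0; rewrite gt_eqF. Qed.

Let quot_near w : w != z -> exists2 r : R, 0 < r &
  forall v, normc (v - w) < r -> h v / (z - v) = quot v.
Proof.
move=> wz; exists (normc (z - w)); first by rewrite normc_gt0 subr_eq0 eq_sym.
move=> v; rewrite /quot; case: eqP => // ->; by rewrite ltxx.
Qed.

Let Cquot_wirtinger w : Cplus w -> w != z -> exists A, is_wirtinger quot w A 0.
Proof.
move=> Cw wz; have [r r0 hr] := quot_near wz.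
apply: Cdifferentiable_near r0 hr _; apply: CdifferentiableM.
  by move/analyticP: (bergman_analytic bh); apply.
apply: CdifferentiableV; first by rewrite subr_eq0 eq_sym.
exists (-1).
have := is_wirtingerD (is_wirtinger_cst z w) (is_wirtingerZ (-1) (is_wirtinger_id w)).
rewrite mulr1 mulr0 !add0r; apply: (is_wirtinger_near ltr01) => v _.
by rewrite mulN1r.
Qed.

Let Cquot_continuous w : Cplus w -> Ccontinuous_at quot w.
Proof.
move=> Cw; have [->|wz] := eqVneq w z; last first.
  by have [A] := Cquot_wirtinger Cw wz; exact: is_wirtinger_continuous.
move=> e e0; have e20 : 0 < e / 2 by rewrite divr_gt0.
have [r r0 hr] := dh e20; exists r => // v vr.
have [vz|vz] := eqVneq v z; first by rewrite vz subrr Normc.normc0.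
rewrite (_ : quot z = - A0) /quot ?eqxx// (negbTE vz).
have := hr v vr; rewrite hz subr0 mul0r addr0 => H.
have nv : 0 < normc (v - z) by rewrite normc_gt0 subr_eq0.
have d1 : v - z != 0 by rewrite subr_eq0.
have d2 : z - v != 0 by rewrite subr_eq0 eq_sym.
rewrite (_ : _ - _ = - ((h v - A0 * (v - z)) / (v - z))); last first.
  by field; rewrite ?d1 ?d2.
rewrite normcN Normc.normcM Normc.normcV; apply: le_lt_trans (_ : e / 2 < e).
  by rewrite ler_pdivrMr.
by rewrite ltr_pdivrMr// ltr_pMr// ltr1n.
Qed.

Let q_wirtinger w : is_wirtinger q w 0 1.
Proof.
have := is_wirtingerD (is_wirtinger_conj w) (is_wirtinger_cst z w).
by rewrite !addr0.
Qed.

(** The numerator comes from q w - 2 Re w = z - w, and it cancels the denominator of [quot] in the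
    derivative of the product. *)
Let t_wirtinger w : Cplus w -> exists A, is_wirtinger (fun v => t v) w A ((z - w) / q w ^+ 2).
Proof.
move=> Cw; have := is_wirtingerM (is_wirtingerZ 2 (is_wirtinger_ReC w))
  (is_wirtingerV (q_neq0 Cw) (q_wirtinger w)).
set A := (X in is_wirtinger _ _ X _); set B := (X in is_wirtinger _ _ _ X) => W.
exists A; rewrite (_ : _ / _ = B)//.
have zq : z - w = q w - 2 * ReC w by rewrite /q -addcJ; ring.
by rewrite /B zq; have := q_neq0 Cw; set Q := q w; set X := ReC w => Q0; field.
Qed.

Lemma green_fun_wirtinger N w : 0 < N -> Cplus w -> w != z ->
  exists A, is_wirtinger (green_fun N) w A (green_deriv N w).
Proof.
move=> N0 Cw wz.
have [A1 W1] := Cquot_wirtinger Cw wz; have [A2 W2] := t_wirtinger Cw.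
have [A3 W3] := is_wirtinger_cutoff N0 Cw.
have := is_wirtingerM (is_wirtingerM W1 (is_wirtingerX l W2)) W3.
set A := (X in is_wirtinger _ _ X _); set B := (X in is_wirtinger _ _ _ X) => W.
exists A; rewrite (_ : green_deriv N w = B)//.
rewrite /B /green_deriv /kern /kern_quot /quot (negbTE wz) (exprS (t w)).
have Q0 := q_neq0 Cw; have X0 := ReC_neq0 Cw; have D0 : z - w != 0 by rewrite subr_eq0 eq_sym.
set T := t w ^+ l; set C := cutoff N w; set C' := cutoff_deriv N w.
by field; rewrite Q0 X0 D0.
Qed.

Let t_continuous w : Cplus w -> Ccontinuous_at (fun v => t v) w.
Proof. by move=> /t_wirtinger[A]; exact: is_wirtinger_continuous. Qed.

Let q_continuous w : Ccontinuous_at q w.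
Proof. exact: is_wirtinger_continuous (q_wirtinger w). Qed.

Lemma kern_continuous w : Cplus w -> Ccontinuous_at kern w.
Proof.
move=> Cw; apply: Ccontinuous_atM; last first.
  by apply: Ccontinuous_atV; [rewrite expf_neq0// q_neq0|exact: Ccontinuous_atX].
apply: Ccontinuous_atM; last exact: analytic_continuous (bergman_analytic bh) Cw.
apply: Ccontinuous_atM; first exact: Ccontinuous_cst.
by apply: Ccontinuous_atX; exact: t_continuous.
Qed.

Lemma kern_quot_continuous w : Cplus w -> Ccontinuous_at kern_quot w.
Proof.
move=> Cw; apply: Ccontinuous_atM; first exact: Cquot_continuous.
apply: Ccontinuous_atM; last by apply: Ccontinuous_atX; exact: t_continuous.
apply: Ccontinuous_atM; first exact: Ccontinuous_cst.
by apply: Ccontinuous_atV; [exact: q_neq0|exact: q_continuous].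
Qed.

Lemma green_fun_continuous N w : 0 < N -> Cplus w -> Ccontinuous_at (green_fun N) w.
Proof.
move=> N0 Cw; apply: Ccontinuous_atM; last by have [] := Ccontinuous_cutoff N0 Cw.
apply: Ccontinuous_atM; first exact: Cquot_continuous.
by apply: Ccontinuous_atX; exact: t_continuous.
Qed.

Lemma green_deriv_continuous N w : 0 < N -> Cplus w -> Ccontinuous_at (green_deriv N) w.
Proof.
move=> N0 Cw; have [c1 c2] := Ccontinuous_cutoff N0 Cw.
by apply: Ccontinuous_atD; apply: Ccontinuous_atM => //;
  [exact: kern_continuous|exact: kern_quot_continuous].
Qed.

Lemma rect_sub_Cplus N : 0 < N -> rect N^-1 N (- N) N `<=` @Cplus R.
Proof.
by move=> N0 w [h1 _ _ _]; rewrite /Cplus /=; apply: lt_le_trans h1; rewrite invr_gt0.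
Qed.

Lemma green_deriv_integral0 N : 0 < N -> N^-1 < complex.Re z -> complex.Re z < N ->
  `|complex.Im z| < N ->
  \int[mu2]_(p in rect_pairs N^-1 N (- N) N) complex.Re (green_deriv N (pt p)) = 0.
Proof.
move=> N0 h1 h2; rewrite ltr_norml => /andP[h3 h4].
have Nn0 : N != 0 by rewrite gt_eqF.
apply: (@green_Re _ _ (green_fun N) (green_deriv N) z _ _ _ _ (@Copen_Cplus R)) => //.
- by move=> w; exact: green_fun_continuous.
- by move=> w; exact: green_deriv_continuous.
- exact: rect_sub_Cplus.
- by move=> w /(rect_sub_Cplus N0) Cw wz; exact: green_fun_wirtinger.
- by move=> x; rewrite /green_fun; have [-> _ _ _] := cutoff_boundary x Nn0; rewrite mulr0.
- by move=> x; rewrite /green_fun; have [_ -> _ _] := cutoff_boundary x Nn0; rewrite mulr0.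
- by move=> x; rewrite /green_fun; have [_ _ -> _] := cutoff_boundary x Nn0; rewrite mulr0.
- by move=> x; rewrite /green_fun; have [_ _ _ ->] := cutoff_boundary x Nn0; rewrite mulr0.
Qed.

Let normc_q w : normc (q w) = normc (w + conjc z).
Proof. by rewrite -normc_conj /q conjcD conjcK. Qed.

Let nq_gt0 w : Cplus w -> 0 < normc (q w).
Proof. by move=> Cw; rewrite normc_gt0 q_neq0. Qed.

(** Away from z, |z - w| is comparable with |q w|, which gives the first term. Near z the quotient
    is bounded, and so is |q w|, so a multiple of any negative power of |q w| absorbs it; the
    exponent l + 3 is the one that yields the square of the kernel in [kern_dominated]. *)
Lemma quot_bound : exists2 C : R, 0 <= C & forall w, Cplus w ->
  normc (quot w) <= C * (normc (h w) / normc (q w) + normc (q w) ^- l.+3).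
Proof.
have [r r0 hr] := Cquot_continuous Cz ltr01.
pose x0 := complex.Re z; have x00 : 0 < x0 by exact: Cz.
pose M := normc (quot z) + 1; have M0 : 0 <= M by rewrite addr_ge0 ?normc_ge0.
(* Both constants come from |q w| <= |w - z| + 2 x0: this is at most rho inside the disc of radius
   r, and at most C2 |w - z| outside. *)
pose rho := r + 2 * x0; have rho0 : 0 < rho by rewrite addr_gt0// mulr_gt0.
pose C1 := M * rho ^+ l.+3; pose C2 := 1 + 2 * x0 / r.
have C10 : 0 <= C1 by rewrite mulr_ge0// exprn_ge0// ltW.
have C20 : 0 <= C2 by rewrite addr_ge0// divr_ge0 ?mulr_ge0 ?ltW.
exists (C1 + C2); first exact: addr_ge0.
move=> w Cw.
have nq : normc (q w) <= normc (w - z) + 2 * x0.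
  rewrite normc_q (_ : w + conjc z = (w - z) + (z + conjc z)); last by ring.
  apply: le_trans (normcD _ _) _; rewrite lerD2l addcJ -rc_nat -rcM normcC.
  by rewrite ger0_norm// mulr_ge0// ltW.
have q0 := nq_gt0 Cw.
have T1 : 0 <= normc (h w) / normc (q w) by rewrite divr_ge0 ?normc_ge0.
have T2 : 0 <= normc (q w) ^- l.+3 by rewrite invr_ge0 exprn_ge0 ?normc_ge0.
have [wr|rw] := ltP (normc (w - z)) r.
  have qM : normc (quot w) <= M.
    by have := hr _ wr; have := lerB_normc (quot w) (quot z); rewrite /M; lra.
  apply: le_trans qM _; apply: (@le_trans _ _ (C1 * normc (q w) ^- l.+3)).
    rewrite /C1 -mulrA ler_peMr// ler_pdivlMr ?exprn_gt0// mul1r.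
    by rewrite lerXn2r ?nnegrE ?(ltW q0) ?(ltW rho0)// (le_trans nq)// lerD2r ltW.
  apply: ler_pM => //; first by rewrite lerDl.
  by rewrite lerDr.
have wz : w != z by apply/eqP => wz; move: rw; rewrite wz subrr Normc.normc0 leNgt r0.
rewrite /quot (negbTE wz) Normc.normcM Normc.normcV.
have zw0 : 0 < normc (z - w) by rewrite normc_gt0 subr_eq0 eq_sym.
apply: (@le_trans _ _ (C2 * (normc (h w) / normc (q w)))).
  rewrite mulrCA ler_wpM2l ?normc_ge0// ler_pdivlMr// mulrC ler_pdivrMr//.
  apply: le_trans nq _; rewrite (normcBC z w).
  have H : 2 * x0 <= 2 * x0 / r * normc (w - z).
    by rewrite mulrAC ler_pdivlMr// ler_wpM2l// mulr_ge0// ltW.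
  by rewrite /C2; lra.
by apply: ler_pM => //; rewrite ?lerDr ?lerDl.
Qed.

Let E := power_kernel l (conjc z).

Let normc_E w : normc (E w) = normc (q w) ^- l.+2.
Proof. by rewrite /E /power_kernel Normc.normcV normcX -normc_q. Qed.

Let normc_t w : Cplus w -> normc (t w) = 2 * complex.Re w / normc (q w).
Proof.
move=> Cw; rewrite Normc.normcM Normc.normcV /ReC -rc_nat -rcM normcC.
by rewrite ger0_norm// mulr_ge0// ltW.
Qed.

(** Both terms are bounded by multiples of (Re w)^l |h| |E| and (Re w)^l |E|^2, which are integrable
    because h and E lie in the space. The bound is free of N, as dominated convergence requires. *)
Lemma kern_dominated : exists D : R[i] -> R, Cplus_integrable D /\
  forall w, Cplus w -> normc (kern w) + 2 * normc (kern_quot w) <= D w.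
Proof.
have bE : bergman l E by apply: bergman_power_kernel; exact: Cplus_conj.
have [C C0 HC] := quot_bound.
have I (u u0 : R[i] -> R[i]) : bergman l u -> bergman l u0 ->
    Cplus_integrable (fun w => complex.Re w ^+ l * (normc (u w) * normc (u0 w))).
  move=> bu bv; apply: (weight_integrable bu bv) => [|w Cw].
    apply: Cplus_measurable_continuous => w Cw.
    have := Rcontinuous_normc (Ccontinuous_atM
      (analytic_continuous (bergman_analytic bu) Cw)
      (analytic_continuous (bergman_analytic bv) Cw)).
    by under eq_fun do rewrite Normc.normcM.
  by rewrite ger0_norm// mulr_ge0 ?normc_ge0.
exists (fun w => l.+1%:R * 2 ^+ l * (complex.Re w ^+ l * (normc (h w) * normc (E w))) +
  2 * (C * 2 ^+ l.+1) * (complex.Re w ^+ l * (normc (h w) * normc (E w)) +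
     complex.Re w ^+ l * (normc (E w) * normc (E w)))); split.
  apply: Cplus_integrableD; first by apply: Cplus_integrableZ; exact: I.
  by apply: Cplus_integrableZ; apply: Cplus_integrableD; exact: I.
move=> w Cw; have x0 : 0 < complex.Re w := Cw.
have q0 := nq_gt0 Cw; have qn0 : normc (q w) != 0 by rewrite gt_eqF.
apply: lerD.
  rewrite /kern !Normc.normcM Normc.normcV !normcX normc_t// normc_E.
  rewrite -rc_nat normcC ger0_norm ?ler0n//.
  rewrite !exprMn exprVn !exprS le_eqVlt; apply/orP; left; apply/eqP.
  by field; rewrite expf_neq0.
rewrite -mulrA ler_wpM2l//.
rewrite /kern_quot !Normc.normcM Normc.normcV !normcX normc_t//.
rewrite -rc_nat normcC ger0_norm//.
have T0 : 0 <= 2 / normc (q w) * (2 * complex.Re w / normc (q w)) ^+ l.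
  by rewrite mulr_ge0 ?exprn_ge0 ?divr_ge0 ?mulr_ge0 ?ltW.
apply: le_trans (ler_wpM2r T0 (HC _ Cw)) _.
rewrite normc_E !exprMn exprVn !exprS le_eqVlt; apply/orP; left; apply/eqP.
by field; rewrite expf_neq0.
Qed.

Lemma green_deriv_le N w : 1 <= N -> rect N^-1 N (- N) N w ->
  normc (green_deriv N w) <= normc (kern w) + 2 * normc (kern_quot w).
Proof.
move=> N1 Rw; have [h1 _ h3 _] := cutoff_bounds N1 Rw.
apply: le_trans (normcD _ _) _.
rewrite (Normc.normcM (kern w)) (Normc.normcM (kern_quot w)); apply: lerD.
  exact: ler_piMr (normc_ge0 _) h1.
by rewrite mulrC; exact: ler_wpM2r (normc_ge0 _) _ _ h3.
Qed.

Lemma green_deriv_near w : Cplus w -> exists2 C : R, 0 <= C & forall N, 1 <= N ->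
  rect N^-1 N (- N) N w -> normc (green_deriv N w - kern w) <= C / N.
Proof.
case: w => x y; rewrite /Cplus /= => x0; set w := x +i* y.
exists (normc (kern w) * (y ^+ 2 + x + x^-1) + normc (kern_quot w) * (x * `|y| + x + x^-1)).
  by rewrite addr_ge0 ?mulr_ge0 ?normc_ge0 ?addr_ge0 ?sqr_ge0 ?mulr_ge0 ?invr_ge0 ?normr_ge0 ?(ltW x0).
move=> N N1 Rw; have [_ h2 _ h4] := cutoff_bounds N1 Rw.
rewrite (_ : _ - _ = kern w * (cutoff N w - 1) + kern_quot w * cutoff_deriv N w); last first.
  by rewrite /green_deriv; ring.
apply: le_trans (normcD _ _) _.
rewrite (Normc.normcM (kern w)) (Normc.normcM (kern_quot w)) mulrDl -!mulrA.
by apply: lerD; apply: ler_wpM2l => //; exact: normc_ge0.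
Qed.

End Vanishing.
End GreenFunction.

Section ReproducingProperty.
Context {R : realType}.
Local Notation mu2 := (@lebesgue_measure R \x @lebesgue_measure R)%E.
Variable l : nat.
Implicit Types (h : R[i] -> R[i]) (w v z : R[i]).

Section Vanishing.
Variables (z : R[i]) (h : R[i] -> R[i]) (A0 : R[i]).
Hypotheses (Cz : Cplus z) (bh : bergman l h) (hz : h z = 0)
  (dh : is_wirtinger h z A0 0).

Local Notation kern := (kern l z h).
Local Notation green_deriv := (green_deriv l z h A0).

(** [green_deriv N] integrates to 0 over its rectangle; extended by 0 to the half-plane it converges
    pointwise to [kern] under the dominating function of [kern_dominated]. *)
Lemma kern_integral0 : Cplus_Rintegral (fun w => complex.Re (kern w)) = 0.
Proof.
have x00 : 0 < complex.Re z := Cz.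
(* Starting the sequence at S puts z in the interior of all the rectangles and ensures N >= 1. *)
pose S := complex.Re z + (complex.Re z)^-1 + `|complex.Im z| + 1.
have S1 : [/\ complex.Re z < S, (complex.Re z)^-1 < S, `|complex.Im z| < S & 1 <= S].
  have : 0 < (complex.Re z)^-1 by rewrite invr_gt0.
  by have := normr_ge0 (complex.Im z); rewrite /S; split; lra.
pose N (n : nat) : R := S + n%:R.
have SN n : S <= N n by rewrite lerDl.
have N0 n : 0 < N n by apply: lt_le_trans (SN n); case: S1; lra.
have N1 n : 1 <= N n by apply: le_trans (SN n); case: S1.
pose rN n := rect_pairs (N n)^-1 (N n) (- N n) (N n).
pose G n (p : R * R) : R := complex.Re (green_deriv (N n) (pt p)).
pose g n := G n \_ (rN n).
have rNC n : rN n `<=` Cplus_pairs.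
  by move=> p /rect_pairsP; exact: rect_sub_Cplus.
have g0 n : (\int[mu2]_(p in Cplus_pairs) (g n p)%:E = 0)%E.
  have i0 : \int[mu2]_(p in rN n) G n p = 0.
    have [s1 s2 s3 s4] := S1; have SNn := SN n.
    apply: green_deriv_integral0 => //; [|by lra|by lra].
    by rewrite -[X in _ < X]invrK ltf_pV2 ?posrE ?invr_gt0//; lra.
  have iG : mu2.-integrable (rN n) (EFin \o G n).
    have NN : (N n)^-1 <= N n by rewrite (le_trans _ (N1 n))// invf_le1.
    apply: (@rect_integrable _ _ (@Copen_Cplus R) (fun w => complex.Re (green_deriv (N n) w)) _ _ _ _ NN) => //.
    - by have := N0 n; lra.
    - exact: rect_sub_Cplus.
    - move=> w Cw; apply: Rcontinuous_at_Re; exact: green_deriv_continuous.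
  have : (\int[mu2]_(p in Cplus_pairs `&` rN n) (G n p)%:E = 0)%E.
    rewrite (_ : _ `&` _ = rN n); last by apply/setIidr; exact: rNC.
    rewrite -[LHS]fineK; first by rewrite -/(Rintegral mu2 (rN n) (G n)) i0.
    by apply: integrable_fin_num iG; exact: measurable_rect_pairs.
  by rewrite integral_mkcondr => <-; apply: eq_integral => p _; rewrite /g restrict_EFin.
have [D [iD HD]] := kern_dominated Cz bh hz dh.
have mg n : measurable_fun (Cplus_pairs : set (measurableTypeR R * measurableTypeR R)) (EFin \o g n).
  apply/measurable_EFinP; apply: measurable_funTS.
  apply: (measurable_restrictT _ _).1; first exact: measurable_rect_pairs.
  apply: (@Rcontinuous_at_measurable _ _ (@Copen_Cplus R) (fun w => complex.Re (green_deriv (N n) w))); first exact: rect_sub_Cplus.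
  by move=> w Cw; apply: Rcontinuous_at_Re; exact: green_deriv_continuous.
have mk : measurable_fun (Cplus_pairs : set (measurableTypeR R * measurableTypeR R))
    (fun p => (complex.Re (kern (pt p)))%:E).
  apply/measurable_EFinP.
  apply: (@Cplus_measurable_continuous _ (fun w => complex.Re (kern w))) => w Cw.
  by apply: Rcontinuous_at_Re; exact: kern_continuous.
have cv p : Cplus_pairs p -> (fun n => (g n p)%:E) @ \oo --> (complex.Re (kern (pt p)))%:E.
  move=> Cp; apply: cvg_EFin; first exact: nearW.
  have [C C0 HC] := green_deriv_near l z h A0 Cp.
  apply/cvgrPdist_lt => e e0.
  have [x [y pE]] : exists x y : R, p = (x, y) by case: p {Cp HC} => x y; exists x, y.
  rewrite {}pE in Cp HC *; have x0 : 0 < x := Cp.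
  near=> n.
  have nbig : C / e + x + x^-1 + `|y| < n%:R by near: n; exact: nbhs_infty_gtr.
  have [s1 s2 s3 s4] := S1.
  have Ce : 0 <= C / e by rewrite divr_ge0// ltW.
  have xi : 0 < x^-1 by rewrite invr_gt0.
  have y0 := normr_ge0 y.
  have NE : N n = S + n%:R by [].
  have yN : `|y| < N n by rewrite NE; lra.
  move: (yN); rewrite ltr_norml => /andP[yN1 yN2].
  have xN : (N n)^-1 < x.
    by rewrite -[X in _ < X]invrK ltf_pV2 ?posrE// NE; lra.
  have xN2 : x <= N n by rewrite NE; lra.
  have inr : (x, y) \in rN n.
    by rewrite inE; split; rewrite /= in_itv /=; apply/andP; split => //; exact: ltW.
  have Rp : rect (N n)^-1 (N n) (- N n) (N n) (x +i* y) 
    by apply: (@rect_pairsP _ _ _ _ _ (x, y)); move: inr; rewrite inE.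
  rewrite /comp /g /patch inr /G distrC -ReCN -ReCD.
  apply: le_lt_trans (normr_Re_le _) _; apply: le_lt_trans (HC _ (N1 n) Rp) _.
  by rewrite ltr_pdivrMr// mulrC -ltr_pdivrMr// NE; lra.
have gD p : forall n, Cplus_pairs p -> (`|(g n p)%:E| <= (D (pt p))%:E)%E.
  move=> n Cp; rewrite /= lee_fin /g /patch; case: ifPn => [|_]; last first.
    rewrite normr0; apply: le_trans (HD _ Cp).
    by rewrite addr_ge0 ?mulr_ge0 ?normc_ge0.
  rewrite inE => /rect_pairsP Rp; apply: le_trans (normr_Re_le _) _.
  exact: le_trans (green_deriv_le _ _ _ _ (N1 n) Rp) (HD _ Cp).
have [_ _ cvI] := dominated_convergence (mu := mu2) (f_ := fun n p => (g n p)%:E)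
  measurable_Cplus_pairs mg mk (aeW mu2 cv) iD
  (aeW mu2 gD).
suff K : (\int[mu2]_(p in Cplus_pairs) (complex.Re (kern (pt p)))%:E = 0)%E.
  by rewrite /Cplus_Rintegral /Rintegral K.
apply: (@cvg_unique _ _ _ _ _ _ cvI).
  exact: ereal_hausdorff.
rewrite (_ : [sequence _]_n = fun=> 0%E); first exact: cvg_cst.
by apply/funext => n; exact: g0.
Unshelve. all: by end_near.
Qed.

End Vanishing.
Lemma Re_rcM (t : R) w : complex.Re (t%:C * w) = t * complex.Re w.
Proof. by case: w => x y /=; rewrite mul0r subr0. Qed.

Lemma conj_power_kernel z w :
  conjc (power_kernel l z w) = power_kernel l (conjc z) (conjc w).
Proof. by rewrite /power_kernel conjc_inv conjcX conjcD. Qed.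

Lemma kernE z h w : Cplus z -> Cplus w -> kern l z h w =
  (l.+1%:R * 2 ^+ l * complex.Re w ^+ l)%:C *
  (h w * conjc (power_kernel l (conjc z) w)).
Proof.
move=> Cz Cw; rewrite conj_power_kernel conjcK /power_kernel /kern.
have q0 : conj_shift z w != 0.
  by apply: Cplus_neq0; apply: CplusD => //; exact: Cplus_conj.
rewrite /conj_shift in q0 *; rewrite !rcE /ReC !exprMn exprVn !exprS.
by field; rewrite q0 expf_neq0.
Qed.

Lemma ip_power_kernel_eq0 z h : Cplus z -> bergman l h -> h z = 0 ->
  ip l h (power_kernel l (conjc z)) = 0.
Proof.
move=> Cz bh hz.
have bE : bergman l (power_kernel l (conjc z)).
  by apply: bergman_power_kernel; exact: Cplus_conj.
have Re0 u : bergman l u -> u z = 0 -> complex.Re (ip l u (power_kernel l (conjc z))) = 0.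
  move=> bu uz; have [A0 du] : Cdifferentiable u z.
    by move/analyticP: (bergman_analytic bu); apply.
  have [i1 _] := ip_integrable bu bE.
  have := kern_integral0 Cz bu uz du.
  rewrite (@eq_Cplus_Rintegral _ _ (fun w => l.+1%:R * 2 ^+ l * (complex.Re w ^+ l *
      complex.Re (u w * conjc (power_kernel l (conjc z) w))))); last first.
    by move=> w Cw; rewrite kernE// Re_rcM mulrA.
  rewrite Cplus_RintegralZ// => /eqP; rewrite mulf_eq0 => /orP[|/eqP//].
  by rewrite mulf_eq0 pnatr_eq0 /= expf_eq0 pnatr_eq0 andbF.
apply: complex_ext; first exact: Re0.
(* The imaginary part for h is the real part for -i h, which also vanishes at z. *)
have := Re0 _ (bergmanZ (- 'i%C) bh); rewrite hz mulr0 => /(_ erefl).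
by rewrite ipZl// !ReImE /= !(oppr0, mul0r, sub0r, mulN1r, opprK, mulNr, mul1r).
Qed.

Lemma normsq_power_kernel_gt0 z : Cplus z -> 0 < normsq l (power_kernel l z).
Proof.
move=> Cz; have bE := bergman_power_kernel l Cz; have iE := bergman_integrable bE.
(* On the rectangle 1 < Re w <= 2, 0 < Im w <= 1, of area 1, the weight is at least 1 and |w + z| <=
   3 + |z|, so e bounds the integrand from below. *)
pose B := 3 + normc z; have B0 : 0 < B by rewrite ltr_wpDr ?normc_ge0.
pose e := (B ^- l.+2) ^+ 2; have e0 : 0 < e by rewrite exprn_gt0// invr_gt0 exprn_gt0.
have sub : rect_pairs 1 2 0 1 `<=` @Cplus_pairs R.
  by move=> p /rect_pairsP[h _ _ _]; rewrite /Cplus_pairs /= /Cplus /=; apply: lt_le_trans h.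
have Ee p : rect_pairs 1 2 0 1 p -> e <= sq_weight l (power_kernel l z) (pt p).
  case: p => x y /rect_pairsP[h1 h2 h3 h4]; rewrite /= in h1 h2 h3 h4.
  rewrite /sq_weight [complex.Re _]/= -[leLHS]mul1r.
  apply: ler_pM => //; [exact: ltW|exact: exprn_ege1|].
  rewrite /power_kernel Normc.normcV normcX lerXn2r ?nnegrE ?invr_ge0 ?exprn_ge0 ?normc_ge0 ?(ltW B0)//.
  have nz : 0 < normc (x +i* y + z).
    rewrite normc_gt0 Cplus_neq0//; apply: CplusD => //; rewrite /Cplus /=; lra.
  rewrite lef_pV2 ?posrE ?exprn_gt0// lerXn2r ?nnegrE ?normc_ge0 ?(ltW B0)//.
  apply: le_trans (normcD _ _) _; rewrite lerD2r.
  apply: le_trans (normc_le_ReIm _) _; rewrite /= !ger0_norm; lra.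
have H : (e%:E <= \int[mu2]_(p in Cplus_pairs) (sq_weight l (power_kernel l z) (pt p))%:E)%E.
  apply: (@le_trans _ _ (\int[mu2]_(p in rect_pairs 1 2 0 1) (sq_weight l (power_kernel l z) (pt p))%:E)%E).
    apply: (@le_trans _ _ (\int[mu2]_(p in rect_pairs 1 2 0 1) e%:E)%E).
      rewrite integral_cst; last exact: measurable_rect_pairs.
      have := @mu2_rect_pairs R 1 2 0 1 (ltac:(lra)) (ltac:(lra)).
      rewrite subr0 mulr1 (_ : 2 - 1 = 1 :> R); last by ring.
      by move=> /= ->; rewrite mule1.
    apply: ge0_le_integral => //.
    - exact: measurable_rect_pairs.
    - by move=> p _; rewrite lee_fin ltW.
    - apply/measurable_EFinP; apply: measurable_funS (Cplus_integrable_measurable iE) => //.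
      exact: measurable_Cplus_pairs.
  apply: ge0_subset_integral => //.
  - exact: measurable_rect_pairs.
  - exact: measurable_Cplus_pairs.
  - by apply/measurable_EFinP; exact: Cplus_integrable_measurable.
  - by move=> p Cp; rewrite lee_fin; exact: sq_weight_ge0.
apply: lt_le_trans e0 _; rewrite -lee_fin /normsq /Cplus_Rintegral /Rintegral fineK//.
by apply: integrable_fin_num; [exact: measurable_Cplus_pairs|exact: iE].
Qed.

(* The constant does not depend on [z] because the inner product of two kernels
   can be evaluated at either of their points. *)
Theorem reproducing : exists2 c : R, 0 < c & forall z h, Cplus z -> bergman l h ->
  ip l h (power_kernel l (conjc z)) = c%:C * h z.
Proof.
pose E z := power_kernel l (conjc z).
have bE z : Cplus z -> bergman l (E z).
  by move=> Cz; apply: bergman_power_kernel; exact: Cplus_conj.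
have E0 z w : Cplus z -> Cplus w -> E z w != 0.
  move=> Cz Cw; rewrite invr_eq0 expf_neq0// Cplus_neq0//; apply: CplusD => //.
  exact: Cplus_conj.
pose c z := normsq l (E z) / complex.Re (E z z).
have EzC z : Cplus z -> exists2 t : R, 0 < t & E z z = t%:C.
  move=> Cz; exists ((2 * complex.Re z) ^- l.+2).
    by rewrite invr_gt0 exprn_gt0// mulr_gt0//; exact: Cz.
  by rewrite /E /power_kernel addcJ !rcE.
have rep z h : Cplus z -> bergman l h -> ip l h (E z) = (c z)%:C * h z.
  move=> Cz bh; have [t t0 tE] := EzC _ Cz.
  have tC : t%:C != 0 by rewrite rc_neq0// gt_eqF.
  (* Subtracting s E_(conj z) from h gives a function vanishing at z, hence orthogonal to the
     kernel; this determines the inner product, with the constant [c z]. *)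
  pose s := h z / E z z.
  have b1 := bergmanZ (- s) (bE _ Cz).
  have s0 : h z + (- s) * E z z = 0.
    by rewrite /s mulNr divfK ?subrr// tE.
  have := ip_power_kernel_eq0 Cz (bergmanD bh b1) s0.
  rewrite -/(E z) (ipDl bh b1 (bE _ Cz)) (ipZl _ (bE _ Cz) (bE _ Cz)).
  rewrite ip_normsq mulNr => /eqP; rewrite subr_eq0 => /eqP ->.
  by rewrite /c /s tE /= rcM rcV; field.
have c0 z : Cplus z -> 0 < c z.
  move=> Cz; have [t t0 tE] := EzC _ Cz; rewrite /c tE /= divr_gt0//.
  by apply: normsq_power_kernel_gt0; exact: Cplus_conj.
have cc z w : Cplus z -> Cplus w -> c z = c w.
  move=> Cz Cw; have := ip_conj (bE _ Cz) (bE _ Cw).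
  rewrite (rep z _ Cz (bE _ Cw)) (rep w _ Cw (bE _ Cz)) conjcM conjc_real /E conj_power_kernel conjcK -/(E _).
  have -> : power_kernel l z (conjc w) = E w z by rewrite /E /power_kernel addrC.
  by move=> /(mulIf (E0 _ _ Cw Cz)) [].
have C1 : Cplus (1 : R[i]) by rewrite /Cplus /= ltr01.
by exists (c 1); [exact: c0|move=> z h Cz bh; rewrite -(cc z)// rep].
Qed.

End ReproducingProperty.

(** * Density of the kernel combinations *)

Section Density.
Context {R : realType}.
Variable l : nat.
Implicit Types (h k : R[i] -> R[i]) (w v z : R[i]) (S T : seq (R[i] * R[i])).

(** A pair holds a coefficient and a point. Points may repeat, so that sums and multiples of
    combinations are plain list operations. *)
Definition kernel_span S w : R[i] := \sum_(p <- S) p.1 * power_kernel l p.2 w.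

Definition in_Cplus S := forall p, p \in S -> Cplus p.2.

Lemma in_Cplus_cons p S : in_Cplus (p :: S) <-> Cplus p.2 /\ in_Cplus S.
Proof.
split=> [H|[H1 H2] q]; last by rewrite inE => /orP[/eqP->|/H2].
by split=> [|q qS]; apply: H; rewrite inE ?eqxx// qS orbT.
Qed.

Lemma in_Cplus_cat S T : in_Cplus S -> in_Cplus T -> in_Cplus (S ++ T).
Proof. by move=> CS CT p; rewrite mem_cat => /orP[/CS|/CT]. Qed.

Definition scale_pairs (c : R[i]) S := [seq (c * p.1, p.2) | p <- S].

Lemma in_Cplus_scale c S : in_Cplus S -> in_Cplus (scale_pairs c S).
Proof. by move=> CS _ /mapP[p /CS Cp ->]. Qed.

Lemma kernel_span_cat S T w :
  kernel_span (S ++ T) w = kernel_span S w + kernel_span T w.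
Proof. by rewrite /kernel_span big_cat. Qed.

Lemma kernel_span_scale c S w : kernel_span (scale_pairs c S) w = c * kernel_span S w.
Proof.
rewrite /kernel_span big_map mulr_sumr; apply: eq_bigr => p _ /=.
by rewrite mulrA.
Qed.

Lemma kernel_span_cons p S w :
  kernel_span (p :: S) w = p.1 * power_kernel l p.2 w + kernel_span S w.
Proof. by rewrite /kernel_span big_cons. Qed.

Lemma bergman_kernel_span S : in_Cplus S -> bergman l (kernel_span S).
Proof.
elim: S => [|p S IH].
  by move=> _; apply: eq_Cplus_bergman (bergman0 l) => w _; rewrite /kernel_span big_nil.
move=> /in_Cplus_cons[Cp /IH bS].
apply: eq_Cplus_bergman (bergmanD (bergmanZ p.1 (bergman_power_kernel l Cp)) bS) => w _.
by rewrite kernel_span_cons.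
Qed.

Lemma ip_kernel_spanl S k : in_Cplus S -> bergman l k ->
  ip l (kernel_span S) k = \sum_(p <- S) p.1 * ip l (power_kernel l p.2) k.
Proof.
move=> + bk; elim: S => [|p S IH].
  move=> _; rewrite big_nil (@eq_ip _ l _ (fun w => 0 * k w) k k)//.
    by rewrite ipZl// mul0r.
  by move=> w _; rewrite /kernel_span big_nil mul0r.
move=> /in_Cplus_cons[Cp CS]; rewrite big_cons -(IH CS).
have bp := bergman_power_kernel l Cp; have bS := bergman_kernel_span CS.
rewrite -(ipZl _ bp bk) -(ipDl (bergmanZ p.1 bp) bS bk).
by apply: eq_ip => // w _; rewrite kernel_span_cons.
Qed.

(* The differences between [h] and a minimizing sequence of kernel combinations
   tend to 0 pointwise by the reproducing property, and they form a Cauchy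
   sequence by the parallelogram law, so that Fatou's lemma bounds their norms. *)
Theorem kernel_span_dense h (e : R) : bergman l h -> 0 < e ->
  exists2 S, in_Cplus S & normsq l (fun w => h w - kernel_span S w) < e.
Proof.
move=> bh e0; have [c c0 rep] := @reproducing R l.
pose Dist := [set normsq l (fun w => h w - kernel_span S w) | S in in_Cplus].
have lbD : has_inf Dist.
  split; first by exists (normsq l (fun w => h w - kernel_span [::] w)); exists [::].
  by exists 0 => _ [S _ <-]; exact: normsq_ge0.
pose d := inf Dist.
have dS S : in_Cplus S -> d <= normsq l (fun w => h w - kernel_span S w).
  by move=> CS; apply: ge_inf; [exact: lbD.2|exists S].
have bhS S : in_Cplus S -> bergman l (fun w => h w - kernel_span S w).
  by move=> CS; exact: (bergmanB bh (bergman_kernel_span CS)).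
have exF (n : nat) : exists S, in_Cplus S /\
    normsq l (fun w => h w - kernel_span S w) < d + n.+1%:R^-1.
  have n0 : 0 < n.+1%:R^-1 :> R by rewrite invr_gt0.
  by have [_ [S CS <-] HS] := inf_adherent n0 lbD; exists S.
have [F HF] := choice exF.
have CF n : in_Cplus (F n) by case: (HF n).
pose phi n w := h w - kernel_span (F n) w.
have bphi n : bergman l (phi n) by exact: bhS.
have ptw n z : Cplus z -> normc (phi n z) ^+ 2 <=
    normsq l (power_kernel l (conjc z)) / c ^+ 2 / n.+1%:R.
  move=> Cz; have Cz' := Cplus_conj Cz.
  have bE := bergman_power_kernel l Cz'.
  set K := power_kernel l (conjc z) in bE *; set t := ip l (phi n) K.
  have K0 : 0 < normsq l K by exact: normsq_power_kernel_gt0.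
  (* The best correction of [phi n] in the direction K: it lowers the squared norm by |t|^2 /
     [normsq l K], which cannot exceed the excess 1 / (n + 1) over the infimum d. *)
  pose lam := - (t / (normsq l K)%:C).
  have CS : in_Cplus ((- lam, conjc z) :: F n) by apply/in_Cplus_cons.
  have := dS _ CS; rewrite (@eq_normsq _ l _ (fun w => phi n w + lam * K w)); last first.
    move=> w _; rewrite kernel_span_cons.
    by rewrite -[(_, _).1]/(- lam) -[(_, _).2]/(conjc z) -/K /phi; ring.
  rewrite (normsqD (bphi n) (bergmanZ lam bE)) (normsqZ lam bE) (ipZr lam (bphi n) bE) -/t.
  have -> : conjc lam * t = (- (normc t ^+ 2 / normsq l K))%:C.
    have conjcN (x : R[i]) : conjc (- x) = - conjc x by exact: rmorphN.
    rewrite /lam -rcV conjcN conjcM conjc_real rcN rcM -mulcJ.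
    by move: (conjc t) => t'; ring.
  rewrite /lam normcN Normc.normcM Normc.normcV normcC (gtr0_norm K0) /=.
  have HFn : normsq l (phi n) < d + n.+1%:R^-1 := (HF n).2.
  have -> : normsq l (phi n) + 2 * - (normc t ^+ 2 / normsq l K) +
     (normc t / normsq l K) ^+ 2 * normsq l K = normsq l (phi n) - normc t ^+ 2 / normsq l K.
    by field; rewrite gt_eqF.
  move=> H; have {H} : normc t ^+ 2 / normsq l K <= n.+1%:R^-1.
    by move: H HFn; set X := normsq l (phi n); set i1 := n.+1%:R^-1; lra.
  rewrite ler_pdivrMr// /t (rep z _ Cz (bphi n)) Normc.normcM normcC (gtr0_norm c0) exprMn => H.
  rewrite mulrAC ler_pdivlMr ?exprn_gt0// mulrC (mulrC (normsq l K)).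
  exact: H.
have half S : in_Cplus S -> in_Cplus (scale_pairs 2^-1 S) by exact: in_Cplus_scale.
(* The mean of the two combinations is again admissible, so the mean of the two differences has
   squared norm at least d. The parallelogram law then leaves at most 2 / (n + 1) + 2 / (n + m +
   1). *)
have cauchy n m : normsq l (fun w => phi n w - phi (n + m)%N w) <= 4 / n.+1%:R.
  have b1 := bphi n; have b2 := bphi (n + m)%N.
  have par := parallelogram b1 b2.
  have bs := bergmanD b1 b2.
  have CS := in_Cplus_cat (half _ (CF n)) (half _ (CF (n + m)%N)).
  have := dS _ CS.
  rewrite (@eq_normsq _ l _ (fun w => 2^-1 * (phi n w + phi (n + m)%N w))); last first.
    by move=> w _; rewrite kernel_span_cat !kernel_span_scale /phi; field.
  rewrite (normsqZ 2^-1 bs) Normc.normcV -rc_nat normcC (ger0_norm (ler0n _ 2)) => H.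
  have H1 : normsq l (phi n) < d + n.+1%:R^-1 := (HF n).2.
  have H2 : normsq l (phi (n + m)%N) < d + (n + m).+1%:R^-1 := (HF (n + m)%N).2.
  have H3 : (n + m).+1%:R^-1 <= n.+1%:R^-1 :> R.
    by rewrite lef_pV2 ?posrE// ler_nat ltnS leq_addr.
  move: H H1 H2 par.
  set X := normsq l (phi n); set Y := normsq l (phi (n + m)%N).
  set Z := normsq l (fun w => _ + _); set V := normsq l (fun w => _ - _).
  have -> : (2^-1 : R) ^+ 2 = 4^-1 by field.
  set i1 := n.+1%:R^-1 in H3 *; set i2 := (n + m).+1%:R^-1 in H3 *.
  lra.
have lim0 z : Cplus z -> (fun n => normc (phi n z)) @ \oo --> (0 : R).
  move=> Cz; apply/cvgrPdist_lt => r r0.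
  set B := normsq l (power_kernel l (conjc z)) / c ^+ 2.
  near=> n.
  have nB : B / r ^+ 2 < n%:R by near: n; exact: nbhs_infty_gtr.
  rewrite sub0r normrN ger0_norm ?normc_ge0//.
  rewrite -ltr_sqr ?nnegrE ?normc_ge0 ?(ltW r0)//.
  apply: le_lt_trans (ptw n z Cz) _; rewrite -/B.
  rewrite ltr_pdivrMr// mulrC -ltr_pdivrMr ?exprn_gt0//.
  by apply: lt_trans nB _; rewrite ltr_nat.
(* For fixed n, [phi n] is the pointwise limit in m of the differences [phi n - phi (n + m)], whose
   norms [cauchy] bounds. *)
have phib n : normsq l (phi n) <= 4 / n.+1%:R.
  apply: (proj2 (@fatou_bergman _ l (fun m w => phi n w - phi (n + m)%N w) _ _ _ _ _ _)).
  - by move=> m; exact: (bergmanB (bphi n) (bphi (n + m)%N)).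
  - exact: bergman_analytic (bphi n).
  - move=> z /lim0 Cz; apply: cvg_trans (cvg_comp _ _ (cvg_addnl n) Cz).
    apply: near_eq_cvg; apply: nearW => m /=.
    by rewrite addrAC subrr sub0r normcN.
  - exact: cauchy.
pose n := Num.truncn (4 / e).
exists (F n); first exact: CF.
apply: le_lt_trans (phib n) _.
by rewrite ltr_pdivrMr// mulrC -ltr_pdivrMr// truncnS_gt.
Unshelve. all: by end_near.
Qed.

End Density.

(** * Positive kernels *)

Section PositiveKernels.
Context {R : realType}.
Implicit Types (M : R[i] -> R[i] -> R[i]) (w v z : R[i]) (S T : seq (R[i] * R[i])).

Definition gram M S : R[i] :=
  \sum_(p <- S) \sum_(q <- S) p.1 * conjc q.1 * M p.2 q.2.

(** Stated through the real part, which is all that the comparison of norms uses; hermitian symmetry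
    need not be carried along. *)
Definition positive_kernel M := forall S, in_Cplus S -> 0 <= complex.Re (gram M S).

Lemma eq_gram M M' S : in_Cplus S ->
  (forall w v, Cplus w -> Cplus v -> M w v = M' w v) -> gram M S = gram M' S.
Proof.
move=> CS MM'; apply: eq_big_seq => p /CS Cp; apply: eq_big_seq => q /CS Cq.
by rewrite MM'.
Qed.

Lemma eq_positive_kernel M M' :
  (forall w v, Cplus w -> Cplus v -> M w v = M' w v) ->
  positive_kernel M -> positive_kernel M'.
Proof. by move=> MM' pM S CS; rewrite -(eq_gram CS MM') pM. Qed.

Lemma gramD M M' S : gram (fun w v => M w v + M' w v) S = gram M S + gram M' S.
Proof.
rewrite /gram -big_split; apply: eq_bigr => p _ /=.
by rewrite -big_split; apply: eq_bigr => q _ /=; rewrite mulrDr.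
Qed.

Lemma gramZ c M S : gram (fun w v => c * M w v) S = c * gram M S.
Proof.
rewrite /gram mulr_sumr; apply: eq_bigr => p _; rewrite mulr_sumr.
by apply: eq_bigr => q _; rewrite mulrCA.
Qed.

Lemma positive_kernelD M M' : positive_kernel M -> positive_kernel M' ->
  positive_kernel (fun w v => M w v + M' w v).
Proof. by move=> pM pM' S CS; rewrite gramD ReCD addr_ge0 ?pM ?pM'. Qed.

Lemma positive_kernelZ (c : R) M : 0 <= c -> positive_kernel M ->
  positive_kernel (fun w v => c%:C * M w v).
Proof. by move=> c0 pM S CS; rewrite gramZ Re_rcM mulr_ge0 ?pM. Qed.

(** The values of a are absorbed into the coefficients of the list. *)
Lemma positive_kernel_rank1 (a : R[i] -> R[i]) M : positive_kernel M ->
  positive_kernel (fun w v => a w * conjc (a v) * M w v).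
Proof.
move=> pM S CS.
have := pM [seq (p.1 * a p.2, p.2) | p <- S].
rewrite (_ : gram M _ = gram (fun w v => a w * conjc (a v) * M w v) S).
  by apply=> _ /mapP[p /CS Cp ->].
rewrite /gram big_map; apply: eq_bigr => p _; rewrite big_map.
by apply: eq_bigr => q _ /=; rewrite conjcM; ring.
Qed.

Lemma positive_kernel1 : positive_kernel (fun _ _ => 1).
Proof.
move=> S _; rewrite /gram.
rewrite (_ : \sum_(p <- S) _ = (\sum_(p <- S) p.1) * conjc (\sum_(p <- S) p.1)).
  by rewrite mulcJ /= sqr_ge0.
rewrite rmorph_sum mulr_suml; apply: eq_bigr => p _.
by rewrite mulr_sumr; apply: eq_bigr => q _; rewrite mulr1.
Qed.

Lemma positive_kernel0 : positive_kernel (fun _ _ => 0).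
Proof.
apply: eq_positive_kernel (positive_kernelZ (lexx 0) positive_kernel1) => w v _ _.
by rewrite mulr1.
Qed.

Lemma cvg_normc_sum S (F : R[i] * R[i] -> nat -> R[i]) :
  (forall p, p \in S -> (fun n => normc (F p n)) @ \oo --> (0 : R)) ->
  (fun n => normc (\sum_(p <- S) F p n)) @ \oo --> (0 : R).
Proof.
elim: S => [|p S IH] HS.
  by under eq_fun do rewrite big_nil Normc.normc0; exact: cvg_cst.
have h1 := HS p (mem_head _ _).
have h2 : (fun n => normc (\sum_(p <- S) F p n)) @ \oo --> (0 : R).
  by apply: IH => q qS; apply: HS; rewrite inE qS orbT.
have h12 := cvgD h1 h2; rewrite addr0 in h12.
apply: (@squeeze_cvgr _ _ _ _ (fun=> 0) (fun n => normc (F p n) + normc (\sum_(q <- S) F q n))).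
- by apply: nearW => n /=; rewrite normc_ge0 big_cons normcD.
- exact: cvg_cst.
- exact: h12.
Qed.

Lemma normc_cayley_lt1 w : Cplus w -> normc ((w - 1) / (w + 1)) < 1.
Proof.
move=> Cw; have x0 : 0 < complex.Re w := Cw.
have w1 : w + 1 != 0.
  by apply: Cplus_neq0; apply: CplusD => //; rewrite /Cplus /= ltr01.
rewrite Normc.normcM Normc.normcV ltr_pdivrMr ?normc_gt0// mul1r.
rewrite -ltr_sqr ?nnegrE ?normc_ge0// !normc_sqr !ReImE /= oppr0 !addr0.
by rewrite ltrD2r; nra.
Qed.

(* The Cayley transform turns the Cauchy kernel into a geometric series of
   rank-one kernels: with zeta = (g - 1) / (g + 1),
   1 / (g w + conj (g v)) =
     2 / ((g w + 1) conj (g v + 1)) * \sum_k (zeta w * conj (zeta v)) ^ k. *)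
Lemma positive_kernel_cauchy (g : R[i] -> R[i]) M :
  (forall w, Cplus w -> Cplus (g w)) -> positive_kernel M ->
  positive_kernel (fun w v => M w v / (g w + conjc (g v))).
Proof.
move=> Cg pM S CS.
have g1 w : Cplus w -> g w + 1 != 0.
  move=> /Cg Cw; apply: Cplus_neq0; apply: CplusD => //.
  by rewrite /Cplus /= ltr01.
have gg w v : Cplus w -> Cplus v -> g w + conjc (g v) != 0.
  move=> /Cg Cw /Cg Cv; apply: Cplus_neq0; apply: CplusD => //.
  exact: Cplus_conj.
pose ze w := (g w - 1) / (g w + 1); pose a w := (g w + 1)^-1.
have ze_lt1 w : Cplus w -> normc (ze w) < 1 by move=> /Cg; exact: normc_cayley_lt1.
have geo w v : Cplus w -> Cplus v ->
    1 - ze w * conjc (ze v) = 2 * (a w * conjc (a v)) * (g w + conjc (g v)).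
  move=> Cw Cv; have n1 := g1 _ Cw.
  have n2 : conjc (g v) + 1 != 0.
    by rewrite -(conjc1 R) -conjcD conjc_eq0; exact: g1.
  rewrite /ze /a !(conjcM, conjc_inv, conjcB, conjcD, conjc1).
  by move: n1 n2; set G := g w; set H := conjc (g v) => n1 n2; field; rewrite n1 n2.
clearbody ze a.
pose Mk k w v := ((a w * ze w ^+ k) * conjc (a v * ze v ^+ k)) * M w v.
pose MK K w v := 2%:C * \sum_(k < K) Mk k w v.
(* The tail of the geometric series in closed form. It tends to 0 at each of the finitely many pairs
   of points in S. *)
pose rest K w v := (ze w * conjc (ze v)) ^+ K * (M w v / (g w + conjc (g v))).
have pMK K : positive_kernel (MK K).
  apply: positive_kernelZ => //; elim: K => [|K IH].
    by apply: eq_positive_kernel positive_kernel0 => w v _ _; rewrite big_ord0.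
  apply: eq_positive_kernel (positive_kernelD IH (positive_kernel_rank1
    (fun w => a w * ze w ^+ K) pM)) => w v _ _.
  by rewrite big_ord_recr.
have split K : gram (fun w v => M w v / (g w + conjc (g v))) S =
    gram (MK K) S + gram (rest K) S.
  rewrite -gramD; apply: eq_gram => // w v Cw Cv.
  rewrite /MK /rest /Mk; have n3 := gg _ _ Cw Cv; have := geo _ _ Cw Cv.
  set Z := ze w * conjc (ze v); set G := g w + conjc (g v) in n3 *.
  set N := M w v => ZE; elim: K => [|K IH].
    by rewrite big_ord0 mulr0 add0r expr0 mul1r.
  rewrite [LHS]IH big_ord_recr /= mulrDr -!addrA; congr (_ + _).
  rewrite (conjcM (a v)) conjcX rc_nat exprS.
  rewrite (_ : a w * _ * _ = a w * conjc (a v) * Z ^+ K); last by rewrite /Z exprMn; ring.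
  move: ZE; set A := a w * conjc (a v) => ZE.
  have {}ZE : Z = 1 - 2 * A * G by rewrite -ZE opprB addrC subrK.
  by rewrite {3}ZE; move: (Z ^+ K) => ZK; field.
have rest0 : (fun K => normc (gram (rest K) S)) @ \oo --> (0 : R).
  apply: cvg_normc_sum => p pS; apply: cvg_normc_sum => q qS.
  have Cp := CS _ pS; have Cq := CS _ qS.
  set r := normc (ze p.2 * conjc (ze q.2)).
  have r1 : `|r| < 1.
    rewrite ger0_norm ?normc_ge0// /r Normc.normcM normc_conj.
    by apply: mulr_ilt1; rewrite ?normc_ge0// ze_lt1.
  set C := normc (p.1 * conjc q.1 * (M p.2 q.2 / (g p.2 + conjc (g q.2)))).
  rewrite (_ : (fun K => _) = (fun K => r ^+ K * C)).
    rewrite -[X in _ --> X](mul0r C); apply: cvgM; last exact: cvg_cst.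
    exact: cvg_expr.
  apply/funext => K; rewrite /r -normcX -Normc.normcM; congr normc.
  by rewrite /rest; ring.
(* A negative value would exceed in modulus the tail of some partial sum, making that partial sum
   negative too. *)
rewrite leNgt; apply/negP => neg.
have e0 : 0 < - complex.Re (gram (fun w v => M w v / (g w + conjc (g v))) S).
  by rewrite oppr_gt0.
have [K _ /(_ K (leqnn K))] := (cvgrPdist_lt _ _).1 rest0 _ e0.
rewrite /= sub0r normrN ger0_norm ?normc_ge0// {1}(split K) ReCD => H.
have := pMK K S CS; have := normr_Re_le (gram (rest K) S).
rewrite ler_norml => /andP[h1 _] h2; lra.
Qed.

(* A^(n+1) - B^(n+1) = A^n (A - B) + B (A^n - B^n), and A - B is the sum of the two
   rank-one kernels times two positive Cauchy kernels. *)
Lemma positive_kernel_power_diff (g F p q : R[i] -> R[i]) (L : R) n : 0 <= L ->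
  (forall w, Cplus w -> Cplus (g w)) ->
  (forall w v, Cplus w -> Cplus v -> L%:C * (g w + conjc (g v)) -
     F w * conjc (F v) * (w + conjc v) = p w * conjc (p v) + q w * conjc (q v)) ->
  positive_kernel (fun w v => (L%:C / (w + conjc v)) ^+ n -
    (F w * conjc (F v) / (g w + conjc (g v))) ^+ n).
Proof.
move=> L0 Cg H.
have Cid w : Cplus w -> Cplus (id w) by [].
have nz w v : Cplus w -> Cplus v -> w + conjc v != 0.
  move=> Cw Cv; apply: Cplus_neq0; apply: CplusD => //; exact: Cplus_conj.
have pA M m : positive_kernel M -> positive_kernel (fun w v => (L%:C / (w + conjc v)) ^+ m * M w v).
  move=> pM; elim: m => [|m IH].
    by apply: eq_positive_kernel pM => w v _ _; rewrite expr0 mul1r.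
  apply: eq_positive_kernel (positive_kernelZ L0 (positive_kernel_cauchy Cid IH)) => w v _ _.
  by rewrite exprS; ring.
elim: n => [|n IH].
  by apply: eq_positive_kernel positive_kernel0 => w v _ _; rewrite !expr0 subrr.
have p1 a : positive_kernel (fun w v => a w * conjc (a v) / (w + conjc v) / (g w + conjc (g v))).
  apply: (positive_kernel_cauchy Cg); apply: (positive_kernel_cauchy Cid).
  apply: eq_positive_kernel (positive_kernel_rank1 a positive_kernel1) => w v _ _.
  by rewrite mulr1.
have := positive_kernelD (pA _ n (positive_kernelD (p1 p) (p1 q)))
  (positive_kernel_cauchy Cg (positive_kernel_rank1 F IH)).
apply: eq_positive_kernel => w v Cw Cv.
have n1 := nz _ _ Cw Cv; have n2 := nz _ _ (Cg _ Cw) (Cg _ Cv).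
have {H}Hwv := H _ _ Cw Cv.
rewrite -mulrDl -mulrDl -Hwv !exprS.
set X := _ ^+ n; set Y := _ ^+ n.
move: n1 n2; set a := w + _; set b := g w + _ => n1 n2.
by field; rewrite n1 n2.
Qed.

End PositiveKernels.

(** * Selfadjointness of weighted composition operators *)

Section Conjugation.
Context {R : realType}.
Local Notation mu := (@lebesgue_measure R).
Variables (l : nat) (a : R).
Implicit Types (h k u v : R[i] -> R[i]) (w z : R[i]).
Local Notation ia := (0 +i* a).
Local Notation C := (Cconj a).

Lemma Cplus_shift w : Cplus (w + ia) <-> Cplus w.
Proof. by rewrite /Cplus /= ReCD /= addr0. Qed.

Lemma Cplus_shiftN w : Cplus (w - ia) <-> Cplus w.
Proof. by rewrite /Cplus /= ReCD ReCN /= oppr0 addr0. Qed.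

Lemma Cplus_conj_shift w : Cplus w -> Cplus (conjc w + ia).
Proof. by move=> Cw; apply/Cplus_shift; exact: Cplus_conj. Qed.

Lemma conjc_ia : conjc ia = - ia :> R[i].
Proof. by apply: complex_ext; rewrite /= ?oppr0. Qed.

Lemma CconjK u : C (C u) = u.
Proof.
apply/funext => w; rewrite /Cconj conjcK; congr u.
by rewrite conjcD conjcK conjc_ia subrK.
Qed.

Lemma analytic_Cconj u : analytic u -> analytic (C u).
Proof.
move=> /analyticP au; apply/analyticP => w Cw.
have [A du] := au _ (Cplus_conj_shift Cw).
exists (conjc A) => e /du[r r0 hr]; exists r => // v vr.
have E : (conjc v + ia) - (conjc w + ia) = conjc (v - w) by rewrite conjcB; ring.
have := hr (conjc v + ia); rewrite E normc_conj => /(_ vr).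
rewrite !mul0r !addr0 => H; rewrite /Cconj.
rewrite (_ : conjc (u (conjc v + ia)) - conjc (u (conjc w + ia)) - conjc A * (v - w) =
    conjc (u (conjc v + ia) - u (conjc w + ia) - A * conjc (v - w))).
  by rewrite normc_conj.
by rewrite !conjcB conjcM !conjcB !conjcK.
Qed.

(** The conjugation acts on points as x + i y -> x + i (a - y), so its isometry rests on this
    reflection of the outer variable. The pushforward of Lebesgue measure is identified through its
    values on half-open intervals. *)
Lemma ge0_integral_reflect (F : R -> \bar R) : measurable_fun setT F ->
  (forall y, 0 <= F y)%E ->
  (\int[mu]_y F (a - y)%R = \int[mu]_y F y)%E.
Proof.
move=> mF F0.
pose r : R -> measurableTypeR R := fun y : R => a - y.
have mr : measurable_fun [set: R] r.
  by apply: measurable_funB => //; exact: measurable_id.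
transitivity (\int[pushforward mu r]_y F y)%E.
  by rewrite ge0_integral_pushforward//.
apply: eq_measure_integral => A mA _ /=.
apply/esym/lebesgue_measure_unique => //= _ [[x y]] _ <-.
rewrite /pushforward /=.
rewrite (_ : r @^-1` _ = `[a - y, a - x[%classic); last first.
  apply/seteqP; split => t; rewrite /= !in_itv /= => /andP[h1 h2]; 
    apply/andP; split; move: h1 h2; rewrite /r ?ltrBrDr ?lerBrDr ?ltrBlDr ?lerBlDr; lra.
rewrite !lebesgue_measure_itv/= !lte_fin.
rewrite (_ : (a - y < a - x) = (x < y)); last by apply/idP/idP; lra.
by case: ifPn => // _; rewrite -!EFinB; congr EFin; ring.
Qed.

Lemma bergman_Cconj u : bergman l u -> bergman l (C u).
Proof.
move=> bu; have au := bergman_analytic bu.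
split; first exact: analytic_Cconj.
have E : Cplus_integral (sq_weight l (C u)) = Cplus_integral (sq_weight l u).
  pose F y := (\int[mu]_(x in `]0%R, +oo[) (sq_weight l u (x +i* y))%:E)%E.
  have F0 y : (0 <= F y)%E.
    apply: integral_ge0 => x; rewrite /= in_itv /= andbT => x0.
    by rewrite lee_fin; exact: sq_weight_ge0.
  have mF : measurable_fun setT F.
    apply: Cplus_slice_measurable; first exact: sq_weight_measurable.
    by move=> w; exact: sq_weight_ge0.
  rewrite /Cplus_integral -(ge0_integral_reflect mF F0); apply: eq_integral => y _.
  apply: eq_integral => x _; rewrite /sq_weight /Cconj normc_conj.
  congr (_ * normc (u _) ^+ 2)%:E.
  by apply: complex_ext; rewrite ?ReCD ?ImCD ?Re_conjc ?Im_conjc /= ?addr0// addrC.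
have [_ fin] := bu; move: fin.
rewrite -[bergman_normsq l u]/((pi^-1)%:E * Cplus_integral (sq_weight l u))%E.
by rewrite -[bergman_normsq l (C u)]/((pi^-1)%:E * Cplus_integral (sq_weight l (C u)))%E E.
Qed.

End Conjugation.

Section KernelSpanNorm.
Context {R : realType}.
Variables (l : nat).
Implicit Types (h k u : R[i] -> R[i]) (w z v : R[i]).

Lemma ip_eq_kernel_span h k : bergman l h -> bergman l k ->
  (forall z, Cplus z -> ip l h (power_kernel l z) = ip l k (power_kernel l z)) ->
  eq_Cplus h k.
Proof.
move=> bh bk H z Cz; have [c c0 rep] := @reproducing R l.
have := H _ (Cplus_conj Cz); rewrite (rep z h Cz bh) (rep z k Cz bk).
by apply: mulfI; rewrite rc_neq0// gt_eqF.
Qed.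

Lemma conjc_kernel_span S w : conjc (kernel_span l S (conjc w)) =
  \sum_(q <- S) conjc q.1 * (w + conjc q.2) ^- l.+2.
Proof.
rewrite /kernel_span rmorph_sum; apply: eq_bigr => q _.
by rewrite /power_kernel rmorphM fmorphV rmorphXn rmorphD /= conjcK.
Qed.

(** Each inner product of two kernels is c times a kernel value by the reproducing property.
    Operator bounds on combinations thus become comparisons of [gram] sums. *)
Lemma normsq_kernel_span : exists2 c : R, 0 < c & forall S, in_Cplus S ->
  normsq l (kernel_span l S) =
  c * complex.Re (gram (fun w v => (w + conjc v) ^- l.+2) S).
Proof.
have [c c0 rep] := @reproducing R l; exists c => // S CS.
have bS := @bergman_kernel_span _ l _ CS.
have := ip_normsq l (kernel_span l S); rewrite (ip_kernel_spanl CS bS).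
rewrite (_ : \sum_(p <- S) _ = c%:C * gram (fun w v => (w + conjc v) ^- l.+2) S); last first.
  rewrite /gram mulr_sumr big_seq_cond [RHS]big_seq_cond; apply: eq_bigr => p.
  rewrite andbT => pS; have Cp := CS _ pS; have bp := bergman_power_kernel l Cp.
  rewrite (ip_conj bS bp) -[in power_kernel _ p.2](conjcK p.2).
  rewrite (rep _ _ (Cplus_conj Cp) bS) conjcM conjc_real mulrCA; congr (_ * _).
  by rewrite conjc_kernel_span mulr_sumr; apply: eq_bigr => q _; rewrite mulrA.
by move=> /(congr1 (@complex.Re R)); rewrite ReCM /= mul0r subr0.
Qed.

End KernelSpanNorm.

(** * From kernel symmetry and a Gram bound to boundedness and selfadjointness *)

Section WeightedComposition.
Context {R : realType}.
Variables (l : nat) (a : R) (f g : R[i] -> R[i]) (L : R).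
Implicit Types (h k u : R[i] -> R[i]) (w z : R[i]) (S : seq (R[i] * R[i])).
Local Notation ia := (0 +i* a).
Local Notation C := (Cconj a).
Local Notation E := (power_kernel l).

Hypothesis f_analytic : analytic f.
Hypothesis g_analytic : analytic g.
Hypothesis g_Cplus : forall z, Cplus z -> Cplus (g z).
Hypothesis kernel_symmetry : forall w z, Cplus w -> Cplus z ->
  f w * E (z - ia) (g w) = f z * E (g z - ia) w.
Hypothesis L_gt0 : 0 < L.
Hypothesis gram_bound : forall S, in_Cplus S ->
  complex.Re (gram (fun p q => f (p + ia) * conjc (f (q + ia)) *
                    (g (p + ia) + conjc (g (q + ia))) ^- l.+2) S) <=
  L * complex.Re (gram (fun p q => (p + conjc q) ^- l.+2) S).

Local Notation W := (fun h w => f w * h (g w)).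

Lemma analytic_weighted h : analytic h -> analytic (W h).
Proof.
move=> /analyticP ah; apply/analyticP => w Cw; apply: CdifferentiableM.
  exact: (analyticP _).1 f_analytic _ Cw.
apply: Cdifferentiable_comp; first exact: (analyticP _).1 g_analytic _ Cw.
exact: ah (g_Cplus Cw).
Qed.

(** By [kernel_symmetry] at the point p + ia, the operator sends E_p to f(p + ia) E_(g(p + ia) -
    ia); this is the image of the combination S. *)
Definition weighted_pairs S :=
  [seq (p.1 * f (p.2 + ia), g (p.2 + ia) - ia) | p <- S].

Lemma in_Cplus_weighted S : in_Cplus S -> in_Cplus (weighted_pairs S).
Proof.
move=> CS _ /mapP[p /CS Cp ->] /=; apply/Cplus_shiftN; apply: g_Cplus.
exact/Cplus_shift.
Qed.

Lemma weighted_kernel_span S w : in_Cplus S -> Cplus w ->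
  W (kernel_span l S) w = kernel_span l (weighted_pairs S) w.
Proof.
move=> CS Cw; rewrite /kernel_span big_map mulr_sumr big_seq [RHS]big_seq.
apply: eq_bigr => p /CS Cp /=; rewrite mulrCA -mulrA; congr (_ * _).
by rewrite -kernel_symmetry ?addrK//; apply/Cplus_shift.
Qed.

Lemma gram_weighted S : gram (fun p q => (p + conjc q) ^- l.+2) (weighted_pairs S) =
  gram (fun p q => f (p + ia) * conjc (f (q + ia)) *
                    (g (p + ia) + conjc (g (q + ia))) ^- l.+2) S.
Proof.
rewrite /gram big_map; apply: eq_bigr => p _; rewrite big_map; apply: eq_bigr => q _ /=.
rewrite conjcB conjc_ia opprK addrACA addNr addr0 conjcM.
move: (conjc q.1) (conjc (f _)) (_ ^- _) => x y z; ring.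
Qed.

Lemma normsq_weighted_span S : in_Cplus S ->
  normsq l (kernel_span l (weighted_pairs S)) <= L * normsq l (kernel_span l S).
Proof.
move=> CS; have [c c0 H] := @normsq_kernel_span R l.
rewrite !H//; last exact: in_Cplus_weighted.
by rewrite gram_weighted mulrCA ler_pM2l//; exact: gram_bound.
Qed.

(** Norm approximation of h by combinations gives pointwise convergence through the reproducing
    property, hence pointwise convergence of the images, and Fatou's lemma applies. The factor 2
    arises because the norm of an approximant is estimated by the parallelogram law; the error e in
    [main] is sent to 0 at the end. *)
Lemma weighted_bound h : bergman l h ->
  bergman l (W h) /\ normsq l (W h) <= 2 * L * normsq l h.
Proof.
move=> bh; have [c c0 rep] := @reproducing R l.
have main (e : R) : 0 < e ->
    bergman l (W h) /\ normsq l (W h) <= L * (2 * normsq l h + 2 * e).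
  move=> e0.
  have exF (n : nat) : exists S, in_Cplus S /\
      normsq l (fun w => h w - kernel_span l S w) < e / n.+1%:R.
    have n0 : 0 < e / n.+1%:R by rewrite divr_gt0.
    by have [S CS HS] := kernel_span_dense bh n0; exists S.
  have [F HF] := choice exF.
  have CF n : in_Cplus (F n) by case: (HF n).
  have bF n := @bergman_kernel_span _ l _ (CF n).
  have bd n := bergmanB bh (bF n).
  have ptw n z : Cplus z -> normc (h z - kernel_span l (F n) z) ^+ 2 <=
      normsq l (E (conjc z)) * e / c ^+ 2 / n.+1%:R.
    move=> Cz; have bE := bergman_power_kernel l (Cplus_conj Cz).
    have := cauchy_schwarz (bd n) bE.
    rewrite (rep z _ Cz (bd n)) Normc.normcM normcC (gtr0_norm c0) exprMn => H.
    rewrite mulrAC ler_pdivlMr ?exprn_gt0// mulrC; apply: le_trans H _.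
    rewrite mulrC -mulrA ler_wpM2l ?normsq_ge0//; exact: ltW (HF n).2.
  apply: (@fatou_bergman _ l (fun n => kernel_span l (weighted_pairs (F n)))).
  - by move=> n; apply: bergman_kernel_span; exact: in_Cplus_weighted.
  - by apply: analytic_weighted; exact: bergman_analytic bh.
  - move=> w Cw; apply/cvgrPdist_lt => r r0.
    set B := normsq l (E (conjc (g w))) * e / c ^+ 2.
    near=> n.
    have nB : normc (f w) ^+ 2 * B / r ^+ 2 < n%:R by near: n; exact: nbhs_infty_gtr.
    rewrite sub0r normrN ger0_norm ?normc_ge0//.
    rewrite -ltr_sqr ?nnegrE ?normc_ge0 ?(ltW r0)//.
    rewrite -(weighted_kernel_span (CF n) Cw) -mulrBr Normc.normcM exprMn normcBC.
    have P := ptw n (g w) (g_Cplus Cw); rewrite -/B in P.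
    apply: le_lt_trans (ler_wpM2l (sqr_ge0 _) P) _.
    rewrite mulrA ltr_pdivrMr// (mulrC (r ^+ 2)) -ltr_pdivrMr ?exprn_gt0//.
    by apply: lt_trans nB _; rewrite ltr_nat.
  - move=> n; apply: le_trans (normsq_weighted_span (CF n)) _.
    rewrite ler_pM2l//.
    have := parallelogram bh (bd n).
    rewrite (@eq_normsq _ l (fun w => h w - (h w - kernel_span l (F n) w))
        (kernel_span l (F n))); last first.
      by move=> w _; rewrite subKr.
    have := normsq_ge0 l (fun w => h w + (h w - kernel_span l (F n) w)).
    have : normsq l (fun w => h w - kernel_span l (F n) w) < e / n.+1%:R := (HF n).2.
    have : e / n.+1%:R <= e by rewrite ler_pdivrMr// ler_peMr ?(ltW e0)// ler1n.
    set X := normsq l _; set Y := normsq l _; set Z := normsq l _; set V := normsq l _.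
    by move: (e / _) => e1; lra.
have [bW _] := main 1 ltr01; split => //.
apply/ler_addgt0Pr => e e0.
have e1 : 0 < e / (2 * L) by rewrite divr_gt0// mulr_gt0.
apply: le_trans (main _ e1).2 _; rewrite le_eqVlt; apply/orP; left; apply/eqP.
by field; rewrite gt_eqF.
Unshelve. all: by end_near.
Qed.

(** Both sides equal c f(p + ia) u(g(p + ia)), with c the reproducing constant. *)
Lemma ip_weighted_kernel p u : Cplus p -> bergman l u ->
  f (p + ia) * ip l (E (g (p + ia) - ia)) (C u) = ip l (E p) (C (W u)).
Proof.
move=> Cp bu; have [c c0 rep] := @reproducing R l.
have Cz : Cplus (p + ia) by apply/Cplus_shift.
have Cgz : Cplus (g (p + ia) - ia) by apply/Cplus_shiftN; exact: g_Cplus.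
have bCu := bergman_Cconj a bu; have bCWu := bergman_Cconj a (weighted_bound bu).1.
rewrite (ip_conj bCu (bergman_power_kernel l Cgz)).
rewrite (ip_conj bCWu (bergman_power_kernel l Cp)).
rewrite -{1}[g (p + ia) - ia]conjcK -[in E p](conjcK p).
rewrite (rep _ _ (Cplus_conj Cgz) bCu) (rep _ _ (Cplus_conj Cp) bCWu).
rewrite /Cconj !conjcM !conjc_real !conjcK.
by rewrite subrK mulrCA.
Qed.

Lemma ip_weighted_span S u : in_Cplus S -> bergman l u ->
  ip l (W (kernel_span l S)) (C u) = ip l (kernel_span l S) (C (W u)).
Proof.
move=> CS bu; have bCu := bergman_Cconj a bu.
have bCWu := bergman_Cconj a (weighted_bound bu).1.
rewrite (@eq_ip _ l _ (kernel_span l (weighted_pairs S)) (C u) (C u))//; last first.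
  by move=> w Cw; exact: weighted_kernel_span.
rewrite (ip_kernel_spanl (in_Cplus_weighted CS) bCu) (ip_kernel_spanl CS bCWu).
rewrite big_map big_seq [RHS]big_seq; apply: eq_bigr => p /CS Cp /=.
by rewrite -mulrA ip_weighted_kernel.
Qed.

Lemma ip_weighted h u : bergman l h -> bergman l u ->
  ip l (W h) (C u) = ip l h (C (W u)).
Proof.
move=> bh bu; have bCu := bergman_Cconj a bu.
have bCWu := bergman_Cconj a (weighted_bound bu).1.
apply/eqP; rewrite -subr_eq0 -normc_eq0 -sqrf_eq0 eq_le sqr_ge0 andbT.
set D := normc _ ^+ 2.
(* With d = h - S and [normsq l d] < e, only the two inner products with d and W d survive; |y -
   z|^2 <= 2 (|y|^2 + |z|^2), Cauchy-Schwarz and [weighted_bound] give M e. *)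
pose M := 2 * (2 * L * normsq l (C u) + normsq l (C (W u))).
have M0 : 0 <= M.
  by rewrite mulr_ge0// addr_ge0 ?normsq_ge0// mulr_ge0 ?normsq_ge0// mulr_ge0// ltW.
have main (e : R) : 0 < e -> D <= M * e.
  move=> e0; have [S CS HS] := kernel_span_dense bh e0.
  have bS := @bergman_kernel_span _ l _ CS; have bd := bergmanB bh bS.
  have [bWS _] := weighted_bound bS; have [bWd NWd] := weighted_bound bd.
  pose d w := h w - kernel_span l S w.
  rewrite /D; have -> : ip l h (C (W u)) = ip l (kernel_span l S) (C (W u)) + ip l d (C (W u)).
    rewrite -(ipDl bS bd bCWu); apply: eq_ip => // w _.
    by rewrite /d addrC subrK.
  have -> : ip l (W h) (C u) = ip l (W (kernel_span l S)) (C u) + ip l (W d) (C u).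
    rewrite -(ipDl bWS bWd bCu); apply: eq_ip => // w _.
    by rewrite /d -mulrDr addrC subrK.
  rewrite ip_weighted_span// opprD addrACA subrr add0r.
  have c1 := cauchy_schwarz bWd bCu; have c2 := cauchy_schwarz bd bCWu.
  have := normcB (ip l (W d) (C u)) (ip l d (C (W u))).
  have := normsq_ge0 l (C u); have := normsq_ge0 l (C (W u)).
  move: c1 c2 HS NWd; rewrite -/d /M.
  have := normc_ge0 (ip l (W d) (C u) - ip l d (C (W u))).
  move: (normc (_ - _)) (normc (ip l (W d) (C u))) (normc (ip l d (C (W u)))) => x y z.
  move: (normsq l (W d)) (normsq l d) (normsq l (C u)) (normsq l (C (W u))) => A B X Y.
  move=> x0 yA zB Be AB Y0 X0 xyz.
  have h1 : x ^+ 2 <= 2 * (y ^+ 2 + z ^+ 2).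
    have : x ^+ 2 <= (y + z) ^+ 2 by rewrite ler_sqr ?nnegrE// (le_trans x0).
    have := sqr_ge0 (y - z); rewrite !expr2; lra.
  have h2 : A * X <= 2 * L * e * X.
    apply: ler_wpM2r => //; apply: le_trans AB _.
    by rewrite ler_pM2l ?mulr_gt0// ltW.
  have h3 : B * Y <= e * Y by apply: ler_wpM2r => //; exact: ltW.
  have -> : 2 * (2 * L * X + Y) * e = 2 * (2 * L * e * X + e * Y) by ring.
  lra.
apply/ler_addgt0Pr => e e0; rewrite add0r.
have M1 : 0 < M + 1 by rewrite ltr_wpDl.
have eM : 0 < e / (M + 1) by rewrite divr_gt0.
apply: le_trans (main _ eM) _.
by rewrite mulrA ler_pdivrMr// mulrC ler_pM2l// lerDl.
Qed.

Let Wmax_self h : bergman l h -> Wmax l f g h (W h).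
Proof. by move=> bh; exact: (And3 bh (weighted_bound bh).1 (fun _ _ => erefl)). Qed.

Lemma bounded_weighted : bounded_op l (Wmax l f g).
Proof.
split=> [h bh|]; first by exists (W h); exact: Wmax_self.
exists (Num.sqrt (2 * L)); first by rewrite sqrtr_gt0 mulr_gt0.
move=> h k [bh bWh kW].
have Wk : eq_Cplus (W h) k by move=> w Cw; rewrite kW.
rewrite (bergman_normE (eq_Cplus_bergman Wk bWh)) (bergman_normE bh) (eq_normsq l kW).
have L0 : 0 <= 2 * L by rewrite mulr_ge0// ltW.
rewrite -(sqrtrM _ L0); apply: ler_wsqrtr; rewrite mulrCA ler_pM2l.
  exact: (weighted_bound bh).2.
by rewrite invr_gt0 pi_gt0.
Qed.

(** W is defined on the whole space, so density is immediate and [ip_weighted] gives one inclusion.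
    Conversely, a value of the adjoint is determined by its inner products with the kernels, all of
    which lie in the domain. *)
Lemma C_selfadjoint_weighted : C_selfadjoint l C (Wmax l f g).
Proof.
split=> [h e bh e0|u v].
  exists h; first by exists (W h); exact: Wmax_self.
  rewrite (bergman_normE (bergmanB bh bh)) (@eq_normsq _ l _ (fun w => 0 * h w)).
    by rewrite (normsqZ 0 bh) Normc.normc0 expr0n mul0r mulr0 sqrtr0.
  by move=> w _; rewrite mul0r subrr.
split=> [[bu bWu vW]|[w [bCu bw adj] vw]].
  have Wv : eq_Cplus (W u) v by move=> z Cz; rewrite vW.
  have bv := eq_Cplus_bergman Wv bWu.
  exists (C v); last by rewrite CconjK.
  split; [exact: bergman_Cconj|exact: bergman_Cconj|move=> h k [bh bWh kW]].
  have Wk : eq_Cplus (W h) k by move=> z Cz; rewrite kW.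
  rewrite (bergman_innerE (eq_Cplus_bergman Wk bWh) (bergman_Cconj a bu)).
  rewrite (bergman_innerE bh (bergman_Cconj a bv)); congr (_ * _).
  rewrite (@eq_ip _ l _ (W h) (C u) (C u))// ip_weighted//; apply: eq_ip => // z Cz.
  by rewrite /Cconj -vW//; exact: Cplus_conj_shift.
have bu : bergman l u by rewrite -(CconjK a u); exact: bergman_Cconj.
have bWu := (weighted_bound bu).1; have bCWu := bergman_Cconj a bWu.
have wE : eq_Cplus w (C (W u)).
  apply: (ip_eq_kernel_span bw bCWu) => p Cp.
  have bp := bergman_power_kernel l Cp; have bWp := (weighted_bound bp).1.
  rewrite (ip_conj bp bw) (ip_conj bp bCWu); congr conjc.
  rewrite -ip_weighted//; have := adj _ _ (Wmax_self bp).
  rewrite (bergman_innerE bWp bCu) (bergman_innerE bp bw) => /mulfI ->//.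
  by rewrite rc_neq0// invr_eq0 gt_eqF// pi_gt0.
split => // z Cz; rewrite vw// /Cconj wE; last exact: Cplus_conj_shift.
by rewrite -[LHS]/(C (C (W u)) z) CconjK.
Qed.

End WeightedComposition.

Section SufficientCases.
Context {R : realType}.
Variables (l : nat) (a : R) (f g : R[i] -> R[i]).
Implicit Types (w z v : R[i]) (S : seq (R[i] * R[i])).
Local Notation ia := (0 +i* a).

Hypothesis f_analytic : analytic f.
Hypothesis g_analytic : analytic g.
Hypothesis g_Cplus : forall z, Cplus z -> Cplus (g z).

(** Common to all three cases, which then only have to supply F, L and the decomposition into p and
    q. The hypothesis on F without powers is the (l + 2)-nd root of [kernel_symmetry]. *)
Lemma selfadjoint_power_weight (F p q : R[i] -> R[i]) (delta : R[i]) (L : R) :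
  0 < L -> (forall w, Cplus w -> f w = delta * F w ^+ l.+2) ->
  (forall w z, Cplus w -> Cplus z ->
     F w * (w + (g z - ia)) = F z * (g w + (z - ia))) ->
  (forall w v, Cplus w -> Cplus v -> L%:C * (g (w + ia) + conjc (g (v + ia))) -
     F (w + ia) * conjc (F (v + ia)) * (w + conjc v) =
     p w * conjc (p v) + q w * conjc (q v)) ->
  C_selfadjoint l (Cconj a) (Wmax l f g) /\ bounded_op l (Wmax l f g).
Proof.
move=> L0 fF symF Fpq.
have sym w z : Cplus w -> Cplus z ->
    f w * power_kernel l (z - ia) (g w) = f z * power_kernel l (g z - ia) w.
  move=> Cw Cz; rewrite (fF _ Cw) (fF _ Cz) /power_kernel -[LHS]mulrA -[RHS]mulrA -!exprVn -!exprMn.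
  congr (_ * _ ^+ _); have := symF _ _ Cw Cz.
  have n1 : g w + (z - ia) != 0.
    by apply: Cplus_neq0; apply: CplusD; [exact: g_Cplus|apply/Cplus_shiftN].
  have n2 : w + (g z - ia) != 0.
    by apply: Cplus_neq0; apply: CplusD => //; apply/Cplus_shiftN; exact: g_Cplus.
  by move=> H; apply/eqP; rewrite eqr_div//; apply/eqP.
have gp w : Cplus w -> Cplus (g (w + ia)).
  by move=> Cw; apply: g_Cplus; apply/Cplus_shift.
have pos := positive_kernel_power_diff l.+2 (ltW L0) gp Fpq.
have [c c0 nsq] := @normsq_kernel_span R l.
pose L' := normc delta ^+ 2 * L ^+ l.+2.
pose K w v := (w + conjc v : R[i]) ^- l.+2.
have K0 S : in_Cplus S -> 0 <= complex.Re (gram K S).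
  move=> CS; have := normsq_ge0 l (kernel_span l S).
  by rewrite nsq// pmulr_rge0.
have L'0 : 0 <= L' by rewrite mulr_ge0 ?sqr_ge0 ?exprn_ge0// ltW.
(* Adding 1 keeps the constant positive when delta = 0. *)
have L'1 : 0 < L' + 1 by rewrite ltr_wpDl.
have bound S : in_Cplus S ->
    complex.Re (gram (fun p q => f (p + ia) * conjc (f (q + ia)) *
                    (g (p + ia) + conjc (g (q + ia))) ^- l.+2) S) <=
    (L' + 1) * complex.Re (gram K S).
  move=> CS; have := positive_kernelZ (sqr_ge0 (normc delta)) pos CS.
  rewrite (@eq_gram _ _ (fun w v => L'%:C * K w v + (- 1) * (f (w + ia) * conjc (f (v + ia)) *
                    (g (w + ia) + conjc (g (v + ia))) ^- l.+2)) _ CS); last first.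
    move=> w v Cw Cv; rewrite (fF _ ((Cplus_shift a w).2 Cw)) (fF _ ((Cplus_shift a v).2 Cv)).
    rewrite conjcM conjcX !exprMn !exprVn /K /L' (rcM (normc delta ^+ 2)) -(mulcJ delta) (rcX L).
    move: (conjc delta) (conjc (F _)) (_ ^- _) (_ ^- _) => x y x' y'.
    by ring.
  rewrite gramD !gramZ ReCD !ReCM /= !mul0r !subr0.
  have := K0 _ CS; set X := complex.Re _; set Y := complex.Re _.
  rewrite -/L' => X0; lra.
split.
- exact: (C_selfadjoint_weighted f_analytic g_analytic g_Cplus sym L'1 bound).
- exact: (bounded_weighted f_analytic g_analytic g_Cplus sym L'1 bound).
Qed.

Lemma sqrt_mulJ (r : R) : 0 <= r -> (Num.sqrt r)%:C * conjc (Num.sqrt r)%:C = r%:C.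
Proof. by move=> r0; rewrite conjc_real -rcM -expr2 sqr_sqrtr. Qed.

Lemma selfadjoint_translation : case_translation f g ->
  C_selfadjoint l (Cconj a) (Wmax l f g) /\ bounded_op l (Wmax l f g).
Proof.
move=> [gamma [lambda [gamma0 H]]].
have g2 : 0 <= 2 * complex.Re gamma by rewrite mulr_ge0.
(* With F = 1 and L = 1 the difference is the constant gamma + conj gamma = 2 Re gamma >= 0, a
   rank-one kernel through its square root. *)
apply: (@selfadjoint_power_weight (fun=> 1)
  (fun=> (Num.sqrt (2 * complex.Re gamma))%:C) (fun=> 0) lambda 1) => //.
- by move=> w Cw; rewrite expr1n mulr1 (H w Cw).2.
- by move=> w z Cw Cz; rewrite (H w Cw).1 (H z Cz).1; ring.
- move=> w v Cw Cv; rewrite (H _ ((Cplus_shift a w).2 Cw)).1 (H _ ((Cplus_shift a v).2 Cv)).1.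
  rewrite sqrt_mulJ// mul0r addr0.
  by apply: complex_ext; rewrite !ReImE /=; ring.
Qed.

(** In s = 1 / (w + m) and t = 1 / (v + m) the kernel to decompose is 2 Re m s conj(t) + b s +
    conj(b t) + 2 L Re m with b = kappa L - 1. It is a hermitian form on the vectors (s, 1), and the
    third hypothesis says that its determinant is nonnegative. The value kappa = 0 covers the
    constant case. *)
Lemma selfadjoint_fractional (m kappa delta : R[i]) (L : R) :
  0 <= complex.Re m -> 0 < L ->
  normc (kappa * L%:C - 1) ^+ 2 <= 4 * complex.Re m ^+ 2 * L ->
  (forall w, Cplus w -> g w = m + kappa / (w - ia + m) /\
     f w = delta / (w - ia + m) ^+ l.+2) ->
  C_selfadjoint l (Cconj a) (Wmax l f g) /\ bounded_op l (Wmax l f g).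
Proof.
move=> m0 L0 cond H.
have Cm w : Cplus w -> w + m != 0.
  by move=> Cw; apply: Cplus_neq0; rewrite /Cplus /= ReCD ltr_wpDr.
have [p [q pq]] : exists p q : R[i] -> R[i], forall s t,
    (2 * complex.Re m)%:C * (s * conjc t) + (kappa * L%:C - 1) * s +
    conjc ((kappa * L%:C - 1) * t) + (2 * complex.Re m * L)%:C =
    p s * conjc (p t) + q s * conjc (q t).
  move: cond; move: (kappa * L%:C - 1) => b cond.
  have [m1|m1] := eqVneq (complex.Re m) 0.
    exists (fun=> 0), (fun=> 0) => s t.
    have b0 : b = 0.
      apply/eqP; rewrite -normc_eq0 -sqrf_eq0 eq_le sqr_ge0 andbT.
      by move: cond; rewrite m1 expr0n /= mulr0 mul0r.
    by apply: complex_ext; rewrite m1 b0 !ReImE /=; ring.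
  have m2 : 0 < complex.Re m by rewrite lt_def m1.
  have r0 : 0 <= 2 * complex.Re m * L - normc b ^+ 2 / (2 * complex.Re m).
    rewrite subr_ge0 ler_pdivrMr ?mulr_gt0//.
    move: cond; set X := _ ^+ 2; set Y := _ * L; set Z := _ * (_ * _).
    by have -> : Z = Y by rewrite /Y /Z; ring.
  (* Completing the square in s; the remaining constant is nonnegative by [r0]. *)
  exists (fun s => (Num.sqrt (2 * complex.Re m))%:C *
              (s + conjc b / (2 * complex.Re m)%:C)).
  exists (fun=> (Num.sqrt (2 * complex.Re m * L - normc b ^+ 2 / (2 * complex.Re m)))%:C).
  move=> s t; rewrite (sqrt_mulJ r0).
  rewrite [in RHS]conjcM mulrACA sqrt_mulJ ?mulr_ge0//.
  rewrite -rcV conjcD !conjcM conjc_real conjcK rcD rcN (rcM (normc b ^+ 2)) -(mulcJ b) !rcV !rcM.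
  have n1 : (complex.Re m)%:C != 0 by exact: rc_neq0.
  move: n1 (conjc b) (conjc t) => n1 x y; field.
  by rewrite n1.
apply: (@selfadjoint_power_weight (fun w => (w - ia + m)^-1)
   (fun w => p ((w + m)^-1)) (fun w => q ((w + m)^-1)) delta L) => //.
- by move=> w Cw; rewrite (H w Cw).2 exprVn.
- move=> w z Cw Cz; rewrite (H w Cw).1 (H z Cz).1.
  have n1 : w - ia + m != 0 by apply: Cm; apply/Cplus_shiftN.
  have n2 : z - ia + m != 0 by apply: Cm; apply/Cplus_shiftN.
  by field; rewrite n1 n2.
- move=> w v Cw Cv; rewrite -pq.
  rewrite (H _ ((Cplus_shift a w).2 Cw)).1 (H _ ((Cplus_shift a v).2 Cv)).1 !addrK.
  have n1 := Cm w Cw; have n2 : conjc v + conjc m != 0.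
    by rewrite -conjcD conjc_eq0 Cm.
  have -> : (2 * complex.Re m)%:C = m + conjc m.
    by apply: complex_ext; rewrite !ReImE /=; ring.
  rewrite rcM.
  have -> : (2 * complex.Re m)%:C = m + conjc m.
    by apply: complex_ext; rewrite !ReImE /=; ring.
  rewrite !(conjcD, conjcM, conjcB, conjc_inv) (conjc_real L).
  move: n1 n2; move: (conjc m) (conjc v) (conjc kappa) L%:C => m' v' k' L' n1 n2.
  by field; rewrite n1 n2.
Qed.

Lemma selfadjoint_constant : case_constant l a f g ->
  C_selfadjoint l (Cconj a) (Wmax l f g) /\ bounded_op l (Wmax l f g).
Proof.
move=> [m [delta [m0 H]]]; have m1 : 0 < complex.Re m := m0.
have m2 : 0 < 4 * complex.Re m ^+ 2 by rewrite mulr_gt0// exprn_gt0.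
(* For kappa = 0 the determinant condition reads 1 <= 4 (Re m)^2 L; this L gives equality. *)
apply: (@selfadjoint_fractional m 0 delta (4 * complex.Re m ^+ 2)^-1).
- exact: ltW.
- by rewrite invr_gt0.
- by rewrite mul0r sub0r normcN Normc.normc1 expr1n mulfV// gt_eqF.
- move=> w Cw; have [-> ->] := H w Cw.
  by rewrite mul0r addr0 addn2 addrAC.
Qed.

(** Here m = - beta / alpha, kappa = - 2 / alpha and L = |alpha| / 2 = 1 / |kappa|. Then kappa L has
    modulus 1, |kappa L - 1|^2 = 2 + 2 |alpha| Re (1 / alpha), and the determinant condition becomes
    exactly Re (1 / alpha) + 1 / |alpha| <= (Re m)^2. *)
Lemma selfadjoint_case_fractional : case_fractional l a f g ->
  C_selfadjoint l (Cconj a) (Wmax l f g) /\ bounded_op l (Wmax l f g).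
Proof.
move=> [alpha [beta [delta [a0 cond H]]]].
have A0 : 0 < normc alpha by rewrite normc_gt0.
pose x := complex.Re (1 / alpha); pose y := complex.Im (1 / alpha).
have xy : normc alpha ^+ 2 * (x ^+ 2 + y ^+ 2) = 1.
  rewrite -normc_sqr -exprMn -Normc.normcM mulrCA mulfV// mulr1 Normc.normc1.
  by rewrite expr1n.
have [m1 m2] : 0 <= complex.Re (- (beta / alpha)) /\
    x + 1 / normc alpha <= complex.Re (- (beta / alpha)) ^+ 2.
  rewrite ReCN sqrrN -/x; case: cond => [[-> y0 x0]|[b0 b1]]; last first.
    by split; [rewrite oppr_ge0 ltW|].
  (* In this alternative 1 / alpha is a negative real, so x = - 1 / |alpha| and both sides of the
     inequality are 0. *)
  split; first by rewrite oppr0.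
  rewrite expr0n /=; move: xy; rewrite {1}/y y0 expr0n addr0 -exprMn => /eqP.
  rewrite sqrf_eq1 => /orP[] /eqP e.
    have : 0 < normc alpha * x by rewrite e.
    by rewrite pmulr_rgt0// ltNge ltW.
  have -> : x = - (1 / normc alpha).
    apply: (mulfI (lt0r_neq0 A0)).
    by rewrite e mulrN mulrCA mulfV ?mulr1// gt_eqF.
  by rewrite addNr.
apply: (@selfadjoint_fractional (- (beta / alpha)) (- (2 / alpha))
   (delta / alpha ^+ l.+2) (normc alpha / 2)) => //.
- by rewrite divr_gt0.
- have E : - (2 / alpha) * (normc alpha / 2)%:C - 1 =
      - ((normc alpha)%:C * (1 / alpha) + 1).
    by rewrite rcM rcV rc_nat; field.
  have N (r : R) s : normc (r%:C * s + 1) ^+ 2 =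
      r ^+ 2 * (complex.Re s ^+ 2 + complex.Im s ^+ 2) + 2 * (r * complex.Re s) + 1.
    by rewrite normc_sqr !ReImE /=; ring.
  rewrite E normcN N -/x -/y.
  rewrite xy; have : normc alpha * (x + 1 / normc alpha) <= normc alpha * complex.Re (- (beta / alpha)) ^+ 2.
    by rewrite ler_pM2l.
  rewrite mulrDr mulrCA mulfV ?gt_eqF// mulr1 ReCN sqrrN.
  set X := complex.Re _ ^+ 2; have -> : 4 * X * (normc alpha / 2) = 2 * (normc alpha * X) by field.
  by lra.
- move=> w Cw; have [-> ->] := H w Cw.
  have -> : alpha * (w - ia) - beta = alpha * (w - ia + - (beta / alpha)) by field.
  rewrite addn2 exprMn invfM; split; last first.
    by rewrite -[RHS]mulrA -invfM.
  by rewrite mulNr mulrA.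
Qed.

Theorem selfadjoint_cases :
  [\/ case_constant l a f g, case_translation f g | case_fractional l a f g] ->
  C_selfadjoint l (Cconj a) (Wmax l f g) /\ bounded_op l (Wmax l f g).
Proof.
case.
- exact: selfadjoint_constant.
- exact: selfadjoint_translation.
- exact: selfadjoint_case_fractional.
Qed.

End SufficientCases.

(** * Classification *)

Section NecessaryCases.
Context {R : realType}.
Variables (l : nat) (a : R) (f g : R[i] -> R[i]).
Implicit Types (w z v : R[i]).
Local Notation ia := (0 +i* a).
Local Notation C := (Cconj a).
Local Notation E := (power_kernel l).

Hypothesis g_Cplus : forall z, Cplus z -> Cplus (g z).

(** For every h in the domain, <W h, E_(conj z)> = c f(z) h(g(z)) by the reproducing property, so
    the adjoint maps E_(conj z) to conj(f z) E_(conj(g z)). Since C E_(z - ia) = E_(conj z),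
    selfadjointness then puts E_(z - ia) in the domain of W and gives its image. *)
Lemma selfadjoint_kernel_symmetry : C_selfadjoint l C (Wmax l f g) ->
  forall w z, Cplus w -> Cplus z -> f w * E (z - ia) (g w) = f z * E (g z - ia) w.
Proof.
move=> [_ sa] w z Cw Cz; have [c c0 rep] := @reproducing R l.
have Cz' : Cplus (z - ia) by apply/Cplus_shiftN.
have bE := bergman_power_kernel l Cz'.
have bg := bergman_power_kernel l (Cplus_conj (g_Cplus Cz)).
pose k v := conjc (f z) * E (conjc (g z)) v.
have CE : C (E (z - ia)) = E (conjc z).
  apply/funext => v; rewrite /Cconj conj_power_kernel /power_kernel.
  by rewrite conjcD conjcK conjcB !conjc_ia opprK addrACA addNr addr0.
have bz := bergman_power_kernel l (Cplus_conj Cz).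
have adj : adjoint l (Wmax l f g) (C (E (z - ia))) k.
  rewrite CE; split; [exact: bz|exact: (bergmanZ (conjc (f z)) bg)|].
  move=> h h' [bh bWh h'W].
  have bh' : bergman l h' by apply: eq_Cplus_bergman bWh => v Cv; rewrite h'W.
  rewrite (bergman_innerE bh' bz) (bergman_innerE bh (bergmanZ (conjc (f z)) bg)).
  rewrite (ipZr _ bh bg) conjcK (rep _ _ Cz bh') (rep _ _ (g_Cplus Cz) bh) h'W//.
  by congr (_ * _); rewrite mulrCA.
have [_ _ H] := (sa (E (z - ia)) (C k)).2 (ex_intro2 _ _ k adj (fun _ _ => erefl)).
rewrite -H// /Cconj /k conjcM conjcK; congr (_ * _).
rewrite conj_power_kernel conjcK /power_kernel.
by rewrite conjcD conjcK conjc_ia addrAC addrA.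
Qed.

End NecessaryCases.

(** * Analytic functions with values in the roots of unity *)

Section RootOfUnity.
Context {R : realType}.
Implicit Types (w z v : R[i]).

(** In x^(n + 1) - 1 = (x - 1) s(x) the second factor is n + 1 at x = 1, hence nonzero nearby by
    continuity. *)
Lemma root_of_unity_isolated n : exists2 d : R, 0 < d &
  forall x : R[i], x ^+ n.+1 = 1 -> normc (x - 1) < d -> x = 1.
Proof.
pose s x : R[i] := \sum_(i < n.+1) x ^+ i.
have ds : Cdifferentiable s 1.
  rewrite /s; elim: n.+1 => [|m IH].
    apply: (Cdifferentiable_near ltr01 _ (Cdifferentiable_cst 0 1)) => v _.
    by rewrite big_ord0.
  apply: (Cdifferentiable_near ltr01 _
    (CdifferentiableD IH (CdifferentiableX m (Cdifferentiable_id 1)))) => v _.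
  by rewrite big_ord_recr.
have n0 : 0 < n.+1%:R :> R by rewrite ltr0n.
have [d d0 H] := Cdifferentiable_continuous ds n0.
exists d => // x x1 xd; apply/eqP; rewrite -subr_eq0.
have /eqP : (x - 1) * s x = 0 by rewrite -subrX1 x1 subrr.
rewrite mulf_eq0 => /orP[//|/eqP sx].
have := H x xd; rewrite sx sub0r normcN.
have -> : s 1 = (n.+1%:R : R)%:C.
  rewrite rc_nat /s (eq_bigr (fun=> 1)) => [|i _]; last by rewrite expr1n.
  by rewrite sumr_const card_ord.
by rewrite normcC ger0_norm ?ltxx// ltW.
Qed.

Lemma Cplus_segment w z (t : R) : Cplus w -> Cplus z -> 0 <= t <= 1 ->
  Cplus (w + t%:C * (z - w)).
Proof.
rewrite /Cplus /= => w0 z0 /andP[t0 t1].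
rewrite ReCD ReCM ReCD ReCN /= mul0r subr0.
have [->|t0'] := eqVneq t 0; first by rewrite mul0r addr0.
have : 0 < t * complex.Re z by rewrite mulr_gt0// lt_def t0'.
have : 0 <= (1 - t) * complex.Re w by rewrite mulr_ge0 ?subr_ge0// ltW.
lra.
Qed.

(** Along the segment from w to z the distance from rho to 1 is continuous, starts at 0, and takes
    no value strictly between 0 and d; by the intermediate value theorem it never reaches d. *)
Lemma root_of_unity_constant n (rho : R[i] -> R[i]) w z :
  analytic rho -> (forall v, Cplus v -> rho v ^+ n.+1 = 1) ->
  Cplus w -> Cplus z -> rho w = 1 -> rho z = 1.
Proof.
move=> ar r1 Cw Cz rw; have [d d0 H] := @root_of_unity_isolated n.
pose p (t : R) := w + t%:C * (z - w).
pose phi (t : R) : R := normc (rho (p t) - 1).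
have p1 : p 1 = z by rewrite /p mul1r addrC subrK.
have phi0 : phi 0 = 0 by rewrite /phi /p mul0r addr0 rw subrr Normc.normc0.
have cphi : {within `[0, 1], continuous phi}.
  apply: continuous_in_subspaceT => t; rewrite inE /= in_itv /= => t01.
  have Cp := Cplus_segment Cw Cz t01.
  have crho := Cdifferentiable_continuous ((analyticP _).1 ar _ Cp).
  apply/cvgrPdist_lt => e e0; have [r r0 Hr] := crho _ e0.
  have K0 : 0 < normc (z - w) + 1 by rewrite ltr_wpDl ?normc_ge0.
  near=> s.
  have st : `|t - s| < r / (normc (z - w) + 1).
    by near: s; apply: cvgr_dist_lt; rewrite ?divr_gt0//; exact: cvg_id.
  rewrite /phi; apply: le_lt_trans (_ : normc (rho (p s) - rho (p t)) < e).
    rewrite ler_norml; apply/andP; split.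
      rewrite lerNl opprB (le_trans (lerB_normc _ _))//.
      by rewrite opprB addrA subrK.
    rewrite (le_trans (lerB_normc _ _))// opprB addrA subrK.
    by rewrite normcBC.
  apply: Hr.
  have -> : p s - p t = (s - t)%:C * (z - w) by rewrite /p rcD rcN; ring.
  rewrite Normc.normcM normcC distrC.
  rewrite ltr_pdivlMr// in st; apply: le_lt_trans st.
  by rewrite ler_wpM2l ?lerDl.
rewrite -p1; apply: (H); first by rewrite p1 r1.
rewrite ltNge; apply/negP => dphi.
have d2 : Num.min (phi 0) (phi 1) <= d / 2 <= Num.max (phi 0) (phi 1).
  rewrite phi0 ge_min le_max; apply/andP; split; apply/orP; [left|right].
    by rewrite divr_ge0// ltW.
  by apply: le_trans dphi; rewrite ler_pdivrMr// ler_peMr ?ler1n// ltW.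
have [t + phit] := IVT ler01 cphi d2.
rewrite in_itv /= => t01; have Cp := Cplus_segment Cw Cz t01.
have := H (rho (p t)) (r1 _ Cp); rewrite -/(phi t) phit => rt.
have d1 : d / 2 < d by rewrite ltr_pdivrMr// ltr_pMr// ltr1n.
move: phit; rewrite /phi rt// subrr Normc.normc0 => /esym/eqP.
by rewrite mulf_eq0 invr_eq0 gt_eqF//= pnatr_eq0.
Unshelve. all: by end_near.
Qed.

End RootOfUnity.

Section NecessaryForm.
Context {R : realType}.
Variables (l : nat) (a : R) (f g : R[i] -> R[i]).
Implicit Types (w z v : R[i]).
Local Notation ia := (0 +i* a).
Local Notation E := (power_kernel l).

Hypothesis g_analytic : analytic g.
Hypothesis g_Cplus : forall z, Cplus z -> Cplus (g z).
Hypothesis kernel_symmetry : forall w z, Cplus w -> Cplus z ->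
  f w * E (z - ia) (g w) = f z * E (g z - ia) w.
Hypothesis f_neq0 : exists2 w, Cplus w & f w != 0.

Let A w z : R[i] := w + (g z - ia).

Let CA w z : Cplus w -> Cplus z -> Cplus (A w z).
Proof. by move=> Cw Cz; apply: CplusD => //; apply/Cplus_shiftN; exact: g_Cplus. Qed.

Let A0 w z : Cplus w -> Cplus z -> A w z != 0.
Proof. by move=> Cw Cz; apply: Cplus_neq0; exact: CA. Qed.

Let fA w z : Cplus w -> Cplus z -> f w * A w z ^+ l.+2 = f z * A z w ^+ l.+2.
Proof.
move=> Cw Cz; have := kernel_symmetry Cw Cz; rewrite /power_kernel.
have -> : g w + (z - ia) = A z w by rewrite addrA addrAC addrC.
rewrite -/(A w z) => /eqP; rewrite eqr_div ?expf_neq0 ?A0//.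
by move=> /eqP.
Qed.

Let f_unit z : Cplus z -> f z != 0.
Proof.
have [w Cw fw] := f_neq0 => Cz; apply/negP => /eqP fz.
have := fA Cw Cz; rewrite fz mul0r => /eqP; rewrite mulf_eq0 (negPf fw) /=.
by rewrite (negPf (expf_neq0 _ (A0 Cw Cz))).
Qed.

Let analytic_A w : analytic (A w).
Proof.
apply/analyticP => v Cv; apply: CdifferentiableD; first exact: Cdifferentiable_cst.
by apply: CdifferentiableD; [by have /analyticP := g_analytic; apply|exact: Cdifferentiable_cst].
Qed.

Let analytic_Al w : analytic (A^~ w).
Proof.
apply/analyticP => v Cv; apply: CdifferentiableD; first exact: Cdifferentiable_id.
exact: Cdifferentiable_cst.
Qed.

Let C1 : Cplus (1 : R[i]). Proof. by rewrite /Cplus /= ltr01. Qed.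

(** An explicit analytic root of f(1) / f(z) of order l + 2, read off from the symmetry relation at
    w = 1; no branch of a root has to be chosen. *)
Let P z := A z 1 / A 1 z.

Let P0 z : Cplus z -> P z != 0.
Proof. by move=> Cz; rewrite mulf_neq0 ?invr_neq0 ?A0. Qed.

Let fP z : Cplus z -> f z * P z ^+ l.+2 = f 1.
Proof.
move=> Cz; rewrite /P expr_div_n mulrA -(fA C1 Cz) mulfK//.
by rewrite expf_neq0// A0.
Qed.

Let analytic_P : analytic P.
Proof.
apply/analyticP => v Cv; apply: (@CdifferentiableM _ (A^~ 1) (fun v => (A 1 v)^-1)).
  by have /analyticP := @analytic_Al 1; apply.
apply: (@CdifferentiableV _ (A 1)); first exact: A0.
by have /analyticP := @analytic_A 1; apply.
Qed.

(* The quotient of the two sides is an analytic n-th root of unity in [z]. *)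
Let AP w z : Cplus w -> Cplus z -> A w z * P z = A z w * P w.
Proof.
move=> Cw Cz; pose rho v := A w v * P v / (A v w * P w).
have den v : Cplus v -> A v w * P w != 0 by move=> Cv; rewrite mulf_neq0 ?A0 ?P0.
have arho : analytic rho.
  apply/analyticP => v Cv.
  apply: (@CdifferentiableM _ (fun v => A w v * P v) (fun v => (A v w * P w)^-1)).
    apply: (@CdifferentiableM _ (A w) P); first by have /analyticP := @analytic_A w; apply.
    by have /analyticP := analytic_P; apply.
  apply: (@CdifferentiableV _ (fun v => A v w * P w)); first exact: den.
  apply: (@CdifferentiableM _ (A^~ w) (fun=> P w)); last exact: Cdifferentiable_cst.
  by have /analyticP := @analytic_Al w; apply.
have rho1 v : Cplus v -> rho v ^+ l.+2 = 1.
  move=> Cv; rewrite /rho expr_div_n (exprMn _ (A w v)) (exprMn _ (A v w)).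
  have e1 := fA Cw Cv; have e2 := fP Cv; have e3 := fP Cw.
  have n1 := f_unit Cv; have n2 := f_unit Cw.
  have d0 : A v w ^+ l.+2 * P w ^+ l.+2 != 0 by rewrite -exprMn; apply: expf_neq0; exact: den.
  rewrite -[RHS](mulfV d0); congr (_ / _).
  apply: (mulfI n2); apply: (mulfI n1).
  move: e1 e2 e3; set x := A w v ^+ _; set y := A v w ^+ _; set s := P v ^+ _; set t := P w ^+ _.
  move=> e1 e2 e3.
  transitivity ((f w * x) * (f v * s)); first by ring.
  by rewrite e1 e2 -e3; ring.
have rw : rho w = 1 by rewrite /rho mulfV// den.
have := root_of_unity_constant arho rho1 Cw Cz rw.
by move=> /(canRL (mulfVK (den z Cz))); rewrite mul1r.
Qed.

(** As A 2 z - A 1 z = 1, P z is the difference of A 2 z P z and A 1 z P z, which [AP] turns into A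
    z 2 P 2 - A z 1 P 1, affine in z. The relation at w = 1 then determines (g z - ia) P z, and P 1
    = al + eta makes eta its leading coefficient. *)
Lemma weight_affine : exists al eta r : R[i], forall z, Cplus z ->
  [/\ al * z + eta != 0, f z = f 1 / (al * z + eta) ^+ l.+2
    & (g z - ia) * (al * z + eta) = eta * z + r].
Proof.
have C2 : Cplus (2 : R[i]) by rewrite -rc_nat /Cplus /= ltr0n.
pose Q z := (g z - ia) * P z.
pose al := P 2 - P 1; pose eta := Q 2 - Q 1.
have PE z : Cplus z -> P z = al * z + eta.
  move=> Cz; have e1 := AP C1 Cz; have e2 := AP C2 Cz.
  have -> : P z = A 2 z * P z - A 1 z * P z by rewrite /A; ring.
  by rewrite e1 e2 /al /eta /Q /A; ring.
have P1 : P 1 = al + eta by rewrite (PE 1 C1) mulr1.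
exists al, eta, (Q 1 - eta) => z Cz; rewrite -(PE z Cz); split; first exact: P0.
  by apply: (canRL (mulfK _)); [rewrite expf_neq0// P0|exact: fP].
have -> : (g z - ia) * P z = A 1 z * P z - P z by rewrite /A; ring.
rewrite (AP C1 Cz) (PE z Cz) /Q P1 /A.
by ring.
Qed.

End NecessaryForm.

Section Classification.
Context {R : realType}.
Variables (l : nat) (a : R) (f g : R[i] -> R[i]).
Implicit Types (w z v : R[i]).
Local Notation ia := (0 +i* a).

Hypothesis g_Cplus : forall z, Cplus z -> Cplus (g z).

Lemma ge0_at_right (A B C : R) : (forall e, 0 < e -> 0 < A + B * e + C * e ^+ 2) ->
  0 <= A.
Proof.
move=> H; rewrite leNgt; apply/negP => A0.
pose M := `|B| + `|C|; have M0 : 0 <= M by rewrite addr_ge0.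
have d0 : 0 < M - A by lra.
(* For A < 0 this e lies in ]0, 1], so the expression is at most A + M e = - A^2 / (M - A) < 0. *)
pose e := - A / (M - A).
have e0 : 0 < e by rewrite divr_gt0// oppr_gt0.
have e1 : e <= 1 by rewrite ler_pdivrMr// mul1r; lra.
have Be : B * e <= `|B| * e by rewrite ler_pM2r// ler_norm.
have Ce : C * e ^+ 2 <= `|C| * e.
  apply: le_trans (_ : `|C| * e ^+ 2 <= _).
    by rewrite ler_pM2r ?exprn_gt0// ler_norm.
  by rewrite ler_wpM2l// expr2 ger_pMr.
have Me : M * e + A = A * (- A / (M - A)).
  by rewrite /e; field; rewrite gt_eqF.
have : A * (- A / (M - A)) < 0 by rewrite pmulr_llt0.
have : M * e = `|B| * e + `|C| * e by rewrite mulrDl.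
by have := H e e0; move: Be Ce Me; rewrite -/e; lra.
Qed.

(* On the boundary line Re v = m1 the quadratic form m1 |v|^2 + Re (kappa v^-)
   is nonnegative; its discriminant gives the bound. *)
Lemma fractional_parameters (m kappa : R[i]) :
  (forall v, complex.Re m < complex.Re v ->
     v != 0 /\ 0 < complex.Re (m + kappa / v)) ->
  0 <= complex.Re m /\
  normc kappa - complex.Re kappa <= 2 * complex.Re m ^+ 2.
Proof.
move=> H; set m1 := complex.Re m; set k1 := complex.Re kappa; set k2 := complex.Im kappa.
have m0 : 0 <= m1.
  by rewrite leNgt; apply/negP => m0; have [] := H 0 m0; rewrite eqxx.
have quad y (e : R) : 0 < e ->
    0 < m1 * ((m1 + e) ^+ 2 + y ^+ 2) + k1 * (m1 + e) + k2 * y.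
  move=> e0; pose v := (m1 + e) +i* y.
  have [v0 pos] : v != 0 /\ 0 < complex.Re (m + kappa / v) by apply: H; rewrite /= ltrDl.
  have N0 : 0 < normc v ^+ 2 by rewrite exprn_gt0// normc_gt0.
  have : 0 < normc v ^+ 2 * complex.Re (m + kappa / v) by rewrite mulr_gt0.
  have -> : kappa / v = ((normc v ^+ 2)^-1)%:C * (kappa * conjc v).
    rewrite rcV -mulcJ; have : conjc v != 0 by rewrite conjc_eq0.
    by move: (conjc v) => v' v'0; field; rewrite v0 v'0.
  have RK : complex.Re (kappa * conjc v) = k1 * (m1 + e) + k2 * y.
    by rewrite ReCM Re_conjc Im_conjc mulrN opprK.
  rewrite ReCD Re_rcM RK mulrDr mulVKf ?gt_eqF// normc_sqr -/m1.
  by rewrite addrA (mulrC _ m1).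
have line y : 0 <= m1 * (m1 ^+ 2 + y ^+ 2) + k1 * m1 + k2 * y.
  apply: (@ge0_at_right _ (2 * m1 ^+ 2 + k1) m1) => e e0.
  by have := quad y e e0; congr (0 < _); ring.
split => //.
have kk : normc kappa ^+ 2 = k1 ^+ 2 + k2 ^+ 2 by rewrite normc_sqr.
suff [h1 h2] : 0 <= 2 * m1 ^+ 2 + k1 /\ normc kappa ^+ 2 <= (2 * m1 ^+ 2 + k1) ^+ 2.
  by move: h2; rewrite ler_sqr ?nnegrE ?normc_ge0// => h2; lra.
rewrite kk.
(* For m1 = 0 the boundary form is k2 y, nonnegative for both signs of y, so k2 = 0; a point inside
   the half-plane then gives k1 > 0. *)
have [m10|m10] := eqVneq m1 0.
  have k2e : k2 = 0.
    by have := line 1; have := line (-1); rewrite m10 !mul0r !mulr0 !add0r; lra.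
  have := quad 0 1 ltr01; rewrite m10 k2e !mul0r !add0r addr0 mulr1 => k10.
  by rewrite expr0n /= mulr0 add0r addr0; split; [exact: ltW|].
have mp : 0 < m1 by rewrite lt_def m10.
(* The minimizer of the form in y. Multiplied by 4 m1, the minimum is (2 m1^2 + k1)^2 -
   |kappa|^2. *)
have := line (- k2 / (2 * m1)) => D.
have {D} : 0 <= 4 * m1 * (m1 * (m1 ^+ 2 + (- k2 / (2 * m1)) ^+ 2) + k1 * m1 + k2 * (- k2 / (2 * m1))).
  by rewrite mulr_ge0// mulr_ge0.
have -> : 4 * m1 * (m1 * (m1 ^+ 2 + (- k2 / (2 * m1)) ^+ 2) + k1 * m1 + k2 * (- k2 / (2 * m1)))
   = 4 * m1 ^+ 2 * (m1 ^+ 2 + k1) - k2 ^+ 2 by field.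
move=> D; split; last first.
  by rewrite -subr_ge0; congr (0 <= _): D; ring.
have : 0 <= 4 * m1 ^+ 2 * (m1 ^+ 2 + k1) by have := sqr_ge0 k2; lra.
rewrite pmulr_rge0 ?mulr_gt0 ?exprn_gt0// => h.
by have := sqr_ge0 m1; lra.
Qed.

Lemma case_of_fractional (m kappa delta : R[i]) : kappa != 0 ->
  (forall w, Cplus w -> [/\ w - ia + m != 0, g w = m + kappa / (w - ia + m)
     & f w = delta / (w - ia + m) ^+ l.+2]) ->
  case_fractional l a f g.
Proof.
move=> k0 H.
have [m0 cond] : 0 <= complex.Re m /\
    normc kappa - complex.Re kappa <= 2 * complex.Re m ^+ 2.
  apply: fractional_parameters => v vm.
  have Cw : Cplus (v - m + ia).
    by apply/Cplus_shift; rewrite /Cplus /= ReCD ReCN subr_gt0.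
  have [n1 gw _] := H _ Cw; have Cg := g_Cplus Cw.
  move: n1 gw Cg; rewrite addrK subrK => n1 ->.
  by rewrite /Cplus /=.
have n0 : 0 < normc kappa by rewrite normc_gt0.
(* Solves m = - beta / alpha and kappa = - 2 / alpha; the power of alpha in the third witness
   compensates the one extracted from the denominator of f. *)
exists (- (2 / kappa)), (2 * m / kappa), (delta * (- (2 / kappa)) ^+ l.+2).
have two0 : (2 : R[i]) != 0 by rewrite pnatr_eq0.
have al0 : - (2 / kappa) != 0 by rewrite oppr_eq0 mulf_neq0 ?invr_neq0.
have -> : 2 * m / kappa / (- (2 / kappa)) = - m by field; rewrite k0.
have -> : 1 / (- (2 / kappa)) = (- (2^-1))%:C * kappa.
  by rewrite rcN rcV rc_nat; field; rewrite k0.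
have -> : normc (- (2 / kappa)) = 2 / normc kappa.
  by rewrite normcN Normc.normcM Normc.normcV -rc_nat normcC ger0_norm.
split => //.
- have -> : 1 / (2 / normc kappa) = normc kappa / 2 by field; rewrite gt_eqF.
  rewrite ReCN !ReCM ImCM /= !mul0r subr0 addr0 sqrrN.
  (* When Re m = 0 the bound says |kappa| <= Re kappa, so kappa is real and positive: the first
     alternative. Otherwise the bound is the inequality of the second one. *)
  have [m1|m1] := eqVneq (complex.Re m) 0.
    left; move: cond; rewrite m1 expr0n /= mulr0 subr_le0 => cond.
    have := normc_sqr kappa => nn.
    have k1 : 0 < complex.Re kappa by exact: lt_le_trans cond.
    have : normc kappa ^+ 2 <= complex.Re kappa ^+ 2.
      by rewrite ler_sqr ?nnegrE ?normc_ge0// ltW.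
    rewrite nn gerDl => k2.
    have /eqP : complex.Im kappa ^+ 2 = 0 by apply/eqP; rewrite eq_le k2 sqr_ge0.
    rewrite sqrf_eq0 => /eqP ->; rewrite oppr0 mulr0; split => //.
    by rewrite mulNr oppr_lt0 mulr_gt0// invr_gt0.
  right; split; first by rewrite oppr_lt0 lt_def m1.
  by lra.
- move=> w Cw; have [n1 -> ->] := H w Cw.
  have -> : - (2 / kappa) * (w - ia) - 2 * m / kappa = - (2 / kappa) * (w - ia + m).
    by field; rewrite k0.
  rewrite addn2 exprMn; split; last first.
    by rewrite [in RHS]invfM [RHS]mulrA mulfK// expf_neq0.
  rewrite opprK; congr (_ + _); move: n1; move: (w - ia + m) => v n1.
  by field; rewrite k0 n1.
Qed.

Lemma cases_of_affine (c al eta r : R[i]) :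
  (forall z, Cplus z -> [/\ al * z + eta != 0, f z = c / (al * z + eta) ^+ l.+2
    & (g z - ia) * (al * z + eta) = eta * z + r]) ->
  [\/ case_constant l a f g, case_translation f g | case_fractional l a f g].
Proof.
move=> H.
have C1 : Cplus (1 : R[i]) by rewrite /Cplus /= ltr01.
have [al0|al0] := eqVneq al 0.
  apply: Or32; have [eta0 _ _] := H 1 C1; rewrite al0 mul0r add0r in eta0.
  have gE z : Cplus z -> g z = z + (r / eta + ia).
    move=> Cz; have [_ _] := H z Cz; rewrite al0 mul0r add0r => /(canRL (mulfK eta0)) e.
    by rewrite -[LHS](subrK ia) e; field.
  exists (r / eta + ia), (c / eta ^+ l.+2); split.
    (* If Re gam < 0, the point - Re gam / 2 of the half-plane would be sent to one of real part Re
       gam / 2. *)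
    rewrite leNgt; apply/negP => neg; set gam := r / eta + ia in gE neg.
    have Cz : Cplus (- (complex.Re gam / 2))%:C.
      by rewrite /Cplus /= oppr_gt0 pmulr_llt0// invr_gt0.
    have := g_Cplus Cz; rewrite gE// /Cplus /= ReCD /=; lra.
  move=> w Cw; split; first exact: gE.
  by have [_ -> _] := H w Cw; rewrite al0 mul0r add0r.
pose b := eta / al.
have bE z : al * z + eta = al * (z + b) by rewrite /b; field.
have v0 z : Cplus z -> z + b != 0.
  by move=> /H[+ _ _]; rewrite bE mulf_eq0 negb_or => /andP[].
(* The remainder in the division of eta z + r by al z + eta, with quotient b; g is constant exactly
   when it vanishes. *)
pose D := r - eta ^+ 2 / al.
have gE z : Cplus z -> g z = b + ia + D / al / (z + b).
  move=> Cz; have n1 := v0 z Cz; have [_ _] := H z Cz.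
  rewrite bE => /(canRL (mulfK (mulf_neq0 al0 n1))) e.
  rewrite -[LHS](subrK ia) e /D /b; field.
  by have [n2 _ _] := H z Cz; rewrite al0 mulrC n2.
have fE z : Cplus z -> f z = c / al ^+ l.+2 / (z + b) ^+ l.+2.
  by move=> Cz; have [_ -> _] := H z Cz; rewrite bE exprMn [in LHS]invfM [LHS]mulrA.
have zb z : z - ia + (b + ia) = z + b by ring.
have [D0|D0] := eqVneq D 0.
  apply: Or31; exists (b + ia), (c / al ^+ l.+2).
  have gb z : Cplus z -> g z = b + ia by move=> Cz; rewrite gE// D0 !mul0r addr0.
  split=> [|w Cw]; first by rewrite -(gb 1 C1); exact: g_Cplus.
  split; first exact: gb.
  by rewrite fE// addn2 addrA addrK.
apply: Or33; apply: (@case_of_fractional (b + ia) (D / al) (c / al ^+ l.+2)).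
  by rewrite mulf_neq0// invr_neq0.
by move=> w Cw; rewrite zb; split; [exact: v0|exact: gE|exact: fE].
Qed.

End Classification.

(** Supplies boundedness when f vanishes identically and the classification does not apply. *)
Lemma bounded_zero_weight (R : realType) (l : nat) (f g : R[i] -> R[i]) :
  (forall w, Cplus w -> f w = 0) -> bounded_op l (Wmax l f g).
Proof.
move=> f0.
have W0 h : eq_Cplus (fun=> 0) (fun w => f w * h (g w)).
  by move=> w Cw; rewrite f0// mul0r.
split=> [h bh|]; first exists (fun w => f w * h (g w)).
  exact: And3 bh (eq_Cplus_bergman (W0 h) (bergman0 l)) (fun _ _ => erefl).
exists 1; first exact: ltr01.
move=> h k [bh _ kW]; rewrite mul1r.
have k0 : eq_Cplus (fun=> 0) k by move=> w Cw; rewrite kW// f0// mul0r.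
rewrite (bergman_normE (eq_Cplus_bergman k0 (bergman0 l))) (bergman_normE bh).
rewrite -(eq_normsq l k0) (_ : (fun=> 0) = (fun w => 0 * h w)); last first.
  by apply/funext => w; rewrite mul0r.
rewrite (normsqZ 0 bh) Normc.normc0 expr0n mul0r mulr0 sqrtr0.
exact: sqrtr_ge0.
Qed.

Theorem theorem5p3 (R : realType) (l : nat) (a : R) (f g : R[i] -> R[i])
  (f_analytic : analytic f) (g_analytic : analytic g)
  (g_Cplus : forall z, Cplus z -> Cplus (g z)) :
  [/\ [\/ case_constant l a f g, case_translation f g
        | case_fractional l a f g] ->
      C_selfadjoint l (Cconj a) (Wmax l f g),
      (* for f = 0 this implication fails, as Wmax = 0 for every g *)
      (exists2 w, Cplus w & f w != 0) ->
      C_selfadjoint l (Cconj a) (Wmax l f g) ->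
      [\/ case_constant l a f g, case_translation f g
        | case_fractional l a f g]
    & C_selfadjoint l (Cconj a) (Wmax l f g) -> bounded_op l (Wmax l f g)].
Proof.
have cases : (exists2 w, Cplus w & f w != 0) ->
    C_selfadjoint l (Cconj a) (Wmax l f g) -> [\/ case_constant l a f g, case_translation f g
    | case_fractional l a f g].
  move=> f0 sa; have sym := selfadjoint_kernel_symmetry g_Cplus sa.
  have [al [eta [r H]]] := weight_affine g_analytic g_Cplus sym f0.
  exact: cases_of_affine H.
split.
- by move=> /(selfadjoint_cases f_analytic g_analytic g_Cplus)[].
- exact: cases.
- move=> sa; have [f0|f0] := pselect (exists2 w, Cplus w & f w != 0).
    exact: (selfadjoint_cases f_analytic g_analytic g_Cplus (cases f0 sa)).2.
  apply: bounded_zero_weight => w Cw; apply/eqP/negP => /negP fw.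
  by apply: f0; exists w.
Qed.
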